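(* Let $d\ge2$, $q_1,\dots,q_d\ge2$ be integers and let $(Z_n)_{n\ge0}$ be a random walk on $\mathrm{DL}=\mathrm{DL}(q_1,\dots,q_d)$ whose transition matrix $P=(p(x,y))_{x,y\in\mathrm{DL}}$ is stochastic and satisfies: (i) (irreducibility) for all $x,y\in\mathrm{DL}$ there is $n$ with $p^{(n)}(x,y)>0$; (ii) (group-invariance) the group $\Gamma=\{g\in\mathcal A: p(gx,gy)=p(x,y)\ \forall x,y\in\mathrm{DL}\}$ acts transitively on $\mathrm{DL}$; (iii) (finite first moment) $\sum_xp(o,x)\,d(o,x)<\infty$. Then there is a $\Lambda$-valued random variable $Z_\infty$ such that $$\lim_{n\to\infty}Z_n=Z_\infty\quad\Pr_x\text{-almost surely}$$ in the topology of $\widehat{\mathrm{DL}}$, for every $x\in\mathrm{DL}$. The $\Pr_x$-distribution $\nu_x$ of $Z_\infty$ is a Borel probability measure supported by the whole of $\Lambda$. It is a continuous measure (carries no point mass) unless $\Lambda=\{\omega_1\cdots\omega_d\}$ is trivial, which happens precisely when $\alpha_j=0$ for all $j$. The measures $\nu_x$ satisfy $\nu_x=\sum_yp(x,y)\nu_y$ and are mutually absolutely continuous.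
   Context: For an integer $q\ge 2$, $\mathbb T_q$ is the homogeneous tree in which every vertex has $q+1$ neighbours, with graph metric $d(\cdot,\cdot)$, a fixed origin and a fixed end $\omega$ (an end is a class of one-sided infinite geodesic rays, two rays being equivalent if their symmetric difference is finite). Let $x\curlywedge y$ be the first common vertex of the geodesic rays from $x$ and from $y$ that represent $\omega$, and $\mathfrak h(x)=d(x,x\curlywedge o)-d(o,x\curlywedge o)$ the Busemann function. $\partial T$ is the space of ends of a tree $T$, $\partial^*T=\partial T\setminus\{\omega\}$, and $\widehat T=T\cup\partial T$ is the (compact) end compactification. Let $T_j=\mathbb T_{q_j}$ with origin $o_j$ and end $\omega_j$. $\mathrm{DL}(q_1,\dots,q_d)$ has vertex set $\{x_1\cdots x_d\in\prod_jT_j:\sum_j\mathfrak h(x_j)=0\}$; $x_1\cdots x_d\sim y_1\cdots y_d$ iff there are $i\ne j$ with $x_i\sim y_i$, $x_j\sim y_j$, and $x_k=y_k$ for $k\ne i,j$. Its origin is $o=o_1\cdots o_d$. The geometric compactification $\widehat{\mathrm{DL}}$ is the closure of $\mathrm{DL}$ in $\prod_{j=1}^d\widehat T_j$, and $\partial\mathrm{DL}=\widehat{\mathrm{DL}}\setminus\mathrm{DL}$. $\mathrm{Aff}(\mathbb T_q)$ is the group of automorphisms of $\mathbb T_q$ fixing $\omega$; for such $g$, $\mathfrak h(g):=\mathfrak h(gx)-\mathfrak h(x)$ is independent of $x$. $\mathcal A=\{g_1\cdots g_d\in\prod_j\mathrm{Aff}(\mathbb T_{q_j}):\sum_j\mathfrak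 h(g_j)=0\}$ acts on $\mathrm{DL}$ coordinatewise. $p^{(n)}(x,y)$ is the $(x,y)$-entry of $P^n$, and $\Pr_x$ is the law of the random walk with $Z_0=x$. Set $\alpha_j=\sum_{x\in\mathrm{DL}}p(o,x)\,\mathfrak h(x_j)$ (finite by (iii)), $\Lambda_j=\{\omega_j\}$ if $\alpha_j\le0$ and $\Lambda_j=\partial^*T_j$ if $\alpha_j>0$, and $\Lambda=\prod_{j=1}^d\Lambda_j$, a Borel subset of $\partial\mathrm{DL}$. *)

(* Defs.v *)
From HB Require Import structures.
From mathcomp Require Import all_boot all_order all_algebra.
From mathcomp Require Import all_classical all_reals all_analysis.
Set Implicit Arguments.
Unset Strict Implicit.
Unset Printing Implicit Defensive.
Import Order.TTheory GRing.Theory Num.Theory.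
Local Open Scope classical_set_scope.
Local Open Scope ring_scope.

(* The least natural number satisfying P; the value is 0 when there is none. *)
Definition least (P : set nat) : nat :=
  xget 0%N [set n | P n /\ forall m, P m -> (n <= m)%N].

Section Graph.
Variables (V : choiceType) (e : rel V).

Definition gdist (x y : V) : nat :=
  least [set n | exists s, [/\ path e x s, last x s = y & size s = n]].

Definition is_ray (r : nat -> V) : Prop :=
  forall m n, (m <= n)%N -> gdist (r m) (r n) = (n - m)%N.

Definition ray_equiv (r s : nat -> V) : Prop :=
  finite_set ((range r `\` range s) `|` (range s `\` range r)).

(* An end is represented by its equivalence class, a set of rays. *)
Record graph_end := GraphEnd {
  end_rays :> set (nat -> V);
  end_classP : exists2 r, is_ray r &
    end_rays = [set s | is_ray s /\ ray_equiv r s]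
}.

End Graph.

Record homTree (q : nat) := HomTree {
  vertex :> choiceType;
  adj : rel vertex;
  adj_sym : symmetric adj;
  adj_irr : irreflexive adj;
  adj_connected : forall x y, exists2 s, path adj x s & last x s = y;
  adj_acyclic : forall s : seq vertex, (2 < size s)%N -> ~ ucycle adj s;
  adj_regular : forall x, ([set y | adj x y] #= `I_q.+1)%card;
  origin : vertex
}.
Arguments adj {q} h _ _.
Arguments origin {q} h.

Definition tree_end (q : nat) (T : homTree q) := graph_end (adj T).

Section Tree.
Variables (q : nat) (T : homTree q).
Implicit Types (x y z : T) (w xi : tree_end T).

Definition tdist x y : nat := gdist (adj T) x y.

Definition ray_from x xi : nat -> T :=
  xget (fun=> x) [set r | end_rays xi r /\ r 0%N = x].

Definition confluent w x y : T :=
  ray_from x w (least [set n | range (ray_from y w) (ray_from x w n)]).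

Definition busemann w x : int :=
  (tdist x (confluent w x (origin T)))%:Z -
  (tdist (origin T) (confluent w x (origin T)))%:Z.

Lemma busemann_origin w : busemann w (origin T) = 0.
Proof. exact: subrr. Qed.

Definition in_Aff w (g : T -> T) : Prop :=
  [/\ bijective g, forall x y, adj T (g x) (g y) = adj T x y &
      [set g \o r | r in end_rays w] = end_rays w].

(* h(g) = h(g x) - h(x) does not depend on x; it is read off at the origin. *)
Definition busemann_shift w (g : T -> T) : int :=
  busemann w (g (origin T)) - busemann w (origin T).

Variant tree_hat := Vertex of T | End of tree_end T.

(* [cone x y] consists of all z such that the geodesic from x to z passes
   through y. *)
Definition cone x y : set tree_hat := [set z |
  match z with
  | Vertex v => (tdist x y + tdist y v)%N = tdist x v
  | End xi => exists r, [/\ end_rays xi r, r 0%N = x & range r y]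
  end].

HB.instance Definition _ := gen_eqMixin tree_hat.
HB.instance Definition _ := gen_choiceMixin tree_hat.
HB.instance Definition _ := isPointed.Build tree_hat (Vertex (origin T)).

(* The topology of the end compactification is generated by the cones. For
   adjacent x and y, [cone x y] and [cone y x] are complementary, so all cones
   are clopen; since T is locally finite, every vertex is an isolated point. *)
HB.instance Definition _ := isSubBaseTopological.Build tree_hat
  [set C | exists x y, C = cone x y] id.

End Tree.
Arguments Vertex {q T} _.
Arguments End {q T} _.

Section DiestelLeader.
Variables (d : nat) (q : 'I_d -> nat) (T : forall j, homTree (q j)).
Variable w : forall j, tree_end (T j).

Record DL := MkDL {
  dl_val :> forall j, T j;
  dl_sum : \sum_j busemann (w j) (dl_val j) == 0
}.

HB.instance Definition _ := gen_eqMixin DL.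
HB.instance Definition _ := gen_choiceMixin DL.

Definition dl_adj : rel DL := fun x y => `[< exists i j,
  [/\ i != j, adj (T i) (x i) (y i), adj (T j) (x j) (y j) &
      forall k, k != i -> k != j -> x k = y k] >].

Lemma dl_origin_subproof : \sum_j busemann (w j) (origin (T j)) == 0.
Proof. by rewrite big1 // => j _; exact: busemann_origin. Qed.

Definition dl_origin : DL := MkDL dl_origin_subproof.

Definition prod_hat := prod_topology (fun j => tree_hat (T j)).
HB.instance Definition _ := Topological.on prod_hat.
HB.instance Definition _ := isPointed.Build prod_hat
  (fun j => Vertex (origin (T j))).

Definition dl_embed (x : DL) : prod_hat := fun j => Vertex (x j).

Definition DL_hat : set prod_hat := closure (range dl_embed).

Definition DL_boundary : set prod_hat := DL_hat `\` range dl_embed.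

(* The product space with its Borel sigma-algebra; the Borel sets of DL_hat
   are the traces of its measurable sets. *)
Definition borel_hat : measurableType _ := g_sigma_algebraType (@open prod_hat).

Definition in_A (g : forall j, T j -> T j) : Prop :=
  (forall j, in_Aff (w j) (g j)) /\ \sum_j busemann_shift (w j) (g j) = 0.

Definition coord_act (g : forall j, T j -> T j) (x : forall j, T j) :
  forall j, T j := fun j => g j (x j).

Variable R : realType.
Implicit Type p : DL -> DL -> R.

Definition stochastic p : Prop :=
  (forall x y, 0 <= p x y) /\
  forall x, \esum_(y in [set: DL]) (p x y)%:E = 1%E.

Fixpoint pstep p (n : nat) (x y : DL) : \bar R :=
  if n is m.+1 then
    \esum_(z in [set: DL]) ((p x z)%:E * pstep p m z y)%E
  else (x == y)%:R%:E.

Definition irreducible p : Prop := forall x y, exists n, (0 < pstep p n x y)%E.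

(* An element g of A maps DL to DL, so the image of x : DL under g is the
   x' : DL with coordinates [coord_act g x]. *)
Definition in_Gamma p (g : forall j, T j -> T j) : Prop :=
  in_A g /\
  forall x y x' y' : DL, dl_val x' = coord_act g x ->
    dl_val y' = coord_act g y -> p x' y' = p x y.

Definition Gamma_transitive p : Prop :=
  forall x y : DL, exists2 g, in_Gamma p g & dl_val y = coord_act g x.

Definition finite_first_moment p : Prop :=
  (\esum_(x in [set: DL])
     (p dl_origin x * (gdist dl_adj dl_origin x)%:R)%:E < +oo)%E.

(* The sum of the absolutely convergent series
   sum_x p(o,x) h(x_j), as positive part minus negative part. *)
Definition alpha p (j : 'I_d) : R :=
  let f (x : DL) := (p dl_origin x * (busemann (w j) (x j))%:~R)%:E in
  fine (esum [set: DL] f^\+ - esum [set: DL] f^\-)%E.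

Definition Lambda_ p (j : 'I_d) : set (tree_hat (T j)) :=
  if alpha p j <= 0 then [set End (w j)]
  else [set End xi | xi in [set xi | xi <> w j]].

Definition Lambda p : set prod_hat := [set z | forall j, Lambda_ p (z j)].

Definition omega_pt : prod_hat := fun j => End (w j).

(* Z is a time-homogeneous Markov chain with transition matrix p and starting
   point x under Pr x, expressed by its finite-dimensional distributions. DL
   carries the discrete sigma-algebra. *)
Definition random_walk p (dO : measure_display) (Om : measurableType dO)
    (Pr : DL -> probability Om R) (Z : nat -> Om -> DL) : Prop :=
  (forall n (A : set DL), measurable (Z n @^-1` A)) /\
  forall x n (xs : nat -> DL),
    Pr x [set om | forall i, (i <= n)%N -> Z i om = xs i] =
    ((xs 0%N == x)%:R * \prod_(i < n) p (xs i) (xs i.+1))%:E.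

(* The topological support. *)
Definition msupport (nu : {measure set borel_hat -> \bar R}) : set prod_hat :=
  [set z | forall U : set prod_hat, open U -> U z -> (0 < nu U)%E].

End DiestelLeader.
Arguments Lambda_ {d q T w R} p j.

(* Main.v *)
(** Write T_v for the set of descendants of a vertex v of a tree with respect to
    the fixed end, and call a family (B_v) of events on the path space equivariant
    when it commutes with the symmetries of the walk. By transitivity the total mass
    [\sum_v P_x(B_v)] does not depend on x; hence it does not change when the path is
    shifted in time. By a last-exit decomposition, the expected number of n <= N such
    that B_o is seen at time n is then at most the mass of B times the expected number
    of visits to o. With [B_v = {Z_0 is a child of v}] this shows that each coordinate
    is transient. With [B_v = {the first step crosses v}], whose mass is at most
    [1 + E d(o, Z_1)], Borel-Cantelli shows that each coordinate crosses every vertex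
    only finitely often, so it converges, either to the fixed end or inside some T_v.
    For the events of entering and leaving T_v, invariance of the mass gives
    [alpha = s_l - u_l], with s_l the mass of entering T_v and then staying for l more
    steps, and u_l the mass of spending l more steps in T_v and then leaving. Letting l
    tend to infinity identifies the sign of alpha with the alternative in the limit.

    Since [\sum_j alpha_j = 0], some alpha_j is nonpositive, and this coordinate is free
    to compensate the heights when the coordinates with positive drift are moved below
    prescribed vertices by a symmetry: the limit law charges every cone. An atom of
    maximal mass would define a harmonic function attaining its maximum, hence constant,
    hence equal to 1 by the zero-one law, which contradicts the full support. *)
From HB Require Import structures.
Require Import Defs.
From mathcomp Require Import all_boot all_order all_algebra.
From mathcomp Require Import zify lra finmap.
From mathcomp Require Import all_classical all_reals all_analysis.
Set Implicit Arguments.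
Unset Strict Implicit.
Unset Printing Implicit Defensive.
Import Order.TTheory GRing.Theory Num.Theory.
Local Open Scope classical_set_scope.
Local Open Scope ring_scope.

(** A single coordinate of the walk need not be a Markov chain: a symmetry carrying [x] to [y] may
    fix the vertex [x j = y j] and still permute the rest of the tree. What survives is that the
    probability of an equivariant event read at the current vertex, [Q x (B (pi x))], is the same
    for all [x] ([Q_diag]), together with a Markov property for such constants ([markov_const]). The
    coordinate is therefore treated as an abstract projection [pi : X -> T], and only diagonal
    quantities and masses are used. The topology is reduced to countably many tests: each cone is
    everything, T_v with its ends, or the complement of such a set. Convergence, measurability and
    identity of limits are all checked on the sets T_v. The critical case [alpha = 0] decides the
    form of the drift argument. If a coordinate is trapped below some vertex, u_l becomes
    arbitrarily small, whereas s_l stays above the mass of entering some T_v forever, which is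
    positive; so the drift is strictly positive. No law of large numbers would separate zero drift
    from the trapped case. *)

Lemma least_ex (P : set nat) n : P n ->
  P (least P) /\ forall m, P m -> (least P <= m)%N.
Proof.
move=> Pn; rewrite /least; case: xgetP => [m _ [Pm mmin] //|none].
have ex : exists k, `[< P k >] by exists n; apply/asboolP.
case: (ex_minnP ex) => k /asboolP Pk kmin; case: (none k); split=> // m Pm.
by apply: kmin; apply/asboolP.
Qed.

Lemma least_eq (P : set nat) n : P n -> (forall m, P m -> (n <= m)%N) ->
  least P = n.
Proof.
move=> Pn nmin; have [Pl lmin] := least_ex Pn.
by apply/eqP; rewrite eqn_leq lmin // nmin.
Qed.

Lemma finite_image_inj (V : choiceType) (f : nat -> V) (A : set nat) :
  injective f -> finite_set (f @` A) -> finite_set A.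
Proof.
move=> finj fin.
pose g y := xget 0%N [set n | f n = y].
apply: sub_finite_set (finite_image g fin) => n An /=; exists (f n).
  by exists n.
by rewrite /g; case: xgetP => [m _ /finj //|/(_ n) []].
Qed.

(** * Rays in acyclic graphs *)

Section AcyclicGraph.
Variables (V : choiceType) (e : rel V).
Hypotheses (e_sym : symmetric e) (e_irr : irreflexive e).
Hypothesis e_acyclic : forall s : seq V, (2 < size s)%N -> ~ ucycle e s.
Implicit Types (x y a b : V) (r : nat -> V).

(** Shortening the path to a simple one and closing it through [x] would otherwise give a cycle with
    at least three vertices. The uniqueness of simple paths and of rays both rest on this. *)
Lemma no_detour x a b s : e x a -> e x b -> path e a s -> last a s = b ->
  x \notin a :: s -> a = b.
Proof.
move=> xa xb ps; case: (shortenP ps) => p ap up sub lp xs.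
apply/eqP/negP => /negP ab.
case: p => [|c p] in ap up sub lp *; first by rewrite /= in lp; rewrite lp eqxx in ab.
apply: (@e_acyclic [:: x, a, c & p]) => //.
apply/andP; split.
  rewrite /cycle -[rcons _ _]/(rcons (a :: c :: p) x) rcons_path.
  by rewrite -[path e x _]/(e x a && path e a (c :: p)) xa ap [last _ _]lp e_sym xb.
rewrite cons_uniq up andbT; apply: contra xs; rewrite in_cons => /orP[/eqP->|/sub xin].
  exact: mem_head.
by rewrite in_cons xin orbT.
Qed.

Lemma rev_path_sym x s : path e (last x s) (rev (belast x s)) = path e x s.
Proof. by rewrite rev_path; apply: eq_path => u v; rewrite /= e_sym. Qed.

(** [no_detour], applied to one path followed by the reverse of the other, shows that both begin
    with the same step. *)
Lemma simple_path_unique x s1 s2 : path e x s1 -> path e x s2 ->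
  uniq (x :: s1) -> uniq (x :: s2) -> last x s1 = last x s2 -> s1 = s2.
Proof.
elim: s1 s2 x => [|a s1 IH] [|b s2] x //=.
- by move=> _ _ _ /andP[+ _] xl; rewrite xl mem_last.
- by move=> _ _ /andP[+ _] _ xl; rewrite -xl mem_last.
move=> /andP[xa p1] /andP[xb p2] /andP[x1 u1] /andP[x2 u2] ll.
have ab : a = b.
  apply: (@no_detour x a b (s1 ++ rev (belast b s2))) => //.
  - by rewrite cat_path p1 ll rev_path_sym.
  - rewrite last_cat ll; case: (s2) => //= c s; first by rewrite rev_cons last_rcons.
  - apply/negP; rewrite -cat_cons mem_cat (negbTE x1) mem_rev => xin.
    by rewrite (mem_belast xin) in x2.
subst b; congr (_ :: _); apply: (IH s2 a) => //.
Qed.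

Lemma gdist_simple x s : path e x s -> uniq (x :: s) ->
  gdist e x (last x s) = size s.
Proof.
move=> ps us; apply: least_eq; first by exists s.
move=> m [t [pt lt <-]]; move: lt; case: (shortenP pt) => t' pt' ut' st' lt'.
rewrite -(simple_path_unique pt' ps ut' us lt').
by apply: uniq_leq_size => //; case/andP: ut'.
Qed.

Lemma gdistP x y s0 : path e x s0 -> last x s0 = y ->
  exists s, [/\ path e x s, last x s = y, uniq (x :: s) & size s = gdist e x y].
Proof.
move=> p0 l0; move: l0; case: (shortenP p0) => s ps us _ ls.
by exists s; split=> //; rewrite -ls gdist_simple.
Qed.

(** [gdist] defaults to 0 when there is no path, so positivity alone guarantees that a path
    exists. *)
Lemma gdist_gt0_path x y : (0 < gdist e x y)%N ->
  exists s, [/\ path e x s, last x s = y & size s = gdist e x y].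
Proof.
rewrite /gdist /least; case: xgetP => // n _ [[s [ps ls sn]] _] _.
by exists s.
Qed.

Lemma gdist_triv x : gdist e x x = 0%N.
Proof. by have := @gdist_simple x [::]; apply. Qed.

(** The local form of being a geodesic ray; [is_rayP] shows that the two notions agree in an acyclic
    graph. *)
Definition nonback r := forall n, e (r n) (r n.+1) /\ r n <> r n.+2.

Lemma path_of_seq r m k : (forall n, e (r n) (r n.+1)) ->
  path e (r m) [seq r i | i <- iota m.+1 k].
Proof. by move=> er; elim: k m => //= k IH m; rewrite er IH. Qed.

Lemma last_of_seq r m k : last (r m) [seq r i | i <- iota m.+1 k] = r (m + k)%N.
Proof. by elim: k m => [m|k IH m] /=; rewrite ?addn0 // IH addSnnS. Qed.

(** Strong induction on the gap between two equal values: the two neighbours of the repeated vertex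
    inside the loop are joined by a stretch that avoids it, so by [no_detour] they coincide, at a
    gap smaller by two. *)
Lemma nonback_inj r : nonback r -> injective r.
Proof.
move=> nb; have er n := (nb n).1.
suff ne k m : r m <> r (m + k.+1)%N.
  move=> m n; case: (ltngtP m n) => // /subnKC; rewrite addSnnS => <-.
    by move/ne.
  by move/esym/ne.
have [K] := ubnP k; elim: K k m => // K IH k m; rewrite ltnS => kK.
case: k kK => [|[|k]] kK.
- by rewrite addn1 => E; have := er m; rewrite -E e_irr.
- by rewrite addn2; exact: (nb m).2.
move=> E; have [] := IH k m.+1 _ _; first exact: leq_trans kK.
apply: (@no_detour (r m) _ _ [seq r i | i <- iota m.+2 k.+1]) => //.
- by rewrite E e_sym (_ : (m + k.+3)%N = (m.+1 + k.+1).+1) ?er // !addnS addSn.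
- exact: path_of_seq.
- exact: last_of_seq.
rewrite -map_cons; apply/mapP => -[i]; rewrite (_ : _ :: _ = iota m.+1 k.+2) //.
rewrite mem_iota => /andP[mi ik] Ei.
have := IH (i - m.+1)%N m; rewrite -addSnnS subnKC //; apply=> //.
by move: ik; rewrite -ltn_subLR //; lia.
Qed.

Lemma is_rayP r : is_ray e r <-> nonback r.
Proof.
split=> [ry n|nb m n mn].
  split; last first.
    move=> E; have := ry n n.+2; rewrite -E gdist_triv.
    by rewrite -addn2 addKn => /(_ (leq_addr _ _)).
  have d1 : gdist e (r n) (r n.+1) = 1%N by rewrite ry // subSnn.
  have [|s []] := @gdist_gt0_path (r n) (r n.+1); first by rewrite d1.
  by rewrite d1; case: s => [|a []] //= /andP[pa _] <-.
have er i := (nb i).1.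
have := @gdist_simple (r m) [seq r i | i <- iota m.+1 (n - m)].
rewrite last_of_seq subnKC // size_map size_iota; apply; first exact: path_of_seq.
rewrite -map_cons (_ : _ :: _ = iota m (n - m).+1) // map_inj_uniq ?iota_uniq //.
exact: nonback_inj.
Qed.

Lemma ray_equiv_sym r s : ray_equiv r s -> ray_equiv s r.
Proof. by rewrite /ray_equiv setUC. Qed.

Lemma ray_equiv_trans r s t : ray_equiv r s -> ray_equiv s t -> ray_equiv r t.
Proof.
rewrite /ray_equiv => f1 f2; apply: sub_finite_set (_ : _ `<=` _ `|` _) _.
  2: by rewrite finite_setU; split; [exact: f1|exact: f2].
move=> x [[rx tx]|[tx rx]]; have [sx|sx] := pselect (range s x);
 rewrite /setU /setD /=; tauto.
Qed.

Lemma ray_equiv_shift r s : (forall n, s n.+1 = r n) -> ray_equiv r s.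
Proof.
move=> sr; rewrite /ray_equiv.
have -> : range r `\` range s = set0.
  by rewrite -subset0 => _ [[n _ <-] []]; exists n.+1.
rewrite set0U; apply: sub_finite_set (finite_set1 (s 0%N)) => _ [[[|n] _ <-]] // [].
by exists n.
Qed.

(** By injectivity the part of [r] beyond [N] has infinitely many vertices, too many for the finite
    symmetric difference. *)
Lemma ray_equiv_meet r s N : injective r -> ray_equiv r s ->
  exists2 n, (N <= n)%N & exists m, r n = s m.
Proof.
move=> rinj rs; apply: contrapT => none.
have : finite_set (r @` [set n | (N <= n)%N]).
  apply: sub_finite_set rs => _ [n /= Nn <-]; left; split; first by exists n.
  by move=> [m _ sm]; apply: none; exists n => //; exists m.
move=> /(finite_image_inj rinj) fin; apply: infinite_nat; have := finite_setU [set n | (N <= n)%N] `I_N.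
rewrite (_ : _ `|` _ = setT) => [->|]; first by split.
by apply/seteqP; split=> // n _ /=; case: (leqP N n); [left|right].
Qed.

(** If the rays agree up to [n], equivalence makes them meet again later. Following one of them to
    that point and the other one back joins their next vertices by a path avoiding [r n], and
    [no_detour] applies. *)
Lemma ray_unique r s : is_ray e r -> is_ray e s -> ray_equiv r s ->
  r 0%N = s 0%N -> r = s.
Proof.
move=> /is_rayP nr /is_rayP ns rs rs0; apply/funext => n.
have ir := nonback_inj nr; have is_ := nonback_inj ns.
suff H : forall n, (forall i, (i <= n)%N -> r i = s i).
  by apply: (H n).
elim=> [i|{}n IH i]; first by rewrite leqn0 => /eqP->.
rewrite leq_eqVlt => /orP[/eqP->|]; last exact: IH.
have [k nk [m km]] := @ray_equiv_meet r s n.+1 ir rs.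
have nm : (n < m)%N.
  rewrite ltnNge; apply/negP => mn; have := IH _ mn; rewrite -km => /ir mk.
  by move: nk; rewrite -mk ltnNge mn.
have rsn := IH n (leqnn n).
apply: (@no_detour (r n) _ _ ([seq r i | i <- iota n.+2 (k - n.+1)] ++
     rev (belast (s n.+1) [seq s i | i <- iota n.+2 (m - n.+1)]))).
- exact: (nr n).1.
- by rewrite rsn; exact: (ns n).1.
- rewrite cat_path path_of_seq => [|j]; last exact: (nr j).1.
  rewrite last_of_seq subnKC // km.
  have := last_of_seq s n.+1 (m - n.+1); rewrite subnKC // => <-.
  by rewrite rev_path_sym path_of_seq // => j; exact: (ns j).1.
- rewrite last_cat last_of_seq subnKC // km.
  case E : (m - n.+1)%N => [|j] /=.
    by congr s; apply/eqP; rewrite eqn_leq nm andbT -subn_eq0 E.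
  by rewrite rev_cons last_rcons.
apply/negP; rewrite -cat_cons mem_cat mem_rev => /orP[].
  rewrite -map_cons (_ : _ :: _ = iota n.+1 (k - n.+1).+1) //.
  by case/mapP => j; rewrite mem_iota => /andP[nj _] /ir E; rewrite E ltnn in nj.
move=> /mem_belast; rewrite -map_cons (_ : _ :: _ = iota n.+1 (m - n.+1).+1) //.
rewrite rsn.
by case/mapP => j; rewrite mem_iota => /andP[nj _] /is_ E; rewrite E ltnn in nj.
Qed.

End AcyclicGraph.

(** * Parents and heights relative to the fixed end *)

Section TreeStructure.
Variables (q : nat) (T : homTree q) (w : tree_end T).
Implicit Types (x y v u : T) (xi : tree_end T) (r s : nat -> T).

Let es := @adj_sym q T.
Let ei := @adj_irr q T.
Let ea := @adj_acyclic q T.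

Lemma end_class xi : exists2 r0, is_ray (adj T) r0 &
  end_rays xi = [set s | is_ray (adj T) s /\ ray_equiv r0 s].
Proof. by case: xi. Qed.

Lemma end_ray xi r : end_rays xi r -> is_ray (adj T) r.
Proof. by have [r0 _ ->] := end_class xi; move=> -[]. Qed.

Lemma end_equiv xi r s : end_rays xi r -> end_rays xi s -> ray_equiv r s.
Proof.
have [r0 _ ->] := end_class xi; move=> -[_ r1] [_ r2].
exact: ray_equiv_trans (ray_equiv_sym r1) r2.
Qed.

Lemma end_closed xi r s : end_rays xi r -> is_ray (adj T) s -> ray_equiv r s ->
  end_rays xi s.
Proof.
have [r0 _ ->] := end_class xi; move=> -[_ r1] rs r2; split=> //.
exact: ray_equiv_trans r1 r2.
Qed.

Lemma end_nonempty xi : exists r, end_rays xi r.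
Proof.
have [r0 r0r ->] := end_class xi; exists r0; split=> //.
by rewrite /ray_equiv setDv setU0; exact: finite_set0.
Qed.

Lemma end_inj xi r : end_rays xi r -> injective r.
Proof. by move=> /end_ray /(is_rayP es ei ea); exact: nonback_inj. Qed.

Lemma end_adj xi r n : end_rays xi r -> adj T (r n) (r n.+1).
Proof. by move=> /end_ray /(is_rayP es ei ea) /(_ n) []. Qed.

Lemma end_eq xi xi' r : end_rays xi r -> end_rays xi' r -> xi = xi'.
Proof.
move=> r1 r2; have E : end_rays xi = end_rays xi'.
  apply/seteqP; split=> s.
    by move=> s1; apply: end_closed r2 (end_ray s1) (end_equiv r1 s1).
  by move=> s1; apply: end_closed r1 (end_ray s1) (end_equiv r2 s1).
by case: xi xi' E {r1 r2} => R h [R' h'] /= E; subst R'; congr GraphEnd; exact: Prop_irrelevance.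
Qed.

Definition ray_cons x r n := if n is m.+1 then r m else x.

Lemma end_tail xi r : end_rays xi r -> end_rays xi (fun n => r n.+1).
Proof.
move=> r1; apply: (end_closed r1).
  by apply/(is_rayP es ei ea) => n; have /(is_rayP es ei ea) /(_ n.+1) := end_ray r1.
by apply: ray_equiv_sym; exact: ray_equiv_shift.
Qed.

Lemma end_cons xi x r : end_rays xi r -> adj T x (r 0%N) -> x <> r 1%N ->
  end_rays xi (ray_cons x r).
Proof.
move=> r1 xr xn; apply: (end_closed r1); last exact: ray_equiv_shift.
apply/(is_rayP es ei ea) => -[|n] //.
by have /(is_rayP es ei ea) /(_ n) := end_ray r1.
Qed.

(** A ray is carried to [x] edge by edge along a path: the new vertex is prepended or, if that would
    backtrack, the old first vertex is dropped. *)
Lemma end_from xi x : exists2 r, end_rays xi r & r 0%N = x.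
Proof.
have [r0 r0xi] := end_nonempty xi.
have [s ps ls] := adj_connected x (r0 0%N).
elim: s x ps ls => [|a s IH] x /= => [_ ->|/andP[xa pa] la]; first by exists r0.
have [r r1 ra] := IH a pa la.
have [xr|xr] := pselect (x = r 1%N); first by exists (fun n => r n.+1); [exact: end_tail|].
by exists (ray_cons x r) => //; apply: end_cons => //; rewrite ra.
Qed.

Lemma ray_from_end xi x : end_rays xi (ray_from x xi) /\ ray_from x xi 0%N = x.
Proof.
rewrite /ray_from; case: xgetP => [r _ []//|none].
by have [r r1 r2] := end_from xi x; case: (none r).
Qed.

Lemma ray_from_unique xi x r : end_rays xi r -> r 0%N = x -> ray_from x xi = r.
Proof.
move=> r1 r2; have [r3 r4] := ray_from_end xi x.
apply: (ray_unique es ei ea (end_ray r3) (end_ray r1)); last by rewrite r4.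
exact: end_equiv r3 r1.
Qed.

(** The parent of [x], its neighbour in the direction of [w]. Every ray of [w] is an orbit of this
    map, so descendants, heights and confluents are all expressed by its iterates. *)
Definition par x : T := ray_from x w 1%N.

Lemma ray_from_par x n : ray_from x w n = iter n par x.
Proof.
elim: n x => [|n IH] x; first exact: (ray_from_end w x).2.
rewrite iterSr -IH /par.
have [r1 r0] := ray_from_end w x.
by rewrite (ray_from_unique (end_tail r1) erefl).
Qed.

Lemma par_ray x : end_rays w (fun n => iter n par x).
Proof.
have [r1 _] := ray_from_end w x; suff <- : ray_from x w = fun n => iter n par x by [].
by apply/funext => n; exact: ray_from_par.
Qed.

Lemma par_ray_unique r : end_rays w r -> r = fun n => iter n par (r 0%N).
Proof.
by move=> r1; rewrite -[LHS](ray_from_unique r1 erefl); apply/funext => n; exact: ray_from_par.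
Qed.

Lemma adj_par x : adj T x (par x).
Proof. exact: (end_adj 0 (par_ray x)). Qed.

Lemma iter_par_inj x m n : iter m par x = iter n par x -> m = n.
Proof. exact: (end_inj (par_ray x)). Qed.

Lemma par_par_neq x : par (par x) <> x.
Proof. by move=> /(@iter_par_inj x 2 0). Qed.

(** Unless [x] is the parent of [y], prepending [x] to the ray from [y] yields the ray from [x],
    whose first step is then [y]. *)
Lemma adjP x y : adj T x y -> y = par x \/ x = par y.
Proof.
move=> xy; have [xE|xE] := pselect (x = par y); first by right.
left; have := end_cons (par_ray y) xy xE.
by move=> /par_ray_unique /(congr1 (fun f => f 1%N)).
Qed.

Lemma common_ancestor x y : exists a b, iter a par x = iter b par y.
Proof.
have [n _ [m nm]] := ray_equiv_meet 0 (end_inj (par_ray x)) (end_equiv (par_ray x) (par_ray y)).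
by exists n, m.
Qed.

Lemma common_ancestor_diff x y a b c d : iter a par x = iter b par y ->
  iter c par x = iter d par y -> (a + d = c + b)%N.
Proof.
move=> ab cd; apply: (@iter_par_inj x).
by rewrite addnC iterD ab -iterD addnC iterD -cd -iterD addnC.
Qed.

Lemma tdist_iter_par x n : tdist x (iter n par x) = n.
Proof. by have := end_ray (par_ray x) (leq0n n); rewrite subn0. Qed.

(** The definition refers to the first common vertex of two rays, but climbing further lengthens
    both ways equally, so any common ancestor gives the same difference. *)
Lemma busemannE x a b : iter a par x = iter b par (origin T) ->
  busemann w x = a%:Z - b%:Z.
Proof.
move=> ab; rewrite /busemann.
have [] := @least_ex [set n | range (ray_from (origin T) w) (ray_from x w n)] a.
  by exists b => //; rewrite !ray_from_par.
move=> + _; rewrite -/(confluent w x (origin T)) /confluent.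
set n := least _ => -[m _]; rewrite !ray_from_par => mn.
rewrite tdist_iter_par -mn tdist_iter_par.
have := common_ancestor_diff ab (esym mn).
by lia.
Qed.

Lemma busemann_par x : busemann w (par x) = busemann w x - 1.
Proof.
have [a [b ab]] := common_ancestor (par x) (origin T).
rewrite (busemannE ab) (@busemannE x a.+1 b) -?iterSr //; first by lia.
by rewrite iterSr.
Qed.

Lemma busemann_iter x n : busemann w (iter n par x) = busemann w x - n%:Z.
Proof. by elim: n => [|n IH] /=; rewrite ?subr0 // busemann_par IH; lia. Qed.

(** Of the [q + 1 >= 3] neighbours only one is the parent. *)
Lemma two_children x : (2 <= q)%N ->
  exists c c', [/\ c <> c', par c = x & par c' = x].
Proof.
move=> q2; have : (`I_3 #<= [set y | adj T x y])%card.
  by rewrite (card_le_eqr (adj_regular x)) card_le_II.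
have [[c cx]|none] := pselect (exists c, par c = x); last first.
  have : [set y | adj T x y] `<=` (fun i => par x) @` `I_1.
    move=> y /adjP [->|xy]; first by exists 0%N.
    by case: none; exists y.
  move=> /subset_card_le /card_le_trans /(_ (card_image_le _ _)).
  by move=> h /card_le_trans /(_ h); rewrite card_le_II.
have [[c' cc' cx']|one] := pselect (exists2 c', c <> c' & par c' = x).
  by exists c, c'.
have : [set y | adj T x y] `<=` (fun i => if i == 0%N then par x else c) @` `I_2.
  move=> y /adjP [->|xy]; first by exists 0%N.
  exists 1%N => //=; apply: contrapT => cy; apply: one; exists y => //.
move=> /subset_card_le /card_le_trans /(_ (card_image_le _ _)).
by move=> h /card_le_trans /(_ h); rewrite card_le_II.
Qed.

Lemma Aff_par g x : in_Aff w g -> g (par x) = par (g x).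
Proof.
move=> [_ _ gw]; have : end_rays w (g \o (fun n => iter n par x)).
  by rewrite -gw; exists (fun n => iter n par x) => //; exact: par_ray.
by move/par_ray_unique => /(congr1 (fun f => f 1%N)).
Qed.

End TreeStructure.

Lemma nat_switch (P : nat -> Prop) m n : (m <= n)%N -> P m -> ~ P n ->
  exists i, [/\ (m <= i)%N, (i < n)%N, P i & ~ P i.+1].
Proof.
elim: n => [|n IH]; first by rewrite leqn0 => /eqP->.
rewrite leq_eqVlt => /orP[/eqP->//|]; rewrite ltnS => mn Pm Pn.
have [Pn'|Pn'] := pselect (P n); first by exists n.
by have [i [*]] := IH mn Pm Pn'; exists i; split=> //; exact: ltnW.
Qed.

(** * Descendants and cones *)

Section Descendants.
Variables (q : nat) (T : homTree q) (w : tree_end T).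
Implicit Types (x y v u c : T) (xi : tree_end T) (r : nat -> T).

Local Notation par := (par w).

(* The end [w] plays the role of the root: [dsc w v x] means that [x] lies in T_v. *)
Definition dsc v x := exists n, iter n par x = v.

Lemma dsc_refl x : dsc x x. Proof. by exists 0%N. Qed.

Lemma dsc_iter x n : dsc (iter n par x) x. Proof. by exists n. Qed.

Lemma dsc_trans y x z : dsc x y -> dsc y z -> dsc x z.
Proof. by move=> [m <-] [n <-]; exists (m + n)%N; rewrite iterD. Qed.

Lemma dsc_par x : dsc (par x) x. Proof. by exists 1%N. Qed.

Lemma dsc_parl v x : dsc v x -> dsc (par v) x.
Proof. exact/dsc_trans/dsc_par. Qed.

Lemma dsc_parr v x : dsc v (par x) -> dsc v x.
Proof. by move=> vx; exact: dsc_trans vx (dsc_par x). Qed.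

Lemma dsc_level v x : dsc v x -> busemann w v <= busemann w x.
Proof. by move=> [n <-]; rewrite busemann_iter; lia. Qed.

Lemma dsc_par_proper v : ~ dsc v (par v).
Proof. by move=> /dsc_level; rewrite busemann_par; lia. Qed.

Lemma dsc_cases v x : dsc v x -> x = v \/ exists2 c, par c = v & dsc c x.
Proof.
move=> [[|n] <-]; first by left.
by right; exists (iter n par x) => //; exact: dsc_iter.
Qed.

Lemma dsc_eq_or v x : dsc v x -> x <> v -> dsc v (par x).
Proof. by move=> [[|n] <-] // _; exists n; rewrite -iterSr. Qed.

Lemma dsc_comparable u v x : dsc u x -> dsc v x -> dsc u v \/ dsc v u.
Proof.
move=> [m <-] [n <-]; case: (leqP m n) => [mn|/ltnW nm].
  by right; exists (n - m)%N; rewrite -iterD subnK.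
by left; exists (m - n)%N; rewrite -iterD subnK.
Qed.

Lemma dsc_same_level u v : dsc u v -> busemann w u = busemann w v -> u = v.
Proof. by move=> [[|n] <-] //; rewrite busemann_iter; lia. Qed.

Lemma dsc_child_unique c c' x : par c = par c' -> dsc c x -> dsc c' x -> c = c'.
Proof.
move=> cc cx c'x; have hc : busemann w c = busemann w c'.
  by have := busemann_par w c; rewrite cc busemann_par; lia.
have [d|d] := dsc_comparable cx c'x; first exact: dsc_same_level.
by apply/esym/dsc_same_level.
Qed.

(** T_v is joined to its complement by a single edge, the one between [v] and its parent. *)
Lemma dsc_enter v x y : adj T x y -> ~ dsc v x -> dsc v y -> y = v /\ x = par v.
Proof.
move=> /(adjP w) [->|->] vx vy; first by case: vx; exact: dsc_parr.
have yv : y = v by apply: contrapT => /(dsc_eq_or vy).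
by rewrite yv.
Qed.

Lemma dsc_exit v x y : adj T x y -> dsc v x -> ~ dsc v y -> x = v /\ y = par v.
Proof. by rewrite adj_sym => yx vx vy; exact: dsc_enter yx vy vx. Qed.

(* [x] and [y] lie in the same component of the tree with [v] removed; false when
   one of them is [v]. *)
Definition same_comp v x y :=
  (exists c, [/\ par c = v, dsc c x & dsc c y]) \/ (~ dsc v x /\ ~ dsc v y).

Lemma same_comp_adj v x y : x <> v -> y <> v -> x = y \/ adj T x y ->
  same_comp v x y.
Proof.
move=> xv yv xy; have [vx|vx] := pselect (dsc v x); last first.
  right; split=> // vy; case: xy => [xy|xy]; first by rewrite xy in vx.
  by have [] := dsc_enter xy vx vy.
left; have [//|[c cv cx]] := dsc_cases vx; exists c; split=> //.
case: xy => [<-//|xy]; apply: contrapT => cy.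
by have [_] := dsc_exit xy cx cy; rewrite cv.
Qed.

Lemma same_comp_trans v x y z :
  same_comp v x y -> same_comp v y z -> same_comp v x z.
Proof.
have chd c : par c = v -> dsc c y -> dsc v y by move=> <- /dsc_parl.
move=> [[c [cv cx cy]]|[vx vy]] [[c' [cv' cy' cz]]|[vy' vz]].
- left; exists c; split=> //; rewrite (@dsc_child_unique c c' y) //.
  by rewrite cv cv'.
- by case: vy'; exact: chd cy.
- by case: vy; exact: chd cy'.
- by right.
Qed.

(** Pauses [a = b] are allowed because a step in DL leaves all but two coordinates unchanged. *)
Lemma same_comp_path v x s : path (fun a b => `[< a = b \/ adj T a b >]) x s ->
  v \notin x :: s -> same_comp v x (last x s).
Proof.
have ne (a b : T) : (a == b) = false -> b <> a by move=> /eqP ab ba; exact: ab.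
elim: s x => [|a s IH] x /=.
  by rewrite inE => _ /negbTE /ne xv; apply: same_comp_adj => //; left.
move=> /andP[/asboolP xa pa]; rewrite inE negb_or => /andP[/negbTE /ne xv vs].
apply: same_comp_trans (IH a pa vs); apply: same_comp_adj => //.
by move: vs; rewrite inE negb_or => /andP[/negbTE /ne].
Qed.

Lemma path_enter v x s : path (adj T) x s -> ~ dsc v x -> dsc v (last x s) ->
  v \in s.
Proof.
elim: s x => [|a s IH] x //= /andP[xa pa] vx vl.
rewrite inE; have [va|va] := pselect (dsc v a).
  by have [-> _] := dsc_enter xa vx va; rewrite eqxx.
by rewrite (IH a) ?orbT.
Qed.

Lemma path_leave c x s : path (adj T) x s -> dsc c x -> ~ dsc c (last x s) ->
  par c \in s.
Proof.
elim: s x => [|a s IH] x //= /andP[xa pa] cx cl.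
rewrite inE; have [ca|ca] := pselect (dsc c a); first by rewrite (IH a) ?orbT.
by have [_ ->] := dsc_exit xa cx ca; rewrite eqxx.
Qed.

Lemma path_avoiding y x v a b : iter a par x = iter b par v ->
  (forall i, (i <= a)%N -> iter i par x <> y) ->
  (forall i, (i <= b)%N -> iter i par v <> y) ->
  exists s, [/\ path (adj T) x s, last x s = v & y \notin x :: s].
Proof.
have es := @adj_sym q T.
have inc u n : path (adj T) u [seq iter i par u | i <- iota 1 n].
  by apply: (@path_of_seq _ _ (fun i => iter i par u) 0) => i; exact: adj_par.
have lst u n : last u [seq iter i par u | i <- iota 1 n] = iter n par u.
  exact: (@last_of_seq _ (fun i => iter i par u) 0).
have notin u n : (forall i, (i <= n)%N -> iter i par u <> y) ->
    y \notin u :: [seq iter i par u | i <- iota 1 n].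
  move=> h; rewrite (_ : _ :: _ = [seq iter i par u | i <- iota 0 n.+1]) //.
  by apply/mapP => -[i]; rewrite mem_iota add0n ltnS => /h hi /esym.
move=> ab ha hb.
exists ([seq iter i par x | i <- iota 1 a] ++
  rev (belast v [seq iter i par v | i <- iota 1 b])); split.
- rewrite cat_path inc lst ab /=.
  by rewrite -[iter b _ _]lst rev_path_sym.
- by rewrite last_cat lst ab; case: (b) => //= n; rewrite rev_cons last_rcons.
rewrite -cat_cons mem_cat negb_or notin //= mem_rev.
by apply: contra (notin v b hb) => /mem_belast.
Qed.

(** Turns the metric condition in [cone] into a separation property: the geodesic is the only simple
    path, hence its vertices occur on every path. *)
Lemma tdist_addP x y v : (tdist x y + tdist y v)%N = tdist x v <->
  forall s, path (adj T) x s -> last x s = v -> y \in x :: s.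
Proof.
have es := @adj_sym q T; have ea := @adj_acyclic q T.
have [s0 p0 l0] := adj_connected x v.
have [s [ps ls us ss]] := gdistP es ea p0 l0.
split=> [xyv t pt lt|]; last first.
  move=> /(_ s ps ls); rewrite inE => /orP[/eqP->|ys].
    by rewrite /tdist gdist_triv.
  move: ys ps ls us ss; case/splitPr => s1 s2.
  rewrite -cat_rcons cat_path last_cat last_rcons => /andP[p1 p2] ls.
  rewrite -cat_cons cat_uniq size_cat => /and3P[u1 hs u2] ss.
  rewrite -/(tdist x v) in ss; rewrite -ss; congr addn.
    by rewrite /tdist -(gdist_simple es ea p1 u1) last_rcons.
  rewrite /tdist -ls gdist_simple //= u2 andbT.
  by apply: contra hs => ys2; apply/hasP; exists y => //; rewrite inE mem_rcons inE eqxx orbT.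
have [t1 q1 m1] := adj_connected x y; have [t2 q2 m2] := adj_connected y v.
have [s1 [p1 l1 u1 z1]] := gdistP es ea q1 m1.
have [s2 [p2 l2 u2 z2]] := gdistP es ea q2 m2.
have pc : path (adj T) x (s1 ++ s2) by rewrite cat_path p1 l1.
have sub p : path (adj T) x p -> last x p = v -> {subset s <= p}.
  move=> pp; case: (shortenP pp) => p' pp' up' sub lp'.
  by rewrite (simple_path_unique es ea ps pp' us up') // ls lp'.
have lc : last x (s1 ++ s2) = v by rewrite last_cat l1.
(* The concatenation contains the geodesic [s] and is no longer than it, so both have the same
   vertices. *)
have [|||_ mem] := @uniq_min_size _ s (s1 ++ s2); first by case/andP: us.
- exact: sub.
- by rewrite size_cat z1 z2 ss -/(tdist x y) -/(tdist y v) xyv.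
have : y \in x :: (s1 ++ s2) by rewrite -cat_cons mem_cat -l1 mem_last.
rewrite !inE -mem => /orP[->//|ys].
by rewrite (sub t) ?orbT.
Qed.

Lemma cone_vertex_out x y v : ~ dsc y x -> cone x y (Vertex v) <-> dsc y v.
Proof.
move=> yx; rewrite /cone /= tdist_addP; split=> [h|yv s ps ls]; last first.
  by rewrite inE (path_enter ps) ?orbT ?ls.
apply: contrapT => yv; have [a [b ab]] := common_ancestor w x v.
have [||s [ps ls]] := @path_avoiding y x v a b ab.
- by move=> i _ E; apply: yx; exists i.
- by move=> i _ E; apply: yv; exists i.
by rewrite h.
Qed.

Lemma cone_vertex_in x c v : dsc c x -> cone x (par c) (Vertex v) <-> ~ dsc c v.
Proof.
move=> cx; rewrite /cone /= tdist_addP; split=> [h cv|cv s ps ls]; last first.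
  by rewrite inE (path_leave ps) ?orbT ?ls.
case: (cx) (cv) => a ax [b bv].
have [|||s [ps ls]] := @path_avoiding (par c) x v a b.
- by rewrite ax bv.
- move=> i ia; rewrite -{1}ax -[par _]/(iter a.+1 par x) => /iter_par_inj E.
  by rewrite E ltnn in ia.
- move=> i ib; rewrite -{1}bv -[par _]/(iter b.+1 par v) => /iter_par_inj E.
  by rewrite E ltnn in ib.
by rewrite h.
Qed.

Lemma end_drop xi r n : end_rays xi r -> end_rays xi (fun k => r (n + k)%N).
Proof.
move=> rx; elim: n => [|n IH] //.
have := end_tail IH; rewrite (_ : (fun k => r (n + k.+1)%N) = fun k => r (n.+1 + k)%N) //.
by apply/funext => k; rewrite addnS addSn.
Qed.

Lemma end_merge xi r r' : end_rays xi r -> end_rays xi r' ->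
  exists m n, forall k, r (m + k)%N = r' (n + k)%N.
Proof.
move=> rx r'x.
have [m _ [n mn]] := ray_equiv_meet 0 (end_inj rx) (end_equiv rx r'x).
exists m, n => k.
have d1 := end_drop m rx; have d2 := end_drop n r'x.
have := ray_unique (@adj_sym q T) (@adj_irr q T) (@adj_acyclic q T) (end_ray d1) (end_ray d2)
  (end_equiv d1 d2).
by rewrite !addn0 => /(_ mn) /(congr1 (fun f => f k)).
Qed.

Definition ends_below v xi := exists r, end_rays xi r /\
  exists N, forall n, (N <= n)%N -> dsc v (r n).

Lemma ends_belowP v xi r : end_rays xi r ->
  ends_below v xi <-> exists N, forall n, (N <= n)%N -> dsc v (r n).
Proof.
move=> rx; split=> [[r' [r'x [N h]]]|[N h]]; last by exists r; split=> //; exists N.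
have [m [n mn]] := end_merge rx r'x.
exists (m + N)%N => k mk; rewrite -(@subnKC m k); last by apply: leq_trans mk; exact: leq_addr.
by rewrite mn; apply: h; lia.
Qed.

Lemma ray_enter xi r v m n : end_rays xi r -> (m <= n)%N -> ~ dsc v (r m) ->
  dsc v (r n) -> exists i, [/\ (m <= i)%N, (i < n)%N, r i = par v & r i.+1 = v].
Proof.
move=> rx mn vm vn; have [|i [mi lin vi]] := @nat_switch (fun k => ~ dsc v (r k)) m n mn vm; first by apply.
move=> /contrapT vi'; have [e1 e2] := dsc_enter (end_adj i rx) vi vi'.
by exists i.
Qed.

Lemma ray_leave xi r c m n : end_rays xi r -> (m <= n)%N -> dsc c (r m) ->
  ~ dsc c (r n) -> exists i, [/\ (m <= i)%N, (i < n)%N, r i = c & r i.+1 = par c].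
Proof.
move=> rx mn vm vn; have [i [mi lin vi vi']] := @nat_switch (fun k => dsc c (r k)) m n mn vm vn.
have [e1 e2] := dsc_exit (end_adj i rx) vi vi'.
by exists i.
Qed.

Lemma cone_end_ray x y xi r : end_rays xi r -> r 0%N = x ->
  cone x y (End xi) <-> exists n, r n = y.
Proof.
move=> rx r0; split=> [[r' [r'x r'0 [n _ rn]]]|[n rn]].
  exists n; rewrite -rn -(ray_from_unique rx r0).
  by rewrite (ray_from_unique r'x r'0).
by exists r; split=> //; exists n.
Qed.

(** A ray is injective, so it crosses the edge between [y] and its parent at most once: after
    entering T_y it stays there. *)
Lemma cone_end_out x y xi : ~ dsc y x -> cone x y (End xi) <-> ends_below y xi.
Proof.
move=> yx; have [r rx r0] := end_from xi x.
rewrite (cone_end_ray _ rx r0) (ends_belowP y rx); rewrite -r0 in yx; split.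
  move=> [n rn]; exists n => k nk; apply: contrapT => yk.
  have [|i [_ lin ri ri']] := @ray_enter xi r y 0 n rx (leq0n n) yx _.
    by rewrite rn; exact: dsc_refl.
  have [|j [nj _ _ rj']] := @ray_leave xi r y n k rx nk _ yk.
    by rewrite rn; exact: dsc_refl.
  have /(end_inj rx) E : r i = r j.+1 by rewrite ri rj'.
  by move: lin; rewrite E => /ltnW; rewrite ltnNge nj.
move=> [N h]; have [i [_ _ _ ri]] := @ray_enter xi r y 0 N rx (leq0n N) yx (h N (leqnn N)).
by exists i.+1.
Qed.

Lemma cone_end_in x c xi : dsc c x -> cone x (par c) (End xi) <-> ~ ends_below c xi.
Proof.
move=> cx; have [r rx r0] := end_from xi x.
rewrite (cone_end_ray _ rx r0) (ends_belowP c rx); rewrite -r0 in cx; split.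
  move=> [n rn] [N h].
  have cn : ~ dsc c (r n) by rewrite rn; exact: dsc_par_proper.
  have [i [_ lin ri _]] := @ray_leave xi r c 0 n rx (leq0n n) cx cn.
  have [|j [nj _ rj rj']] := @ray_enter xi r c n (maxn n N) rx (leq_maxl n N) cn _.
    exact/h/leq_maxr.
  have /(end_inj rx) E : r i = r j.+1 by rewrite ri rj'.
  by move: lin; rewrite E => /ltnW; rewrite leqNgt ltnS nj.
move=> h; apply: contrapT => none; apply: h; exists 0%N => n _.
apply: contrapT => cn; have [i [_ _ _ ri]] := @ray_leave xi r c 0 n rx (leq0n n) cx cn.
by apply: none; exists i.+1.
Qed.

(** T_v together with its ends, written as the cone at [v] seen from its parent, so that it is open
    by definition of the topology. *)
Definition below v : set (tree_hat T) := cone (par v) v.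

Lemma below_vertex v u : below v (Vertex u) <-> dsc v u.
Proof. exact/cone_vertex_out/dsc_par_proper. Qed.

Lemma below_end v xi : below v (End xi) <-> ends_below v xi.
Proof. exact/cone_end_out/dsc_par_proper. Qed.

(** Reduces the subbase of the compactification to the sets [below v] and their complements: a cone
    pointing away from [w] is of the first kind, a cone pointing towards [w] of the second. *)
Lemma cone_cases x y :
  cone x y = setT \/ exists v, cone x y = below v \/ cone x y = ~` below v.
Proof.
have [->|xy] := pselect (x = y).
  left; apply/predeqP => -[v|xi]; split=> // _; first by rewrite /cone /= /tdist (gdist_triv (@adj_sym q T) (@adj_acyclic q T)).
  by have [r rx r0] := end_from xi y; exists r; split=> //; exists 0%N.
right; have [yx|yx] := pselect (dsc y x); last first.
  exists y; left; apply/predeqP => -[v|xi].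
    by rewrite below_vertex cone_vertex_out.
  by rewrite below_end cone_end_out.
have [//|[c <- cx]] := dsc_cases yx.
exists c; right; apply/predeqP => -[v|xi].
  by rewrite (cone_vertex_in _ cx) -below_vertex.
by rewrite (cone_end_in _ cx) -below_end.
Qed.

Lemma below_root v : ~ below v (End w).
Proof.
rewrite below_end (ends_belowP v (par_ray w v)) => -[N h].
have /dsc_level := h N.+1 (leqnSn N).
by rewrite busemann_iter; lia.
Qed.

(** A ray that always moves to the parent represents [w]. Any other ray has a step from a vertex to
    one of its children, and never comes back above that child. *)
Lemma below_nonroot xi : xi <> w -> exists v, below v (End xi).
Proof.
move=> xiw; have [r rx] := end_nonempty xi.
have [[n rn]|up] := pselect (exists n, r n.+1 <> par (r n)).
  exists (r n.+1); have [//|rE] := adjP w (end_adj n rx).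
  rewrite /below -rE; have d := end_drop n rx.
  apply/(cone_end_ray _ d); first by rewrite addn0.
  by exists 1%N; rewrite addn1.
have rE n : r n = iter n par (r 0%N).
  by elim: n => //= n IH; rewrite -IH; apply: contrapT => h; apply: up; exists n.
case: xiw; apply: (end_eq rx); rewrite (_ : r = fun n => iter n par (r 0%N)).
  exact: par_ray.
exact/funext.
Qed.

Lemma below_child v xi : below v (End xi) -> exists2 c, par c = v & below c (End xi).
Proof.
rewrite below_end => vxi; have [r rx r0] := end_from xi v.
have [N h] := (ends_belowP v rx).1 vxi.
have sub n : dsc v (r n).
  apply: contrapT => vn; have [|i [ni _ _ ri]] := ray_enter rx (leq_maxl n N) vn.
    by apply: h; exact: leq_maxr.
  by have /(end_inj rx) : r i.+1 = r 0%N by rewrite ri.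
have vr : v = par (r 1%N).
  have := adjP w (end_adj 0 rx); rewrite r0 => -[E|//].
  by case: (@dsc_par_proper v); rewrite -E.
exists (r 1%N) => //; rewrite /below -vr; apply/(cone_end_ray _ rx r0).
by exists 1%N.
Qed.

Lemma below_desc v u (z : tree_hat T) : dsc u v -> below v z -> below u z.
Proof.
move=> uv; case: z => [x|xi]; first by rewrite !below_vertex; exact: dsc_trans.
rewrite !below_end => -[r [rx [N h]]]; exists r; split=> //.
by exists N => n Nn; exact/(dsc_trans uv)/h.
Qed.

Lemma below_meet v u (z : tree_hat T) : below v z -> below u z -> dsc v u \/ dsc u v.
Proof.
case: z => [x|xi]; first by rewrite !below_vertex; exact: dsc_comparable.
rewrite !below_end => -[r [rx [N h]]] /(ends_belowP u rx) [M h'].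
exact: dsc_comparable (h _ (leq_maxl N M)) (h' _ (leq_maxr N M)).
Qed.

(** The ray from [v 0] has to enter every T_(v n), and it can do so only through the edge above
    [v n]; so it runs along the chain. *)
Lemma chain_end_ray (v : nat -> T) xi : (forall n, par (v n.+1) = v n) ->
  (forall n, below (v n) (End xi)) -> end_rays xi v.
Proof.
move=> vv vb; have [r rx r0] := end_from xi (v 0%N).
suff -> : v = r by []; apply/funext => n.
elim: n => [|n IH] //.
have /below_end /(ends_belowP _ rx) [N h] := vb n.+1.
have [||i [_ _ ri ri']] := @ray_enter xi r (v n.+1) n (maxn n N) rx (leq_maxl n N).
- by rewrite -IH -(vv n); exact: dsc_par_proper.
- exact/h/leq_maxr.
have /(end_inj rx) E : r i = r n by rewrite ri vv IH.
by rewrite -ri' E.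
Qed.

Lemma below_chain v xi : below v (End xi) ->
  exists u : nat -> T, [/\ u 0%N = v, forall n, par (u n.+1) = u n &
    forall n, below (u n) (End xi)].
Proof.
move=> vxi.
pose S := {c : T | below c (End xi)}.
have next (c : S) : {c' : S | par (sval c') = sval c}.
  apply: cid; have [c' cc' bc'] := below_child (svalP c).
  by exists (exist _ c' bc').
pose f n : S := iter n (fun c : S => sval (next c)) (exist _ v vxi).
exists (fun n => sval (f n)); split=> // n; first exact: (svalP (next (f n))).
exact: (svalP (f n)).
Qed.

(** The fixed end lies below no vertex; any other end is the limit of a descending chain of vertices
    above it, and [chain_end_ray] makes this chain a ray of both ends. *)
Lemma ends_separated xi xi' :
  (forall v, below v (End xi) <-> below v (End xi')) -> xi = xi'.
Proof.
move=> E; have [xiw|xiw] := pselect (xi = w).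
  have [xiw'|/below_nonroot [v]] := pselect (xi' = w); first by rewrite xiw.
  by rewrite -E xiw => /below_root.
have [v vxi] := below_nonroot xiw.
have [u [_ uu ub]] := below_chain vxi.
apply: (@end_eq _ _ _ _ u); apply: chain_end_ray => // n.
exact/E/ub.
Qed.

Lemma chain_end (v : nat -> T) : (forall n, par (v n.+1) = v n) ->
  exists xi, forall n, below (v n) (End xi).
Proof.
move=> vv; have vray : is_ray (adj T) v.
  apply/(is_rayP (@adj_sym q T) (@adj_irr q T) (@adj_acyclic q T)) => n; split.
    by rewrite adj_sym -(vv n); exact: adj_par.
  by move=> E; apply: (@par_par_neq _ _ w (v n.+2)); rewrite !vv.
have cls : exists2 r, is_ray (adj T) r &
  [set s | is_ray (adj T) s /\ ray_equiv v s] = [set s | is_ray (adj T) s /\ ray_equiv r s].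
  by exists v.
exists (GraphEnd cls) => n; rewrite below_end; exists v; split.
  by split=> //; rewrite /ray_equiv setDv setU0; exact: finite_set0.
exists n => m /subnKC <-; elim: (m - n)%N => [|k IH]; first by rewrite addn0; exact: dsc_refl.
by rewrite addnS; apply: dsc_parr; rewrite vv.
Qed.

End Descendants.

(** * Path space and Markov chains *)

Section EsumTheory.
Variable R : realType.
Local Open Scope ereal_scope.

Lemma esum_ge1 (I : choiceType) (D : set I) (a : I -> \bar R) i :
  (forall j, D j -> 0 <= a j) -> D i -> a i <= \esum_(j in D) a j.
Proof.
move=> a0 Di; apply: esum_ge; exists [set i].
  by split; [exact: finite_set1|move=> _ ->].
by rewrite fsbig_set1.
Qed.

Lemma esum_eq0P (I : choiceType) (D : set I) (a : I -> \bar R) :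
  (forall j, D j -> 0 <= a j) -> \esum_(j in D) a j = 0 ->
  forall i, D i -> a i = 0.
Proof.
move=> a0 s0 i Di; apply/eqP; rewrite eq_le a0 // andbT -s0.
exact: esum_ge1.
Qed.

(** One inequality holds for finite partial sums; for [c <> 0] the other follows by applying it with
    the inverse of [c]. *)
Lemma esumZl (I : choiceType) (D : set I) (a : I -> \bar R) (c : R) :
  (0 <= c)%R -> (forall j, D j -> 0 <= a j) ->
  \esum_(j in D) (c%:E * a j) = c%:E * \esum_(j in D) a j.
Proof.
have le (b : I -> \bar R) (k : R) : (0 <= k)%R -> (forall j, D j -> 0 <= b j) ->
    \esum_(j in D) (k%:E * b j) <= k%:E * \esum_(j in D) b j.
  move=> k0 b0; apply: ge_ereal_sup => _ [F [finF FD] <-].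
  rewrite fsbig_finite // big_seq -ge0_sume_distrr; last first.
    by move=> j; rewrite in_fset_set // inE => /FD/b0.
  rewrite lee_wpmul2l ?lee_fin // -big_seq -fsbig_finite //; apply: esum_ge.
  by exists F.
move=> c0 a0; apply/eqP; rewrite eq_le le //=.
have [->|cn0] := eqVneq c 0%R; first by rewrite mul0e esum_ge0 // => j Dj; rewrite mul0e.
have := le (fun j => c%:E * a j) c^-1%R.
rewrite invr_ge0 c0 => /(_ isT) /(_ (fun j Dj => mule_ge0 _ (a0 j Dj))).
rewrite lee_fin => /(_ c0) h.
have := lee_wpmul2l (_ : 0 <= c%:E) h; rewrite lee_fin => /(_ c0).
rewrite muleA -EFinM divff // mul1e.
congr (_ * _ <= _); apply: eq_esum => j _.
by rewrite muleA -EFinM mulVf // mul1e.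
Qed.

Lemma exchange_esum (I J : choiceType) (a : I -> J -> \bar R) :
  (forall i j, 0 <= a i j) ->
  \esum_(i in [set: I]) \esum_(j in [set: J]) a i j =
  \esum_(j in [set: J]) \esum_(i in [set: I]) a i j.
Proof.
move=> a0; rewrite !esum_esum //.
rewrite (@reindex_esum R _ _ [set: J * I] _ (fun z => (z.2, z.1))) /=.
  by congr esum; apply/seteqP; split.
by split=> [|[i j] [i' j'] _ _ [-> ->]//|[i j] _]; [by []|exists (j, i)].
Qed.

End EsumTheory.

(** * Measurability of events given by formulas with countable quantifiers *)

Section MeasurablePredicates.
Context d (T : measurableType d).

Lemma measP_exists (I : Type) (P : I -> T -> Prop) :
  countable [set: I] -> (forall i, measurable [set z | P i z]) ->
  measurable [set z | exists i, P i z].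
Proof.
move=> cI mP; rewrite (_ : mkset _ = \bigcup_i [set z | P i z]).
  exact: countable_bigcupT_measurable.
by apply/seteqP; split=> z [i]; [exists i|exists i].
Qed.

Lemma measP_not (P : T -> Prop) :
  measurable [set z | P z] -> measurable [set z | ~ P z].
Proof. exact: measurableC. Qed.

Lemma measP_and (P P' : T -> Prop) :
  measurable [set z | P z] -> measurable [set z | P' z] ->
  measurable [set z | P z /\ P' z].
Proof. exact: measurableI. Qed.

Lemma measP_or (P P' : T -> Prop) :
  measurable [set z | P z] -> measurable [set z | P' z] ->
  measurable [set z | P z \/ P' z].
Proof. exact: measurableU. Qed.

Lemma measP_imp (P P' : T -> Prop) :
  measurable [set z | P z] -> measurable [set z | P' z] ->
  measurable [set z | P z -> P' z].
Proof.
move=> mP mP'; rewrite (_ : mkset _ = [set z | ~ P z \/ P' z]).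
  by apply: measP_or mP'; exact: measP_not.
apply/seteqP; split=> z /=; first by have [] := pselect (P z); tauto.
by tauto.
Qed.

Lemma measP_iff (P P' : T -> Prop) :
  measurable [set z | P z] -> measurable [set z | P' z] ->
  measurable [set z | P z <-> P' z].
Proof. by move=> mP mP'; apply: measP_and; exact: measP_imp. Qed.

Lemma measP_forall (I : Type) (P : I -> T -> Prop) :
  countable [set: I] -> (forall i, measurable [set z | P i z]) ->
  measurable [set z | forall i, P i z].
Proof.
move=> cI mP; rewrite (_ : mkset _ = [set z | ~ exists i, ~ P i z]).
  by apply: measP_not; apply: measP_exists => // i; exact: measP_not.
apply/seteqP; split=> z /=; first by move=> h [i]; exact.
by move=> h i; apply: contrapT => Pi; apply: h; exists i.
Qed.

Lemma measP_const (P : Prop) : measurable [set _ : T | P].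
Proof.
have [p|p] := pselect P.
  by rewrite (_ : mkset _ = setT) //; apply/seteqP; split.
by rewrite (_ : mkset _ = set0) //; apply/seteqP; split.
Qed.

Lemma measP_ev (P : nat -> T -> Prop) :
  (forall n, measurable [set z | P n z]) ->
  measurable [set z | exists N, forall n, (N <= n)%N -> P n z].
Proof.
move=> mP; apply: measP_exists => // N; apply: measP_forall => // n.
by apply: measP_imp (measP_const _) (mP n).
Qed.

End MeasurablePredicates.

(** * The space of paths with the sigma-algebra of cylinders *)

Section PathSpace.
Variables (X : pointedType).
Hypothesis Xcount : countable [set: X].

Definition cyl n (xs : nat -> X) : set (nat -> X) :=
  [set z | forall i, (i <= n)%N -> z i = xs i].

(** The empty set and the whole space are added so that the family is closed under intersection and
    covers the space, as uniqueness of measures requires. *)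
Definition cyls : set (set (nat -> X)) :=
  [set C | C = set0 \/ C = setT \/ exists n xs, C = cyl n xs].

Definition pathX := g_sigma_algebraType cyls.
HB.instance Definition _ := Measurable.on pathX.

Lemma cylsI : setI_closed cyls.
Proof.
have key n xs m ys : (n <= m)%N -> cyls (cyl n xs `&` cyl m ys).
  move=> nm; have [E|ne] := pselect (forall i, (i <= n)%N -> xs i = ys i).
    right; right; exists m, ys; apply/seteqP; split=> z; first by case.
    by move=> zy; split=> // i il; rewrite E // zy // (leq_trans il).
  left; rewrite -subset0 => z [zx zy]; apply: ne => i il.
  by rewrite -zx // zy // (leq_trans il).
move=> A B [->|[->|[n [xs ->]]]] [->|[->|[m [ys ->]]]];
  rewrite ?(set0I, setI0, setTI, setIT); try by [left|right; left|right; right; eexists; eexists].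
by case: (leqP n m) => [|/ltnW] nm; rewrite 1?setIC; [rewrite setIC|]; exact: key.
Qed.

Definition tshift n (z : nat -> X) : nat -> X := fun i => z (n + i)%N.

Lemma measurable_cyl n xs : measurable (cyl n xs : set pathX).
Proof. by apply: sub_sigma_algebra; right; right; exists n, xs. Qed.

Lemma path_measurable_fun (f : (nat -> X) -> (nat -> X)) :
  (forall n xs, measurable (f @^-1` cyl n xs : set pathX)) ->
  forall B, measurable (B : set pathX) -> measurable (f @^-1` B : set pathX).
Proof.
move=> mf; apply: smallest_sub.
  split=> [|A /= mA|F /= mF].
  - by rewrite /= preimage_set0; exact: measurable0.
  - by rewrite setTD preimage_setC; exact: (@measurableC _ pathX).
  - by rewrite preimage_bigcup; exact: (@bigcupT_measurable _ pathX).
move=> _ [->|[->|[n [xs ->]]]] /=; last exact: mf.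
  by rewrite preimage_set0; exact: (@measurable0 _ pathX).
by rewrite preimage_setT; exact: (@measurableT _ pathX).
Qed.

Lemma tshift1_cyl n xs : tshift 1 @^-1` cyl n xs =
  \bigcup_(x in setT) cyl n.+1 (fun i => if i is j.+1 then xs j else x).
Proof.
apply/seteqP; split=> z; first by move=> h; exists (z 0%N) => // -[|i] // il; exact: h.
by move=> [x _ h] i il; exact: (h i.+1).
Qed.

Lemma measurable_tshift n B : measurable (B : set pathX) ->
  measurable (tshift n @^-1` B : set pathX).
Proof.
move=> mB; elim: n => [|n IH] //.
apply: (@path_measurable_fun (tshift 1) _ _ IH) => m xs.
rewrite tshift1_cyl; apply: countable_bigcupT_measurable => // x.
exact: measurable_cyl.
Qed.

Lemma measP_coord n (A : X -> Prop) :
  measurable ([set z | A (z n)] : set pathX).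
Proof.
suff h : measurable ([set z | A (z 0%N)] : set pathX).
  rewrite (_ : mkset _ = tshift n @^-1` [set z | A (z 0%N)]); first exact: measurable_tshift.
  by apply/seteqP; split=> z; rewrite /tshift /= addn0.
rewrite (_ : mkset _ = [set z : pathX | exists x, A x /\ cyl 0 (fun=> x) z]).
  apply: measP_exists => // x; apply: measP_and; first exact: measP_const.
  exact: measurable_cyl.
apply/seteqP; split=> z /=; last by move=> [x [Ax /(_ 0%N) -> //]].
by move=> Az; exists (z 0%N); split=> // i; rewrite leqn0 => /eqP->.
Qed.

Lemma measP_coord2 m n (A : X -> X -> Prop) :
  measurable ([set z | A (z m) (z n)] : set pathX).
Proof.
rewrite (_ : mkset _ = [set z : pathX | exists x, z m = x /\ A x (z n)]).
  apply: measP_exists => // x.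
  by apply: measP_and; [exact: (@measP_coord m (fun y => y = x))|exact: measP_coord].
by apply/seteqP; split=> z /=; [exists (z m)|move=> [x [->]]].
Qed.

Lemma measurable_path_map (G : X -> X) B : bijective G -> measurable (B : set pathX) ->
  measurable ([set z | B (G \o z)] : set pathX).
Proof.
move=> [G' GK G'K]; apply: (@path_measurable_fun (fun z => G \o z)) => n xs.
rewrite (_ : _ @^-1` _ = cyl n (G' \o xs)); first exact: measurable_cyl.
apply/seteqP; split=> z h i il /=; first by rewrite -h //= GK.
by rewrite h //= G'K.
Qed.

Lemma path_measure_unique (R : realType) (m1 m2 : {measure set pathX -> \bar R}) :
  (m1 setT < +oo)%E -> m1 setT = m2 setT ->
  (forall n xs, m1 (cyl n xs) = m2 (cyl n xs)) ->
  forall B, measurable B -> m1 B = m2 B.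
Proof.
move=> fin1 eT ec B mB.
apply: (@measure_unique _ R pathX cyls (fun=> setT) erefl cylsI
   (fun=> or_intror (or_introl erefl)) _ m1 m2) => //.
- by apply/seteqP; split=> // z _; exists 0%N.
- by move=> _ [->|[->|[n [xs ->]]]]; [rewrite !measure0|exact: eT|exact: ec].
Qed.

End PathSpace.

(** * Markov property, zero-one law and maximum principle *)

Section MarkovChain.
Variables (R : realType) (X : pointedType) (p : X -> X -> R).
Hypothesis Xcount : countable [set: X].
Hypothesis p_ge0 : forall x y, 0 <= p x y.
Hypothesis p_sum : forall x, \esum_(y in [set: X]) (p x y)%:E = 1%E.
Variable Q : X -> probability (pathX X) R.
Hypothesis Q_cyl : forall x n xs, Q x (cyl n xs) =
  ((xs 0%N == x)%:R * \prod_(i < n) p (xs i) (xs i.+1))%:E.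
Implicit Types (x y : X) (B : set (pathX X)).
Local Open Scope ereal_scope.

Let m0 : forall y, measurable ([set z | z 0%N = y] : set (pathX X)).
Proof. by move=> y; exact: (measP_coord Xcount 0 (fun x => x = y)). Qed.

Lemma Q_ge0 x B : 0 <= Q x B.
Proof. exact: (measure_ge0 (Q x)). Qed.

Lemma Q_mono x B B' : measurable B -> measurable B' -> B `<=` B' -> Q x B <= Q x B'.
Proof. by move=> mB mB' BB'; apply: le_measure => //; rewrite inE. Qed.

Lemma Q_fin x B : measurable B -> Q x B \is a fin_num.
Proof. by move=> mB; exact: fin_num_measure. Qed.

Lemma Q_start x : Q x [set z | z 0%N = x] = 1.
Proof.
have -> : [set z : pathX X | z 0%N = x] = cyl 0 (fun=> x).
  apply/seteqP; split=> z /=; first by move=> zx i; rewrite leqn0 => /eqP->.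
  by move=> /(_ 0%N) ->.
by rewrite Q_cyl eqxx big_ord0 mulr1.
Qed.

Lemma Q_as x B B' : measurable B -> measurable B' -> Q x B' = 1 ->
  Q x (B' `&` B) = Q x B.
Proof.
move=> mB mB' B'1; rewrite setIC.
have e : Q x B = Q x (B `\` B') + Q x (B `&` B') by exact: measureDI.
rewrite e; suff -> : Q x (B `\` B') = 0 by rewrite add0e.
apply/eqP; rewrite eq_le Q_ge0 ?andbT.
have <- : Q x (~` B') = 0 by rewrite probability_setC // B'1 subee.
apply: Q_mono; [exact: measurableD|exact: measurableC|by move=> z []].
Qed.

Lemma Q_start_cond x (A : X -> Prop) B : measurable B ->
  Q x [set z | A (z 0%N) /\ B z] = if `[< A x >] then Q x B else 0.
Proof.
move=> mB; have mA := measP_coord Xcount 0 A.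
rewrite -(@Q_as x _ _ _ (m0 x)) ?Q_start //; last exact: measurableI.
case: asboolP => Ax.
  rewrite -[RHS](@Q_as x _ _ mB (m0 x)) ?Q_start //; congr (Q x _).
  by apply/seteqP; split=> z [/= zx]; [move=> [_ Bz]|move=> Bz]; rewrite ?zx.
rewrite (_ : _ `&` _ = set0) ?measure0 // -subset0 => z [/= -> []] //.
Qed.

(** Dynkin induction: both sides respect complements and disjoint unions, and on a cylinder the
    identity is the product formula for [Q]. *)
Lemma markov1 x B : measurable B ->
  Q x (tshift 1 @^-1` B) = \esum_(y in [set: X]) ((p x y)%:E * Q y B).
Proof.
have pge x' y : 0 <= (p x' y)%:E by rewrite lee_fin.
move=> mB; move: (mB); apply: (@dynkin_induction _ (pathX X) (@cyls X) (fun B => measurable B ->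
  Q x (tshift 1 @^-1` B) = \esum_(y in [set: X]) ((p x y)%:E * Q y B))) => //.
- exact: cylsI.
- move=> _; rewrite preimage_setT probability_setT -(p_sum x).
  by apply: eq_esum => y _; rewrite probability_setT mule1.
- move=> _ [->|[->|[n [xs ->]]]] _.
  + by rewrite preimage_set0 measure0 esum1 // => y _; rewrite measure0 mule0.
  + rewrite preimage_setT probability_setT -(p_sum x).
    by apply: eq_esum => y _; rewrite probability_setT mule1.
  (* A cylinder fixes the initial state, so only the term [y = xs 0] survives. *)
  rewrite (_ : esum _ _ = \esum_(y in [set xs 0%N]) ((p x y)%:E * Q y (cyl n xs))); last first.
    rewrite [in RHS]esum_mkcond; apply: eq_esum => y _.
    rewrite in_set1; have [//|/negbTE yx] := eqVneq y (xs 0%N).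
    by rewrite Q_cyl eq_sym yx mul0r mule0.
  rewrite esum_set1; last by rewrite mule_ge0 ?pge.
  rewrite Q_cyl eqxx mul1r -EFinM.
  rewrite -(@Q_as x _ _ _ (m0 x)) ?Q_start //; last by apply: measurable_tshift => //; exact: measurable_cyl.
  rewrite (_ : _ `&` _ = cyl n.+1 (fun i => if i is j.+1 then xs j else x)).
    by rewrite Q_cyl eqxx mul1r big_ord_recl.
  apply/seteqP; split=> z /=; first by move=> [zx h] [|i] // il; exact: h.
  by move=> h; split=> [|i il]; [exact: (h 0%N)|exact: (h i.+1)].
- move=> S mS h _; have {}h := h mS.
  have mS' := measurable_tshift Xcount 1 mS.
  rewrite preimage_setC probability_setC // h.
  have e : \esum_(y in [set: X]) ((p x y)%:E * Q y S) +
           \esum_(y in [set: X]) ((p x y)%:E * Q y (~` S)) = 1.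
    rewrite -esumD; first last.
    - by move=> y _; rewrite mule_ge0 // Q_ge0.
    - by move=> y _; rewrite mule_ge0 // Q_ge0.
    rewrite -(p_sum x); apply: eq_esum => y _.
    rewrite -ge0_muleDr ?Q_ge0 //.
    by rewrite probability_setC // addeC subeK ?mule1 // Q_fin.
  by rewrite -h -{}e h addeC addeK // -h Q_fin.
- move=> F mF tF h _; rewrite preimage_bigcup measure_bigcup //; first last.
  + move=> i j _ _ [z [/= zi zj]]; apply: (tF i j) => //.
    by exists (tshift 1 z).
  + by move=> i _; exact: measurable_tshift.
  rewrite (eq_eseriesr (fun i _ => h i (mF i))).
  rewrite nneseries_esum; last first.
    by move=> i _; apply: esum_ge0 => y _; rewrite mule_ge0 // Q_ge0.
  rewrite (_ : [set` [set: nat]] = [set: nat]); last by apply/seteqP; split=> // i _; rewrite /= inE.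
  rewrite exchange_esum; last by move=> i y; rewrite mule_ge0 // Q_ge0.
  apply: eq_esum => y _; rewrite (@esumZl _ _ _ (fun i => Q y (F i))) //.
  rewrite measure_bigcup // nneseries_esum //.
  by congr (_ * esum _ _); apply/seteqP; split=> // i _; rewrite /= inE.
Qed.

Lemma tshiftSE n (z : nat -> X) : tshift n.+1 z = tshift n (tshift 1 z).
Proof. by []. Qed.

Lemma markov_sum n x B : measurable B -> Q x (tshift n @^-1` B) =
  \esum_(y in [set: X]) (Q x [set z | z n = y] * Q y B).
Proof.
move=> mB; elim: n x => [|n IH] x.
  rewrite (_ : esum _ _ = \esum_(y in [set x]) Q y B).
    by rewrite esum_set1 // Q_ge0.
  rewrite [in RHS]esum_mkcond; apply: eq_esum => y _; rewrite in_set1.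
  have [->|/eqP yx] := eqVneq y x; first by rewrite Q_start mul1e.
  have := @Q_start_cond x (fun x => x = y) setT measurableT.
  rewrite asboolF; last by move=> xy; apply: yx.
  rewrite (_ : [set z | _] = [set z | z 0%N = y]) => [->|]; first by rewrite mul0e.
  by apply/seteqP; split=> z /=; [case|].
have ms k y : measurable ([set z | z k = y] : set (pathX X)).
  exact: (measP_coord Xcount k (fun x => x = y)).
have pge x' y : 0 <= (p x' y)%:E by rewrite lee_fin.
rewrite (_ : _ @^-1` _ = tshift 1 @^-1` (tshift n @^-1` B)) //.
rewrite markov1; last exact: measurable_tshift.
under eq_esum do rewrite IH.
have -> : \esum_(y in [set: X]) (Q x [set z | z n.+1 = y] * Q y B) =
  \esum_(y in [set: X]) \esum_(y' in [set: X]) ((p x y')%:E * (Q y' [set z | z n = y] * Q y B)).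
  apply: eq_esum => y _.
  rewrite (_ : [set z | z n.+1 = y] = tshift 1 @^-1` [set z | z n = y]) // markov1 //.
  rewrite muleC -[Q y B]fineK ?Q_fin // -esumZl.
  - by apply: eq_esum => y' _; rewrite fineK ?Q_fin // muleCA [Q y B * _]muleC.
  - by rewrite fine_ge0 // Q_ge0.
  - by move=> y' _; rewrite mule_ge0 // Q_ge0.
rewrite exchange_esum; last by move=> y y'; rewrite !mule_ge0 // Q_ge0.
apply: eq_esum => y' _; rewrite esumZl // => y _.
by rewrite mule_ge0 // Q_ge0.
Qed.

(** Serves as the Markov property of a coordinate: the future only has to have the same probability
    from all states in [A], typically the fibre of a projection. *)
Lemma markov_const n x (A : X -> Prop) B (b : \bar R) : measurable B ->
  (forall y, A y -> Q y B = b) ->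
  Q x [set z | A (z n) /\ B (tshift n z)] = Q x [set z | A (z n)] * b.
Proof.
move=> mB bE; have mA k := measP_coord Xcount k A.
have pge x' y : 0 <= (p x' y)%:E by rewrite lee_fin.
have mAB k : measurable ([set z | A (z k) /\ B (tshift k z)] : set (pathX X)).
  apply: (@measP_and _ (pathX X) (fun z => A (z k)) (fun z => B (tshift k z))) => //.
  exact: (measurable_tshift Xcount k mB).
have [[y0 Ay0]|none] := pselect (exists y, A y); last first.
  rewrite (_ : mkset _ = set0) ?measure0; last first.
    by rewrite -subset0 => z [Az _]; apply: none; exists (z n).
  rewrite (_ : mkset _ = set0) ?measure0 ?mul0e //.
  by rewrite -subset0 => z Az; apply: none; exists (z n).
have bfin : b \is a fin_num by rewrite -(bE y0) // Q_fin.
have b0 : 0 <= b by rewrite -(bE y0) // Q_ge0.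
elim: n x => [|n IH] x.
  have := @Q_start_cond x A setT measurableT.
  have -> : [set z : pathX X | A (z 0%N) /\ setT z] = [set z | A (z 0%N)].
    by apply/seteqP; split=> z /=; [case|].
  move=> ->; rewrite (@Q_start_cond x A B mB) probability_setT.
  by case: asboolP => Ax; rewrite ?mul0e // mul1e bE.
rewrite (_ : mkset _ = tshift 1 @^-1` [set z | A (z n) /\ B (tshift n z)]) //.
rewrite (_ : [set z | A (z n.+1)] = tshift 1 @^-1` [set z | A (z n)]) //.
rewrite !markov1 // muleC -[b in RHS]fineK // -esumZl.
- by apply: eq_esum => y _; rewrite IH fineK // muleA muleC.
- by rewrite fine_ge0.
- by move=> y _; rewrite mule_ge0 // Q_ge0.
Qed.

Lemma markov_cyl n x xs B : measurable B ->
  Q x (cyl n xs `&` tshift n @^-1` B) = Q x (cyl n xs) * Q (xs n) B.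
Proof.
move=> mB; have pge x' y : 0 <= (p x' y)%:E by rewrite lee_fin.
elim: n x xs => [|n IH] x xs.
  have c0 : cyl 0 xs = [set z | z 0%N = xs 0%N].
    apply/seteqP; split=> z /=; first exact.
    by move=> zx i; rewrite leqn0 => /eqP->.
  have := @Q_start_cond x (fun y => y = xs 0%N) setT measurableT.
  have -> : [set z : pathX X | z 0%N = xs 0%N /\ setT z] = cyl 0 xs.
    by rewrite c0; apply/seteqP; split=> z /=; [case|].
  move=> ->; rewrite c0 (@Q_start_cond x (fun y => y = xs 0%N) B mB) probability_setT.
  by case: asboolP => Ax; rewrite ?mul0e // mul1e Ax.
have cS : cyl n.+1 xs = [set z | z 0%N = xs 0%N /\ (tshift 1 @^-1` cyl n (fun i => xs i.+1)) z].
  apply/seteqP; split=> z /=; first by move=> h; split=> [|i il]; [exact: h|exact: (h i.+1)].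
  by move=> [zx h] [|i] // il; exact: h.
have mc := @measurable_cyl X n (fun i => xs i.+1).
rewrite cS (@Q_start_cond x (fun y => y = xs 0%N)); last exact: measurable_tshift.
rewrite (_ : _ `&` _ = [set z | z 0%N = xs 0%N /\
   (tshift 1 @^-1` (cyl n (fun i => xs i.+1) `&` tshift n @^-1` B)) z]); last first.
  by apply/seteqP; split=> z /=; rewrite /setI /=; tauto.
have mcB : measurable (cyl n (fun i => xs i.+1) `&` tshift n @^-1` B : set (pathX X)).
  by apply: measurableI => //; exact: measurable_tshift.
rewrite (@Q_start_cond x (fun y => y = xs 0%N)); last exact: measurable_tshift.
case: asboolP => _; last by rewrite mul0e.
rewrite !markov1 // muleC -[Q (xs n.+1) B]fineK ?Q_fin // -esumZl.
- by apply: eq_esum => y _; rewrite IH fineK ?Q_fin // muleA muleC.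
- by rewrite fine_ge0 // Q_ge0.
- by move=> y _; rewrite mule_ge0 // Q_ge0.
Qed.

Definition shift_invariant B := forall z, B (tshift 1 z) <-> B z.

Lemma invariant_tshift B n : shift_invariant B -> tshift n @^-1` B = B.
Proof.
move=> iB; elim: n => [|n IH] //; rewrite -[RHS]IH.
have h z : B (tshift n z) <-> B z by rewrite -[in X in _ <-> X]IH.
by apply/seteqP; split=> z /=; rewrite tshiftSE; have := iB z; have := h (tshift 1 z); have := h z; tauto.
Qed.

Lemma invariant_markov x B : measurable B -> shift_invariant B ->
  Q x B = \esum_(y in [set: X]) ((p x y)%:E * Q y B).
Proof. by move=> mB iB; rewrite -markov1 // invariant_tshift. Qed.

(** Invariance and constancy make [B] independent of each cylinder, hence of every event, in
    particular of itself; its probability then equals its own square. *)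
Lemma zero_one x B : measurable B -> shift_invariant B -> (forall y, Q y B = Q x B) ->
  Q x B = 0 \/ Q x B = 1.
Proof.
move=> mB iB cB; set c := Q x B.
have cfin : c \is a fin_num by exact: Q_fin.
have c0 : 0 <= c by exact: Q_ge0.
suff h S : measurable S -> Q x (B `&` S) = c * Q x S.
  have := h B mB; rewrite setIid -/c -(fineK cfin) -EFinM => -[].
  set r := fine c => rr; have : (r * (r - 1) = 0)%R by rewrite mulrBr mulr1 -rr subrr.
  by move/eqP; rewrite mulf_eq0 subr_eq0 => /orP[]/eqP ->; [left|right].
pose m1 := mrestr (Q x) mB.
pose m2 := mscale (NngNum (fine_ge0 c0)) (Q x).
move=> mS; suff : m1 S = m2 S by rewrite /m1 /m2 /mrestr /mscale /= fineK // setIC.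
apply: (path_measure_unique (m1 := mrestr (Q x) mB) (m2 := mscale (NngNum (fine_ge0 c0)) (Q x))) => //.
- by change (Q x (setT `&` B) < +oo); rewrite -ge0_fin_numE ?Q_fin ?Q_ge0 // setTI.
- change (Q x (setT `&` B) = (fine c)%:E * Q x setT).
  by rewrite setTI probability_setT mule1 fineK.
- move=> n xs; change (Q x (cyl n xs `&` B) = (fine c)%:E * Q x (cyl n xs)).
  rewrite fineK //.
  by rewrite -{1}(@invariant_tshift B n) // markov_cyl // cB muleC.
Qed.

Lemma Q_map (G : X -> X) x B : bijective G -> (forall x y, p (G x) (G y) = p x y) ->
  measurable B -> Q (G x) B = Q x [set z | B (G \o z)].
Proof.
move=> bG pG mB.
have mG : measurable_fun setT (fun z : pathX X => (G \o z : pathX X)).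
  by move=> _ S mS; rewrite setTI; exact: measurable_path_map.
pose m2 := pushforward (Q x) (fun z : pathX X => (G \o z : pathX X)).
apply: (path_measure_unique (m1 := Q (G x)) (m2 := m2)) => //.
- by rewrite -ge0_fin_numE ?Q_fin ?Q_ge0.
- exact: etrans (probability_setT (Q (G x))) (esym (probability_setT (Q x))).
- move=> n xs; case: (bG) => G' GK G'K.
  transitivity (Q x (cyl n (G' \o xs))); last first.
    change (Q x (cyl n (G' \o xs)) = Q x ((fun z => G \o z) @^-1` (cyl n xs))).
    apply/esym; congr (Q x _).
    apply/seteqP; split=> z h i il /=; first by rewrite -h //= GK.
    by rewrite h //= G'K.
  transitivity (((G' (xs 0%N) == x)%:R * \prod_(i < n) p (G' (xs i)) (G' (xs i.+1)))%:E : \bar R).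
    apply: etrans (Q_cyl (G x) n xs) _; rewrite -{1}[xs 0%N]G'K (can_eq GK); congr ((_ * _)%:E).
    by apply: eq_bigr => i _; rewrite -[in RHS]pG !G'K.
  exact: esym (Q_cyl x n (G' \o xs)).
Qed.

Hypothesis irr : forall x y, exists n, 0 < Q x [set z | z n = y].

Lemma null_all x y B : measurable B -> shift_invariant B -> Q x B = 0 -> Q y B = 0.
Proof.
move=> mB iB B0; have [n xy] := irr x y.
have ms k y' : measurable ([set z | z k = y'] : set (pathX X)).
  exact: (measP_coord Xcount k (fun x => x = y')).
have := markov_sum n x mB; rewrite invariant_tshift // B0 => /esym.
move=> E; have /eqP := esum_eq0P (fun z _ => mule_ge0 (Q_ge0 x _) (Q_ge0 z B)) E (I : [set: X] y).
by rewrite mule_eq0 gt_eqF //= => /eqP.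
Qed.

(** By invariance the nonnegative function [m - Q z B] has average 0 over the position at time [n],
    so it vanishes at each state reached with positive probability. *)
Lemma max_all x y B : measurable B -> shift_invariant B -> (forall z, Q z B <= Q x B) ->
  Q y B = Q x B.
Proof.
move=> mB iB le; have [n xy] := irr x y; set m := Q x B.
have mfin : m \is a fin_num by exact: Q_fin.
have ms k y' : measurable ([set z | z k = y'] : set (pathX X)).
  exact: (measP_coord Xcount k (fun x => x = y')).
have sum1 : \esum_(z in [set: X]) Q x [set z' | z' n = z] = 1.
  have := markov_sum n x (@measurableT _ (pathX X)); rewrite preimage_setT probability_setT => ->.
  by apply: eq_esum => z _; rewrite probability_setT mule1.
have Em : \esum_(z in [set: X]) (Q x [set z' | z' n = z] * Q z B) = m.
  by rewrite -markov_sum // invariant_tshift.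
have E2 : \esum_(z in [set: X]) (Q x [set z' | z' n = z] * (m - Q z B)) = 0.
  have : m + \esum_(z in [set: X]) (Q x [set z' | z' n = z] * (m - Q z B)) = m.
    rewrite -{1}Em -esumD; first last.
    - by move=> z _; rewrite mule_ge0 ?Q_ge0 // sube_ge0 ?le // Q_fin.
    - by move=> z _; rewrite mule_ge0 ?Q_ge0.
    rewrite -[RHS]mul1e -sum1 muleC -(fineK mfin) -esumZl.
    - apply: eq_esum => z _; rewrite fineK // -ge0_muleDr ?Q_ge0 //.
      + by rewrite addeC subeK ?Q_fin // muleC.
      + by rewrite sube_ge0 ?le // Q_fin.
    - by rewrite fine_ge0 // Q_ge0.
    - by move=> z _; exact: Q_ge0.
  rewrite -(fineK mfin); case: (esum _ _) => [r||] //= [] /eqP.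
  by rewrite -subr_eq0 addrAC subrr add0r => /eqP ->.
have /eqP : Q x [set z' | z' n = y] * (m - Q y B) = 0.
  apply: (esum_eq0P _ E2) => // z _; rewrite mule_ge0 ?Q_ge0 // sube_ge0 ?le // Q_fin //.
rewrite mule_eq0 gt_eqF //= sube_eq ?Q_fin // ?add0e //.
by move=> /eqP ->.
Qed.

End MarkovChain.

(** Values in [option I] leave room for an empty or finite [I]. *)
Lemma countable_enum (I : Type) : countable [set: I] ->
  exists e : nat -> option I, forall i, exists n, e n = Some i.
Proof.
move=> /countable_injP [f finj].
exists (fun n => if pselect (exists i, f i = n) is left h then Some (sval (cid h)) else None).
move=> i; exists (f i); case: pselect => [h|[]]; last by exists i.
by congr Some; apply: finj; rewrite ?inE //; exact: (svalP (cid h)).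
Qed.

Lemma convolution_le (R : realType) (r a : nat -> \bar R) N :
  (forall k, 0 <= r k)%E -> (forall l, 0 <= a l)%E ->
  (\sum_(n < N.+1) \sum_(k < n.+1) r k * a (n - k)%N <=
   (\sum_(k < N.+1) r k) * \sum_(l < N.+1) a l)%E.
Proof.
move=> r0 a0; rewrite ge0_sume_distrl //.
under eq_bigr => n _ do rewrite (big_ord_widen N.+1 (fun k => r k * a (n - k)%N)%E) //.
rewrite (exchange_big_dep xpredT) //=; apply: lee_sum => k _.
rewrite -ge0_sume_distrr // lee_wpmul2l //.
have := big_geq_mkord k N.+1 xpredT (fun n => a (n - k)%N) => /= <-.
rewrite -[X in \big[_/_]_(X <= _ < _) _]add0n big_addn.
rewrite (eq_bigr a); last by move=> i _; rewrite addnK.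
rewrite -(big_mkord xpredT a); apply: lee_sum_nneg_natr => //.
exact: leq_subr.
Qed.

Section ProbabilityLemmas.
Context d (T : measurableType d) (R : realType) (P : probability T R).
Implicit Types (A B : set T).
Local Open Scope ereal_scope.

Lemma prob_mono A B : measurable A -> measurable B -> A `<=` B -> P A <= P B.
Proof. by move=> mA mB AB; apply: le_measure => //; rewrite inE. Qed.

Lemma prob_exists0 (I : Type) (F : I -> set T) : countable [set: I] ->
  (forall i, measurable (F i)) -> (forall i, P (F i) = 0) ->
  P (\bigcup_i F i) = 0.
Proof.
move=> /countable_enum [e eI] mF F0.
pose G n := if e n is Some i then F i else set0.
have mG n : measurable (G n) by rewrite /G; case: (e n).
have -> : \bigcup_i F i = \bigcup_n G n.
  apply/seteqP; split=> x; last by move=> [n _]; rewrite /G; case: (e n) => // i; exists i.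
  by move=> [i _ Fi]; have [n en] := eI i; exists n => //; rewrite /G en.
apply/eqP; rewrite eq_le measure_ge0 andbT.
have := measure_sigma_subadditive P mG (bigcupT_measurable _ mG) (@subset_refl _ _).
move=> /le_trans; apply.
rewrite eseries0 // => n _ _; rewrite /G; case: (e n) => // .
Qed.

Lemma prob1C A : measurable A -> P A = 1 <-> P (~` A) = 0.
Proof.
move=> mA; rewrite probability_setC //; split=> [->|]; first by rewrite subee.
have : P A \is a fin_num by exact: fin_num_measure.
by case: (P A) => // r _ [] /eqP; rewrite subr_eq0 => /eqP <-.
Qed.

Lemma prob1_mono A B : measurable A -> measurable B -> A `<=` B -> P A = 1 -> P B = 1.
Proof.
move=> mA mB AB A1; apply/eqP; rewrite eq_le probability_le1 //= -A1.
exact: prob_mono.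
Qed.

Lemma prob0_mono A B : measurable A -> measurable B -> A `<=` B -> P B = 0 -> P A = 0.
Proof.
by move=> mA mB AB B0; apply/eqP; rewrite eq_le measure_ge0 andbT -B0 prob_mono.
Qed.

Lemma prob1_forall (I : Type) (F : I -> set T) : countable [set: I] ->
  (forall i, measurable (F i)) -> (forall i, P (F i) = 1) ->
  P [set x | forall i, F i x] = 1.
Proof.
move=> cI mF F1.
have E : [set x | forall i, F i x] = ~` \bigcup_i (~` F i).
  apply/seteqP; split=> x /=; first by move=> h [i _]; exact.
  by move=> h i; apply: contrapT => Fi; apply: h; exists i.
have mU : measurable (\bigcup_i (~` F i)).
  by apply: countable_bigcupT_measurable => // i; exact: measurableC.
rewrite E; apply/prob1C; first exact: measurableC.
rewrite setCK; apply: prob_exists0 => // i; first exact: measurableC.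
exact/prob1C.
Qed.

Lemma prob1_and A B : measurable A -> measurable B -> P A = 1 -> P B = 1 ->
  P (A `&` B) = 1.
Proof.
move=> mA mB A1 B1; have := @prob1_forall bool (fun b => if b then A else B).
rewrite (_ : [set x | _] = A `&` B); last first.
  apply/seteqP; split=> x /=; first by move=> h; split; [exact: (h true)|exact: (h false)].
  by move=> [Ax Bx] [].
apply; [exact: countableP|by case|by case].
Qed.

Lemma prob1_inhabited A : P A = 1 -> exists x, A x.
Proof.
move=> A1; apply: contrapT => no; have : P A = 0.
  by rewrite (_ : A = set0) ?measure0 // -subset0 => x Ax; apply: no; exists x.
by rewrite A1 => /eqP; rewrite onee_eq0.
Qed.

Lemma prob_nondecreasing (F : nat -> set T) (e : R) :
  (forall n, measurable (F n)) ->
  (forall m n x, (m <= n)%N -> F m x -> F n x) ->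
  P (\bigcup_n F n) = 1 -> (e < 1)%R -> exists n, e%:E < P (F n).
Proof.
move=> mF ndF F1 e1.
have ndF' : nondecreasing_seq F by move=> m n mn; apply/subsetPset => x; exact: ndF.
have cv : (P \o F) @ \oo --> (1 : \bar R).
  by rewrite -F1; exact: (nondecreasing_cvg_mu mF (bigcupT_measurable _ mF) ndF').
have : \forall m \near \oo, e%:E < (P \o F) m.
  apply: (cv [set y | e%:E < y]); apply: open_nbhs_nbhs; split.
    exact: open_ereal_gt_ereal.
  by rewrite /= lte_fin.
by move=> [M _ h]; exists M; exact: (h M (leqnn M)).
Qed.

Lemma prob_cover_le n (F : nat -> set T) A : measurable A ->
  (forall k, measurable (F k)) -> (forall x, A x -> exists2 k, (k < n)%N & F k x) ->
  P A <= \sum_(k < n) P (F k).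
Proof.
move=> mA mF cov; apply: (@content_subadditive _ _ _ P) => //.
by move=> x /cov [k kn Fx]; rewrite -bigcup_mkord; exists k.
Qed.

Lemma prob_disjoint_le n (F : nat -> set T) A : measurable A ->
  (forall k, measurable (F k)) ->
  (forall k l x, (k < l)%N -> (l < n)%N -> F k x -> F l x -> False) ->
  (forall k x, (k < n)%N -> F k x -> A x) ->
  \sum_(k < n) P (F k) <= P A.
Proof.
move=> mA mF dis sub.
rewrite -(@measure_bigsetU_ord _ _ _ P n xpredT (fun k => F k)) //; last first.
  move=> i j _ _ [x [Fi Fj]]; apply/val_inj/eqP; case: ltngtP => // ij.
    by case: (dis i j x).
  by case: (dis j i x).
apply: prob_mono => //; first by apply: bigsetU_measurable.
by move=> x; rewrite -bigcup_mkord => -[k kn]; exact: (sub k).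
Qed.

End ProbabilityLemmas.

(** * Mass transport and transience *)

Section Coordinate.
Variables (R : realType) (X : pointedType) (p : X -> X -> R).
Hypothesis Xcount : countable [set: X].
Hypothesis p_ge0 : forall x y, 0 <= p x y.
Hypothesis p_sum : forall x, \esum_(y in [set: X]) (p x y)%:E = 1%E.
Variable Q : X -> probability (pathX X) R.
Hypothesis Q_cyl : forall x n xs, Q x (cyl n xs) =
  ((xs 0%N == x)%:R * \prod_(i < n) p (xs i) (xs i.+1))%:E.
Hypothesis irr : forall x y, exists n, (0 < Q x [set z | z n = y])%E.
Variables (q : nat) (T : homTree q) (w : tree_end T) (pi : X -> T).
Hypothesis q_ge2 : (2 <= q)%N.
Hypothesis Tcount : countable [set: T].
Hypothesis pi_surj : forall v, exists x, pi x = v.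

Local Notation par := (par w).
Local Notation dsc := (dsc w).

(** A symmetry [G] of the walk paired with the tree map [g] that it induces below [pi]; commuting
    with [par] says that [g] fixes the end [w]. *)
Definition symm (G : X -> X) (g : T -> T) :=
  [/\ bijective G, (forall x y, p (G x) (G y) = p x y), bijective g,
      (forall x, pi (G x) = g (pi x)) & forall v, g (par v) = par (g v)].

Hypothesis sym_trans : forall x y, exists G g, symm G g /\ G x = y.
Implicit Types (x y : X) (u v c : T) (B E : T -> set (pathX X)).
Local Open Scope ereal_scope.

Definition equivariant B := forall G g v z, symm G g -> B (g v) (G \o z) <-> B v z.

Definition mass x B := \esum_(v in [set: T]) Q x (B v).

Let Q_map' := Q_map Q_cyl.

Lemma Q_equi x G g v B : symm G g -> equivariant B -> (forall v, measurable (B v)) ->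
  Q (G x) (B (g v)) = Q x (B v).
Proof.
move=> sG eB mB; have [bG pG bg piG gpar] := sG.
rewrite Q_map' //; congr (Q x _); apply/seteqP.
by split=> z /=; have := eB G g v z sG; tauto.
Qed.

(** A symmetry taking [x] to [y] takes [pi x] to [pi y]. This constancy along the diagonal is what
    remains of homogeneity in one coordinate. *)
Lemma Q_diag x y B : equivariant B -> (forall v, measurable (B v)) ->
  Q x (B (pi x)) = Q y (B (pi y)).
Proof.
move=> eB mB; have [G [g [sG <-]]] := sym_trans x y.
by have [_ _ _ -> _] := sG; rewrite (Q_equi x (pi x) sG eB mB).
Qed.

Lemma mass_indep x y B : equivariant B -> (forall v, measurable (B v)) ->
  mass y B = mass x B.
Proof.
move=> eB mB; have [G [g [sG <-]]] := sym_trans x y.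
have [_ _ [g' gK g'K] _ _] := sG.
rewrite /mass (@reindex_esum _ _ _ [set: T] _ g).
  by apply: eq_esum => v _; rewrite (Q_equi x v sG eB mB).
split=> [//|u v _ _ /(can_inj gK)//|v _]; by exists (g' v).
Qed.

Lemma mass_ge0 x B : 0 <= mass x B.
Proof. by apply: esum_ge0 => v _; rewrite measure_ge0. Qed.

Lemma mass_shift n x B : equivariant B -> (forall v, measurable (B v)) ->
  mass x B < +oo -> mass x (fun v => tshift n @^-1` B v) = mass x B.
Proof.
move=> eB mB fB.
have step k y : mass y (fun v => tshift k.+1 @^-1` B v) =
    \esum_(y' in [set: X]) ((p y y')%:E * mass y' (fun v => tshift k @^-1` B v)).
  have -> : mass y (fun v => tshift k.+1 @^-1` B v) =
      \esum_(v in [set: T]) \esum_(y' in [set: X]) ((p y y')%:E * Q y' (tshift k @^-1` B v)).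
    apply: eq_esum => v _; rewrite -(markov1 Xcount p_ge0 p_sum Q_cyl) //.
    exact: measurable_tshift.
  rewrite exchange_esum; last by move=> v y'; rewrite mule_ge0 ?lee_fin ?measure_ge0.
  by apply: eq_esum => y' _; rewrite esumZl.
have fin : mass x B \is a fin_num by rewrite ge0_fin_numE // mass_ge0.
suff h : forall y, mass y (fun v => tshift n @^-1` B v) = mass x B by [].
elim: n => [|n IH] y; first exact: mass_indep.
rewrite step; under eq_esum do rewrite IH muleC -(fineK fin).
rewrite (@esumZl _ _ _ (fun y' => (p y y')%:E)) ?fine_ge0 ?mass_ge0 //; last first.
  by move=> y' _; rewrite lee_fin.
by rewrite p_sum mule1 fineK.
Qed.

Lemma mass_le x B E : (forall v, measurable (B v)) -> (forall v, measurable (E v)) ->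
  (forall v z, B v z -> E v z) -> mass x B <= mass x E.
Proof. by move=> mB mE BE; apply: le_esum => v _; apply: prob_mono => //; exact: BE. Qed.

Definition hit n v : set (pathX X) := [set z | pi (z n) = v].

Lemma meas_hit n v : measurable (hit n v).
Proof. exact: (measP_coord Xcount n (fun x => pi x = v)). Qed.

(* [E] seen [l] steps later, at the vertex that is visited at time 0 and not
   again up to time [l]. *)
Let last_exit E l v : set (pathX X) :=
  [set z | (forall i, (0 < i <= l)%N -> pi (z i) <> v) /\ E v (tshift l z)].

Let meas_last_exit E l v : (forall v, measurable (E v)) -> measurable (last_exit E l v).
Proof.
move=> mE; apply: (measP_and (P := fun z : pathX X => forall i, (0 < i <= l)%N -> pi (z i) <> v)
   (P' := fun z => E v (tshift l z))).
  apply: measP_forall => // i; apply: measP_imp; first exact: measP_const.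
  by apply: measP_not; exact: meas_hit.
exact: measurable_tshift.
Qed.

Let equi_last_exit E l : equivariant E -> equivariant (last_exit E l).
Proof.
move=> eE G g v z sG; have [_ _ [g' gK g'K] piG _] := sG.
rewrite /last_exit /= -(eE G g v (tshift l z) sG).
split=> -[h1 h2]; split=> // i il.
  by move=> piv; apply: (h1 i il); rewrite piG piv.
by rewrite piG => /(can_inj gK); exact: h1.
Qed.

Let visits o N := \sum_(n < N.+1) Q o (hit n (pi o)).

Lemma visits_fin o N : visits o N \is a fin_num.
Proof.
rewrite /visits; elim/big_ind: _ => // [a b|i _]; first by rewrite fin_numD => -> ->.
apply: fin_num_measure; exact: meas_hit.
Qed.

Lemma visits_indep o o' N : visits o N = visits o' N.
Proof.
apply: eq_bigr => n _; apply: (@Q_diag o o' (hit n)) => [|v]; last exact: meas_hit.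
move=> G g v z [_ _ [g' gK g'K] piG _]; rewrite /hit /= piG; split=> [/(can_inj gK)//|-> //].
Qed.

(* Read at time [N - l], the events for different [l] are disjoint, since [l] is the
   time elapsed since the last visit to [v]; all of them imply [E v] at time [N]. *)
Lemma last_exit_sum o E N : equivariant E -> (forall v, measurable (E v)) ->
  mass o E < +oo -> \sum_(l < N.+1) Q o (last_exit E l (pi o)) <= mass o E.
Proof.
move=> eE mE fE.
pose A l v : set (pathX X) := [set z | pi (z 0%N) = v /\ last_exit E l v z].
have mA l v : measurable (A l v).
  apply: (measP_and (P := fun z : pathX X => pi (z 0%N) = v) (P' := fun z => last_exit E l v z)).
    exact: meas_hit.
  exact: meas_last_exit.
have eA l : equivariant (A l).
  move=> G g v z sG; have := equi_last_exit l eE v z sG.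
  have [_ _ [g' gK g'K] piG _] := sG; rewrite /A /= piG => ->.
  by split=> -[h1 h2]; split=> //; [exact: (can_inj gK)|rewrite h1].
(* From [o] the event [A l v] is null unless [v = pi o], so the mass has one term; writing a single
   probability as a mass makes it invariant under time shifts. *)
have AE l : Q o (last_exit E l (pi o)) = mass o (A l).
  rewrite /mass (_ : esum _ _ = \esum_(v in [set pi o]) Q o (A l v)).
    rewrite esum_set1 //.
    rewrite (Q_start_cond Xcount Q_cyl o (fun x => pi x = pi o) (meas_last_exit l (pi o) mE)).
    by rewrite asboolT.
  rewrite [in RHS]esum_mkcond; apply: eq_esum => v _; rewrite in_set1.
  have [->//|/eqP vo] := eqVneq v (pi o).
  rewrite (Q_start_cond Xcount Q_cyl o (fun x => pi x = v) (meas_last_exit l v mE)).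
  by rewrite asboolF // => h; apply: vo.
have fA l : mass o (A l) < +oo.
  apply: le_lt_trans (fE); rewrite -(mass_shift l eE mE fE).
  apply: mass_le => // [v|v z [_ [_ h]] //]; exact: measurable_tshift.
under eq_bigr => l _ do rewrite AE -(mass_shift (N - l) (eA l) (mA l) (fA l)).
rewrite -(mass_shift N eE mE fE) /mass -esum_sum //; apply: le_esum => v _.
apply: (@prob_disjoint_le _ _ _ (Q o) N.+1 (fun l => tshift (N - l) @^-1` A l v)).
- exact: measurable_tshift.
- by move=> l; apply: measurable_tshift.
- move=> k l z kl; rewrite ltnS => lN [zk _] [_ [h _]].
  apply: (h (l - k)%N); first by rewrite subn_gt0 kl leq_subr.
  by rewrite -[RHS]zk /tshift; congr (pi (z _)); lia.
- move=> l z; rewrite ltnS => lN [_ [_]].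
  rewrite (_ : tshift l _ = tshift N z) //.
  by apply/funext => i; rewrite /tshift; congr (z _); lia.
Qed.

(** Splitting according to the last time [k <= n] spent at [pi o] bounds the [n]-th term by a
    convolution of visit probabilities with last-exit probabilities; the sum of a convolution is at
    most the product of the sums. *)
Lemma mass_transport o E N : equivariant E -> (forall v, measurable (E v)) ->
  mass o E < +oo ->
  \sum_(n < N.+1) Q o (tshift n @^-1` E (pi o)) <= visits o N * mass o E.
Proof.
move=> eE mE fE.
pose r k := Q o (hit k (pi o)); pose a l := Q o (last_exit E l (pi o)).
have a0 l : 0 <= a l by rewrite measure_ge0.
have r0 l : 0 <= r l by rewrite measure_ge0.
have step n : Q o (tshift n @^-1` E (pi o)) <= \sum_(k < n.+1) r k * a (n - k)%N.
  have mk k : measurable ([set z | hit k (pi o) z /\ last_exit E (n - k) (pi o) (tshift k z)]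
      : set (pathX X)).
    apply: measP_and; first exact: meas_hit.
    by apply: measurable_tshift => //; exact: meas_last_exit.
  have ra k : Q o [set z | hit k (pi o) z /\ last_exit E (n - k) (pi o) (tshift k z)] =
      r k * a (n - k)%N.
    apply: (@markov_const _ _ _ Xcount p_ge0 p_sum _ Q_cyl k o (fun x => pi x = pi o)).
      exact: meas_last_exit.
    move=> y yo; rewrite -yo; apply: Q_diag; first exact: equi_last_exit.
    by move=> v; exact: meas_last_exit.
  under eq_bigr do rewrite -ra.
  rewrite -(Q_as _ (meas_hit 0 (pi o))); first last.
  - apply: (@prob1_mono _ _ _ (Q o) [set z | z 0%N = o]) (Q_start Q_cyl o).
    + exact: (measP_coord Xcount 0 (fun x => x = o)).
    + exact: meas_hit.
    + by move=> z; rewrite /hit /= => ->.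
  - exact: measurable_tshift.
  apply: (@prob_cover_le _ _ _ (Q o) n.+1
    (fun k => [set z | hit k (pi o) z /\ last_exit E (n - k) (pi o) (tshift k z)])) => //.
    by apply: measurableI; [exact: meas_hit|exact: measurable_tshift].
  move=> z [z0 Ez].
  (* The largest such [k] is the last visit up to time [n]; one exists because the path starts at
     [pi o]. *)
  pose good k := `[< hit k (pi o) z >] && (k <= n)%N.
  have ex : exists k, good k by exists 0%N; rewrite /good leq0n andbT; apply/asboolP.
  have bd k : good k -> (k <= n)%N by case/andP.
  case: (ex_maxnP ex bd) => k /andP[/asboolP zk kn] kmax.
  exists k; rewrite ?ltnS //; split=> //; split.
    move=> i /andP[i0 ile] zi; have := kmax (k + i)%N; rewrite /good.
    have -> : (k + i <= n)%N by lia.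
    rewrite andbT => h; have := h _; rewrite asboolT // => /(_ isT); lia.
  rewrite (_ : tshift _ (tshift k z) = tshift n z) //.
  by apply/funext => i; rewrite /tshift; congr (z _); lia.
apply: le_trans (lee_sum _ (fun (n : 'I_N.+1) _ => step n)) _.
have vE : visits o N = \sum_(k < N.+1) r k by [].
have : visits o N * \sum_(l < N.+1) a l <= visits o N * mass o E.
  by apply: lee_wpmul2l; [rewrite vE sume_ge0|exact: last_exit_sum].
apply: le_trans.
by rewrite vE; exact: convolution_le.
Qed.

Definition never_back v : set (pathX X) := [set z | forall i, (0 < i)%N -> pi (z i) <> v].

Lemma meas_never_back v : measurable (never_back v).
Proof.
apply: measP_forall => // i; apply: measP_imp; first exact: measP_const.
by apply: measP_not; exact: meas_hit.
Qed.

Lemma equi_never_back : equivariant never_back.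
Proof.
move=> G g v z [_ _ [g' gK g'K] piG _]; rewrite /never_back /=.
split=> h i i0; have := h i i0; rewrite piG; first by move=> ne E; apply: ne; rewrite E.
by move=> ne /(can_inj gK).
Qed.

Definition io v : set (pathX X) := [set z | forall N, exists n, (N <= n)%N /\ pi (z n) = v].

Lemma meas_io v : measurable (io v).
Proof.
apply: measP_forall => // N; apply: measP_exists => // n.
by apply: measP_and; first exact: measP_const; exact: meas_hit.
Qed.

Lemma equi_io : equivariant io.
Proof.
move=> G g v z [_ _ [g' gK g'K] piG _]; rewrite /io /=.
split=> h N; have [n [Nn]] := h N; rewrite ?piG; exists n; split=> //.
  exact: (can_inj gK).
by rewrite piG; congr g.
Qed.

Lemma io_invariant v : shift_invariant (io v).
Proof.
move=> z; split=> h N.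
  by have [n [Nn zn]] := h N; exists n.+1; split=> //; exact: ltnW.
by have [[|n] [Nn zn]] := h N.+1 => //; exists n.
Qed.

Let mstart o : measurable ([set z | z 0%N = o] : set (pathX X)).
Proof. exact: (measP_coord Xcount 0 (fun x => x = o)). Qed.

Lemma hit0 o : Q o (hit 0 (pi o)) = 1.
Proof.
apply: (@prob1_mono _ _ _ (Q o) [set z | z 0%N = o]) (Q_start Q_cyl o) => //.
  exact: meas_hit.
by move=> z; rewrite /hit /= => ->.
Qed.

(** The events of being at [pi o] for the last time at time [k] are disjoint for different [k], and
    each has the product form by [markov_const]. *)
Lemma visits_escape o N : visits o N * Q o (never_back (pi o)) <= 1.
Proof.
rewrite ge0_sume_distrl //.
pose F k : set (pathX X) := [set z | hit k (pi o) z /\ never_back (pi o) (tshift k z)].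
have mF k : measurable (F k).
  apply: measP_and; first exact: meas_hit.
  by apply: measurable_tshift => //; exact: meas_never_back.
have FE k : Q o (F k) = Q o (hit k (pi o)) * Q o (never_back (pi o)).
  apply: (@markov_const _ _ _ Xcount p_ge0 p_sum _ Q_cyl k o (fun x => pi x = pi o)).
    exact: meas_never_back.
  by move=> y yo; have := Q_diag y o equi_never_back meas_never_back; rewrite yo.
under eq_bigr do rewrite -FE.
rewrite -[leRHS](@probability_setT _ _ _ (Q o)).
apply: prob_disjoint_le => // k l z kl _ [_ h] [zl _].
by apply: (h (l - k)%N); [rewrite subn_gt0|rewrite /tshift subnKC // ltnW].
Qed.

(** Almost surely there is no last visit to [pi o], and there is a visit at time 0. *)
Lemma last_visit_null o : Q o (never_back (pi o)) = 0 -> Q o (io (pi o)) = 1.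
Proof.
move=> nb0; pose F k : set (pathX X) := [set z | hit k (pi o) z /\ never_back (pi o) (tshift k z)].
have mF k : measurable (F k).
  apply: measP_and; first exact: meas_hit.
  by apply: measurable_tshift => //; exact: meas_never_back.
have F0 k : Q o (F k) = 0.
  rewrite (@markov_const _ _ _ Xcount p_ge0 p_sum _ Q_cyl k o (fun x => pi x = pi o) _ 0) ?mule0 //.
    exact: meas_never_back.
  by move=> y yo; have := Q_diag y o equi_never_back meas_never_back; rewrite yo => ->.
have U0 : Q o (\bigcup_k F k) = 0 by exact: prob_exists0.
have mU : measurable (\bigcup_k F k) by exact: bigcupT_measurable.
apply: (@prob1_mono _ _ _ (Q o) (hit 0 (pi o) `&` ~` \bigcup_k F k)).
- by apply: measurableI; [exact: meas_hit|exact: measurableC].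
- exact: meas_io.
- move=> z [z0 nF] N; apply: contrapT => none; apply: nF.
  have bd k : `[< pi (z k) = pi o >] -> (k <= N)%N.
    move=> /asboolP zk; rewrite leqNgt; apply/negP => Nk; apply: none; exists k.
    by split=> //; exact: ltnW.
  have ex : exists k, `[< pi (z k) = pi o >] by exists 0%N; apply/asboolP.
  case: (ex_maxnP ex bd) => k /asboolP zk kmax.
  exists k => //; split=> // i i0 zi.
  by have := kmax (k + i)%N; rewrite asboolT // => /(_ isT); lia.
apply: prob1_and; rewrite ?hit0 //; first exact: meas_hit.
- exact: measurableC.
- by apply/prob1C; rewrite ?setCK //; exact: measurableC.
Qed.

(** Once [c] is reached, within [M] steps, the next [N] steps contribute the same expected number of
    visits as at any other vertex, by [visits_indep]. Conditioning on the first step, by induction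
    on [M], replaces a hitting time. *)
Lemma Q_hit_unbounded N M c : forall x,
  Q x [set z | exists i, (i <= M)%N /\ pi (z i) = c] * visits x N <=
  \sum_(n < (N + M).+1) Q x (hit n c).
Proof.
pose U m : set (pathX X) := [set z | exists i, (i <= m)%N /\ pi (z i) = c].
have mU m : measurable (U m).
  apply: measP_exists => // i; apply: measP_and; first exact: measP_const; exact: meas_hit.
have v0 x n : 0 <= visits x n by apply: sume_ge0.
suff : forall x, Q x (U M) * visits x N <= \sum_(n < (N + M).+1) Q x (hit n c) by [].
elim: M => [|M IH] x; have [xc|xc] := pselect (pi x = c).
- rewrite -xc addn0; apply: (@le_trans _ _ (1 * visits x N)); last by rewrite mul1e.
  by apply: lee_wpmul2r => //; exact: probability_le1.
- rewrite (_ : Q x (U 0%N) = 0) ?mul0e ?sume_ge0 //.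
  apply/prob0_mono/(_ : Q x (~` [set z | z 0%N = x]) = 0) => //; first exact: measurableC.
    move=> z [i [i0 zi]] zx; apply: xc; rewrite -zx -zi.
    by move: i0; rewrite leqn0 => /eqP ->.
  by apply/prob1C => //; exact: Q_start.
- apply: (@le_trans _ _ (1 * visits x N)).
    by apply: lee_wpmul2r => //; exact: probability_le1.
  rewrite mul1e /visits xc (big_ord_widen (N + M.+1).+1 (fun n => Q x (hit n c))); last by lia.
  rewrite [leLHS]big_mkcond /=; apply: lee_sum => i _; case: ifP => // _.
have shiftU : Q x (U M.+1) = \esum_(y in [set: X]) ((p x y)%:E * Q y (U M)).
  rewrite -(markov1 Xcount p_ge0 p_sum Q_cyl) //.
  rewrite -[LHS](Q_as (mU M.+1) (mstart x) (Q_start Q_cyl x)).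
  rewrite -[RHS](Q_as _ (mstart x) (Q_start Q_cyl x)); last exact: measurable_tshift.
  congr (Q x _); apply/seteqP; split=> z [zx].
    move=> [[|i] [iM zi]]; first by case: xc; rewrite -zi zx.
    by split=> //; exists i.
  by move=> [i [iM zi]]; split=> //; exists i.+1.
rewrite shiftU addnS big_ord_recl.
have -> : Q x (hit 0 c) = 0.
  apply/prob0_mono/(_ : Q x (~` [set z | z 0%N = x]) = 0) => //; first exact: meas_hit.
  - exact: measurableC.
  - by move=> z zi zx; apply: xc; rewrite -zx.
  by apply/prob1C => //; exact: Q_start.
rewrite add0e.
have st n : Q x (hit n.+1 c) = \esum_(y in [set: X]) ((p x y)%:E * Q y (hit n c)).
  by rewrite -(markov1 Xcount p_ge0 p_sum Q_cyl) //; exact: meas_hit.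
under eq_bigr do rewrite st.
rewrite -esum_sum; last by move=> y n _ _; rewrite mule_ge0 // lee_fin.
have vfin : visits x N \is a fin_num by exact: visits_fin.
rewrite muleC -(fineK vfin) -esumZl ?fine_ge0 //; last first.
  by move=> y _; rewrite mule_ge0 // lee_fin.
apply: le_esum => y _; rewrite fineK // -ge0_sume_distrr // muleCA.
apply: lee_wpmul2l; first by rewrite lee_fin.
by rewrite muleC (visits_indep x y).
Qed.

(** Any constant in the open interval from 1/2 to 1 would serve: two siblings together have to
    outweigh their parent. *)
Lemma Q_hits_tend1 x c : (forall v, Q x (io v) = 1) ->
  exists M, ((3 / 4)%:E < Q x [set z | exists i, (i <= M)%N /\ pi (z i) = c]).
Proof.
move=> io1; pose U m : set (pathX X) := [set z | exists i, (i <= m)%N /\ pi (z i) = c].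
have mU m : measurable (U m).
  apply: measP_exists => // i; apply: measP_and; first exact: measP_const; exact: meas_hit.
have mUU : measurable (\bigcup_m U m) by exact: bigcupT_measurable.
have U1 : Q x (\bigcup_m U m) = 1.
  apply: prob1_mono (io1 c) => //; first exact: meas_io.
  by move=> z /(_ 0%N) [n [_ zn]]; exists n => //; exists n.
apply: (prob_nondecreasing mU _ U1); last by lra.
by move=> m n z mn [i [im zi]]; exists i; split=> //; exact: leq_trans mn.
Qed.

(* If [pi o] were recurrent, each of two children of [pi o] would be visited almost as
   often as [pi o]; but mass transport bounds the visits to all children together by
   the visits to [pi o]. *)
Lemma transience o : exists K : R, forall N, visits o N <= K%:E.
Proof.
have [[K h]|unb] := pselect (exists K : R, forall N, visits o N <= K%:E); first by exists K.
have nb0 : Q o (never_back (pi o)) = 0.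
  apply/eqP; rewrite eq_le measure_ge0 andbT leNgt; apply/negP => pos.
  have nbfin : Q o (never_back (pi o)) \is a fin_num.
    by apply: fin_num_measure; exact: meas_never_back.
  case: unb; exists (fine (Q o (never_back (pi o))))^-1%R => N.
  have := visits_escape o N.
  rewrite -(fineK nbfin) -(fineK (visits_fin o N)) -EFinM !lee_fin.
  rewrite -{1}(fineK nbfin) lte_fin in pos.
  by rewrite -ler_pdivlMr // div1r.
have io1 v : Q o (io v) = 1.
  have [x xv] := pi_surj v.
  have : Q x (io v) = 1.
    by rewrite -(last_visit_null nb0) -xv; apply: (Q_diag x o equi_io); exact: meas_io.
  have mio := meas_io v.
  move=> /(prob1C _ mio).1 h; apply/prob1C => //.
  apply: (null_all Xcount p_ge0 p_sum Q_cyl irr (x := x)) h.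
    exact: measurableC.
  by move=> z; have := io_invariant v z; rewrite /setC /=; tauto.
have [c [c' [cc' cv c'v]]] := two_children w (pi o) q_ge2.
have [M hM] := Q_hits_tend1 c io1; have [M' hM'] := Q_hits_tend1 c' io1.
(* The walk starts at a child of [v]. Only the parent of the starting vertex receives mass, so the
   total is at most 1. *)
pose E v : set (pathX X) := [set z | par (pi (z 0%N)) = v].
have mE v : measurable (E v) by exact: (measP_coord Xcount 0 (fun x => par (pi x) = v)).
have eE : equivariant E.
  move=> G g v z [_ _ [g' gK g'K] piG gpar]; rewrite /E /= piG -gpar.
  by split=> [/(can_inj gK)|->].
have mass1 : mass o E <= 1.
  have <- : \esum_(v in [set par (pi o)]) Q o (E v) = mass o E.
    rewrite [LHS]esum_mkcond; apply: eq_esum => v _; rewrite in_set1.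
    have [//|/eqP vo] := eqVneq v (par (pi o)); apply/esym.
    have := Q_start_cond Xcount Q_cyl o (fun x => par (pi x) = v) (@measurableT _ (pathX X)).
    rewrite asboolF => [<-|h]; last by apply: vo.
    by congr (Q o _); apply/seteqP; split=> z; [split|case].
  by rewrite esum_set1 ?measure_ge0 //; exact: probability_le1.
have fmass : mass o E < +oo by apply: le_lt_trans mass1 _; rewrite ltry.
(* With [V = visits o N], two children give at least [3/2 * V] visits and transport allows at most
   [V + M0], hence the bound [2 * M0]. *)
set M0 := (M + M')%N; case: unb; exists (2 * M0%:R)%R => N.
have grow (m : nat) (b : T) : (m <= M0)%N ->
    (3 / 4)%:E < Q o [set z | exists i, (i <= m)%N /\ pi (z i) = b] ->
    (3 / 4)%:E * visits o N <= \sum_(n < (N + M0).+1) Q o (hit n b).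
  move=> mM h; apply: le_trans (Q_hit_unbounded N M0 b o).
  apply: lee_wpmul2r; first by apply: sume_ge0 => i _; rewrite measure_ge0.
  apply: le_trans (ltW h) _; apply: prob_mono => //.
  - by apply: measP_exists => // i; apply: measP_and; first exact: measP_const; exact: meas_hit.
  - by apply: measP_exists => // i; apply: measP_and; first exact: measP_const; exact: meas_hit.
  by move=> z [i [im zi]]; exists i; split=> //; exact: leq_trans mM.
have g1 := grow M c (leq_addr _ _) hM; have g2 := grow M' c' (leq_addl _ _) hM'.
have mt := mass_transport (N + M0) eE mE fmass.
have sumle : \sum_(n < (N + M0).+1) Q o (hit n c) + \sum_(n < (N + M0).+1) Q o (hit n c') <=
    \sum_(n < (N + M0).+1) Q o (tshift n @^-1` E (pi o)).
  rewrite -big_split; apply: lee_sum => n _.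
  pose F k := if k is 0%N then hit n c else hit n c'.
  have := @prob_disjoint_le _ _ _ (Q o) 2 F (tshift n @^-1` E (pi o)).
  rewrite !big_ord_recl big_ord0 adde0; apply.
  - exact: measurable_tshift.
  - by case=> [|k]; exact: meas_hit.
  - by move=> [|k] [|[|l]] z //= _ _; rewrite /hit /= => -> /cc'.
  - by move=> [|[|k]] z //= _; rewrite /hit /E /= /tshift addn0 => ->.
have visD : visits o (N + M0) <= visits o N + M0%:R%:E.
  rewrite /visits -addSn big_split_ord /= leeD2l //.
  apply: (@le_trans _ _ (\sum_(i < M0) 1)); last first.
    by rewrite sumEFin sumr_const card_ord.
  by apply: lee_sum => i _; apply: probability_le1; exact: meas_hit.
have vf := fineK (visits_fin o N).
have : (3 / 4)%:E * visits o N + (3 / 4)%:E * visits o N <= visits o N + M0%:R%:E.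
  apply: le_trans (leeD g1 g2) (le_trans sumle (le_trans mt _)).
  apply: le_trans visD; rewrite -[leRHS]mule1; apply: lee_wpmul2l => //.
  by apply: sume_ge0 => i _; rewrite measure_ge0.
by rewrite -vf -!EFinM -!EFinD !lee_fin; lra.
Qed.

(** Since [same_comp] fails at [v] itself, this includes arriving at, leaving or pausing at [v]. A
    path without further crossings stays in one component of the tree minus [v]. *)
Definition crossing v : set (pathX X) := [set z | ~ same_comp w v (pi (z 0%N)) (pi (z 1%N))].

Lemma meas_crossing v : measurable (crossing v).
Proof. exact: (measP_coord2 Xcount 0 1 (fun x y => ~ same_comp w v (pi x) (pi y))). Qed.

Lemma symm_dsc G g v u : symm G g -> dsc (g v) (g u) <-> dsc v u.
Proof.
move=> [_ _ [g' gK g'K] _ gpar].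
have gi n (x : T) : g (iter n par x) = iter n par (g x) by elim: n => //= n IH; rewrite gpar IH.
split=> -[n h]; exists n; last by rewrite -gi h.
by apply: (can_inj gK); rewrite gi.
Qed.

Lemma symm_same_comp G g v u u' : symm G g ->
  same_comp w (g v) (g u) (g u') <-> same_comp w v u u'.
Proof.
move=> sG; have [_ _ [g' gK g'K] _ gpar] := sG.
rewrite /same_comp !(symm_dsc _ _ sG); split=> -[[c [cv cu cu']]|h]; try by right.
  left; exists (g' c); split; last by apply/(symm_dsc _ _ sG); rewrite g'K.
    by apply: (can_inj gK); rewrite gpar g'K.
  by apply/(symm_dsc _ _ sG); rewrite g'K.
by left; exists (g c); split; [rewrite -gpar cv|exact/(symm_dsc _ _ sG)|exact/(symm_dsc _ _ sG)].
Qed.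

Lemma equi_crossing : equivariant crossing.
Proof.
move=> G g v z sG; have [_ _ _ piG _] := sG; rewrite /crossing /= !piG.
by rewrite (symm_same_comp _ _ _ sG).
Qed.

Hypothesis crossing_mass : mass point crossing < +oo.

Definition crossed_io v : set (pathX X) :=
  [set z | forall N, exists n, (N <= n)%N /\ crossing v (tshift n z)].

Lemma meas_crossed_io v : measurable (crossed_io v).
Proof.
apply: measP_forall => // N; apply: measP_exists => // n; apply: measP_and; first exact: measP_const.
by apply: measurable_tshift => //; exact: meas_crossing.
Qed.

(** The transport bound concerns the vertex over which the walk starts, so Borel-Cantelli is applied
    from some [y] over [v]; irreducibility transfers the null event to every starting point. *)
Lemma crossed_io_null x v : Q x (crossed_io v) = 0.
Proof.
have [y yv] := pi_surj v.
have fy : mass y crossing < +oo.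
  by rewrite (mass_indep point y equi_crossing meas_crossing).
apply: (null_all Xcount p_ge0 p_sum Q_cyl irr (x := y)); first exact: meas_crossed_io.
  move=> z; split=> h N.
    by have [n [Nn zn]] := h N; exists n.+1; split=> //; exact: ltnW.
  by have [[|n] [Nn zn]] := h N.+1 => //; exists n.
have [K hK] := transience y.
pose F n : set (pathX X) := tshift n @^-1` crossing v.
have mF n : measurable (F n) by apply: measurable_tshift => //; exact: meas_crossing.
have Fsum : \sum_(n <oo) Q y (F n) < +oo.
  have bound N : \sum_(0 <= n < N) Q y (F n) <= K%:E * mass y crossing.
    apply: (@le_trans _ _ (\sum_(0 <= n < N.+1) Q y (F n))).
      by apply: lee_sum_nneg_natr => // n _ _; rewrite measure_ge0.
    rewrite big_mkord /F -yv.
    apply: le_trans (mass_transport N equi_crossing meas_crossing fy) _.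
    by apply: lee_wpmul2r; [exact: mass_ge0|exact: hK].
  apply: le_lt_trans (_ : K%:E * mass y crossing < +oo).
    apply: lime_le; first by apply: is_cvg_nneseries => n _ _; rewrite measure_ge0.
    by apply: nearW => N; exact: bound.
  have mf : mass y crossing \is a fin_num by rewrite ge0_fin_numE ?mass_ge0.
  by rewrite -(fineK mf) -EFinM ltry.
have := lim_sup_set_cvg0 mF Fsum.
apply: prob0_mono => //; first exact: meas_crossed_io.
  by apply: bigcapT_measurable => N; apply: bigcup_measurable => n _.
by move=> z h N _; have [n [Nn zn]] := h N; exists n.
Qed.

Definition settles v : set (pathX X) :=
  [set z | exists N, forall n, (N <= n)%N -> same_comp w v (pi (z n)) (pi (z n.+1))].

Lemma Q_settles x : Q x [set z | forall v, settles v z] = 1.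
Proof.
have mS v : measurable (settles v).
  apply: measP_ev => // n.
  exact: (measP_coord2 Xcount n n.+1 (fun x y => same_comp w v (pi x) (pi y))).
apply: prob1_forall => // v; apply/prob1C => //.
apply: prob0_mono (crossed_io_null x v); first exact: measurableC.
  exact: meas_crossed_io.
move=> z ns N; apply: contrapT => none; apply: ns; exists N => n Nn.
apply: contrapT => nc; apply: none; exists n; split=> //.
by rewrite /crossing /= /tshift addn0 addn1.
Qed.

End Coordinate.

(** * Drift *)

Section DominatedSums.
Variables (R : realType) (I : choiceType).
Local Open Scope ereal_scope.

Lemma sum_eventually_small (s : seq I) (f : nat -> I -> \bar R) :
  (forall v (e : R), (0 < e)%R -> exists L, forall l, (L <= l)%N -> f l v < e%:E) ->
  forall e : R, (0 < e)%R -> exists L, forall l, (L <= l)%N -> \sum_(v <- s) f l v < e%:E.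
Proof.
move=> f0; elim: s => [|a s IH] e e0; first by exists 0%N => l _; rewrite big_nil lte_fin.
have e2 : (0 < e / 2)%R by rewrite divr_gt0.
have [L1 h1] := f0 a _ e2; have [L2 h2] := IH _ e2.
exists (maxn L1 L2) => l; rewrite geq_max => /andP[l1 l2].
by rewrite big_cons (splitr e) EFinD lteD ?h1 ?h2.
Qed.

(** Dominated convergence for sums: a finite set carries all of [F] up to [e / 2], and on it the
    terms are small eventually. *)
Lemma esum_dominated_small (f : nat -> I -> \bar R) (F : I -> \bar R) :
  (forall l v, 0 <= f l v <= F v) -> \esum_(v in [set: I]) F v < +oo ->
  (forall v (e : R), (0 < e)%R -> exists L, forall l, (L <= l)%N -> f l v < e%:E) ->
  forall e : R, (0 < e)%R -> exists L, forall l, (L <= l)%N ->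
    \esum_(v in [set: I]) f l v < e%:E.
Proof.
move=> fF Foo f0 e e0.
have F0 v : 0 <= F v by have /andP[a b] := fF 0%N v; exact: le_trans a b.
pose S := \esum_(v in [set: I]) F v; have Sfin : S \is a fin_num by rewrite ge0_fin_numE // esum_ge0.
have e2 : (0 < e / 2)%R by rewrite divr_gt0.
have [V finV VS] : exists2 V, finite_set V & S - (e / 2)%:E < \sum_(v \in V) F v.
  have : S - (e / 2)%:E < S by rewrite lteBlDr // lteDl // lte_fin.
  by move=> /ereal_sup_gt [_ [V [finV _] <-] h]; exists V.
have split (g : I -> \bar R) : (forall v, 0 <= g v) -> \esum_(v in [set: I]) g v =
    \sum_(v \in V) g v + \esum_(v in ~` V) g v.
  move=> g0; rewrite (esumID V) // !setTI esum_fset //; exact: finV.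
have tail : \esum_(v in ~` V) F v < (e / 2)%:E.
  have := split F F0; rewrite -/S.
  move: VS; set A := \sum_(_ \in _) _; set B := esum _ _ => VS SE.
  have A0 : 0 <= A by apply: fsume_ge0.
  have B0 : 0 <= B by apply: esum_ge0.
  have Af : A \is a fin_num.
    by rewrite ge0_fin_numE // (le_lt_trans _ Foo) // -/S SE leeDl.
  have Bf : B \is a fin_num.
    by rewrite ge0_fin_numE // (le_lt_trans _ Foo) // -/S SE leeDr.
  have VS' : (fine A + fine B - e / 2 < fine A)%R.
    by rewrite -lte_fin EFinB EFinD !fineK // -SE.
  by rewrite -(fineK Bf) lte_fin; lra.
have [L hL] : exists L, forall l, (L <= l)%N ->
    \sum_(v <- fset_set V) f l v < (e / 2)%:E.
  exact: sum_eventually_small.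
exists L => l Ll; rewrite split; last by move=> v; have /andP[] := fF l v.
rewrite (splitr e) EFinD; apply: lteD; first by rewrite fsbig_finite // hL.
apply: le_lt_trans tail; apply: le_esum => v _; by have /andP[] := fF l v.
Qed.

End DominatedSums.

Section ProbabilityLimits.
Context d (T : measurableType d) (R : realType) (P : probability T R).
Local Open Scope ereal_scope.

(** Continuity from above for the unions of tails, which contain the single events. *)
Lemma prob_limsup_null (F : nat -> set T) : (forall n, measurable (F n)) ->
  P (lim_sup_set F) = 0 ->
  forall e : R, (0 < e)%R -> exists L, forall l, (L <= l)%N -> P (F l) < e%:E.
Proof.
move=> mF F0 e e0.
have mU n : measurable (\bigcup_(k >= n) F k) by apply: bigcup_measurable.
have cv : P (\bigcup_(k >= n) F k) @[n --> \oo] --> (0 : \bar R).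
  rewrite -F0; apply: lim_sup_set_cvg => //.
  by apply: le_lt_trans (probability_le1 P (mU 0%N)) _; rewrite ltry.
have : \forall n \near \oo, P (\bigcup_(k >= n) F k) < e%:E.
  apply: (cv [set y | y < e%:E]); apply: open_nbhs_nbhs; split.
    exact: open_ereal_lt_ereal.
  by rewrite /= lte_fin.
move=> [L _ h]; exists L => l Ll; apply: le_lt_trans (h l Ll).
by apply: prob_mono => // x Fx; exists l => //=.
Qed.

Lemma prob_fibers_le (I : choiceType) (F : I -> set T) (A : set T) :
  measurable A -> (forall i, measurable (F i)) -> (forall i, F i `<=` A) ->
  trivIset setT F -> \esum_(i in [set: I]) P (F i) <= P A.
Proof.
move=> mA mF FA tF; apply: ge_ereal_sup => _ [V [finV _] <-].
rewrite -measure_fin_bigcup //; last by move=> i j _ _; exact: tF.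
apply: prob_mono => //; first exact: fin_bigcup_measurable.
by move=> x [i _ Fx]; exact: FA Fx.
Qed.

End ProbabilityLimits.

Section Drift.
Variables (R : realType) (X : pointedType) (p : X -> X -> R).
Hypothesis Xcount : countable [set: X].
Hypothesis p_ge0 : forall x y, 0 <= p x y.
Hypothesis p_sum : forall x, \esum_(y in [set: X]) (p x y)%:E = 1%E.
Variable Q : X -> probability (pathX X) R.
Hypothesis Q_cyl : forall x n xs, Q x (cyl n xs) =
  ((xs 0%N == x)%:R * \prod_(i < n) p (xs i) (xs i.+1))%:E.
Hypothesis irr : forall x y, exists n, (0 < Q x [set z | z n = y])%E.
Variables (q : nat) (T : homTree q) (w : tree_end T) (pi : X -> T).
Hypothesis q_ge2 : (2 <= q)%N.
Hypothesis Tcount : countable [set: T].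
Hypothesis pi_surj : forall v, exists x, pi x = v.
Local Notation par := (par w).
Local Notation dsc := (dsc w).
Hypothesis sym_trans : forall x y, exists G g, symm p w pi G g /\ G x = y.
Local Open Scope ereal_scope.
Hypothesis crossing_mass : mass Q point (crossing w pi) < +oo.
Implicit Types (x y o : X) (u v c : T) (B E : T -> set (pathX X)).

Local Notation mass := (mass Q).
Let mshift := mass_shift Xcount p_ge0 p_sum Q_cyl sym_trans.

Lemma mass_split x B (C : T -> set (pathX X)) :
  (forall v, measurable (B v)) -> (forall v, measurable (C v)) ->
  mass x B = mass x (fun v => B v `&` C v) + mass x (fun v => B v `&` ~` C v).
Proof.
move=> mB mC; rewrite /mass -esumD => [||v _]; rewrite ?measure_ge0 //.
apply: eq_esum => v _; rewrite -setDE addeC.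
exact: measureDI.
Qed.

Let meas_dsc n v : measurable ([set z | dsc v (pi (z n))] : set (pathX X)).
Proof. exact: (measP_coord Xcount n (fun x => dsc v (pi x))). Qed.

Let meas_ndsc n v : measurable ([set z | ~ dsc v (pi (z n))] : set (pathX X)).
Proof. exact: (measP_coord Xcount n (fun x => ~ dsc v (pi x))). Qed.

Definition enters l v : set (pathX X) :=
  [set z | ~ dsc v (pi (z 0%N)) /\ forall i, (1 <= i <= l.+1)%N -> dsc v (pi (z i))].

Definition leaves l v : set (pathX X) :=
  [set z | (forall i, (i <= l)%N -> dsc v (pi (z i))) /\ ~ dsc v (pi (z l.+1))].

Lemma meas_enters l v : measurable (enters l v).
Proof.
apply: measP_and; first exact: meas_ndsc.
by apply: measP_forall => // i; apply: measP_imp; first exact: measP_const.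
Qed.

Lemma meas_leaves l v : measurable (leaves l v).
Proof.
apply: measP_and; last exact: meas_ndsc.
by apply: measP_forall => // i; apply: measP_imp; first exact: measP_const.
Qed.

Let gdsc (G : X -> X) g v (z : nat -> X) n : symm p w pi G g ->
  dsc (g v) (pi ((G \o z : nat -> X) n)) <-> dsc v (pi (z n)).
Proof.
by move=> sG; have [_ _ _ piG _] := sG; rewrite /= piG; exact: symm_dsc sG.
Qed.

Lemma equi_leaves l : equivariant p w pi (leaves l).
Proof.
move=> G g v z sG; split=> -[h1 h2]; split=> [i il|h].
- by apply/(gdsc v z i sG); exact: h1.
- by apply: h2; apply/(gdsc v z l.+1 sG).
- by apply/(gdsc v z i sG); exact: h1.
- by apply: h2; apply/(gdsc v z l.+1 sG).
Qed.

Lemma crossing_ge o B : (forall v, measurable (B v)) ->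
  (forall v z, B v z -> crossing w pi v z) -> mass o B < +oo.
Proof.
move=> mB BC; apply: le_lt_trans crossing_mass.
have mC := meas_crossing Xcount w pi.
rewrite (mass_indep Q_cyl sym_trans o point (@equi_crossing _ _ _ _ _ _ _) mC).
by apply: mass_le => // v; exact: meas_crossing.
Qed.

Lemma same_comp_chd v (x y : T) : same_comp w v x y -> dsc v x <-> dsc v y.
Proof.
move=> [[c [<- cx cy]]|[nx ny]]; last by tauto.
by split=> _; exact: dsc_parl.
Qed.

Lemma enters_fin o l : mass o (enters l) < +oo.
Proof.
apply: crossing_ge => [v|v z [h1 h2] sc]; first exact: meas_enters.
by apply: h1; apply/(same_comp_chd sc); exact: h2.
Qed.

(** Here the crossing happens at time [l] rather than at time 0, so the mass is compared with that
    of [leaves 0] shifted by [l]. *)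
Lemma leaves_fin o l : mass o (leaves l) < +oo.
Proof.
have equi := equi_leaves l; have meas := meas_leaves l.
apply: (@le_lt_trans _ _ (mass o (fun v => tshift l @^-1` leaves 0 v))).
  apply: mass_le => // [v|v z [h1 h2]].
    by apply: measurable_tshift => //; exact: meas_leaves.
  split; last by rewrite /tshift addn1.
  by move=> i; rewrite leqn0 /tshift => /eqP->; rewrite addn0; exact: h1.
have fl0 : mass o (leaves 0) < +oo.
  apply: crossing_ge => [v|v z [h1 h2] sc]; first exact: meas_leaves.
  by apply: h2; apply/(same_comp_chd sc); exact: h1.
by rewrite mshift //; [exact: equi_leaves|exact: meas_leaves].
Qed.

(* [leaves l], read one step later, splits according to whether the path starts in T_v:
   the first part is [leaves l.+1], the second is what [enters l] has beyond
   [enters l.+1]. *)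
Lemma enters_leaves_step o l :
  mass o (leaves l) + mass o (enters l.+1) = mass o (leaves l.+1) + mass o (enters l).
Proof.
pose W v : set (pathX X) := tshift 1 @^-1` leaves l v.
pose A v : set (pathX X) := [set z | dsc v (pi (z 0%N))].
pose B v : set (pathX X) := [set z | dsc v (pi (z l.+2))].
have mW v : measurable (W v) by apply: measurable_tshift => //; exact: meas_leaves.
have -> : mass o (leaves l) = mass o (leaves l.+1) + mass o (fun v => W v `&` ~` A v).
  rewrite -(mshift 1 (equi_leaves l) (meas_leaves l) (leaves_fin o l)) -/W.
  rewrite (_ : leaves l.+1 = fun v => W v `&` A v).
    by apply: mass_split => v; [exact: mW|exact: meas_dsc].
  apply/funext => v; apply/seteqP; split=> z.
    by move=> [h1 h2]; split; [split=> // i il; exact: (h1 i.+1)|exact: (h1 0%N)].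
  by move=> [[h1 h2] h0]; split=> // -[|i] // il; exact: (h1 i).
have -> : mass o (enters l) = mass o (enters l.+1) + mass o (fun v => W v `&` ~` A v).
  rewrite (_ : enters l.+1 = fun v => enters l v `&` B v); last first.
    apply/funext => v; apply/seteqP; split=> z.
      by move=> [h0 h1]; split; [split=> // i /andP[i1 il]; apply: h1; rewrite i1 ltnW|apply: h1; rewrite leqnn].
    move=> [[h0 h1] h2]; split=> // i /andP[i1]; rewrite leq_eqVlt => /orP[/eqP->//|].
    by move=> il; apply: h1; rewrite i1.
  rewrite (_ : (fun v => W v `&` ~` A v) = fun v => enters l v `&` ~` B v).
    by apply: mass_split => v; [exact: meas_enters|exact: meas_dsc].
  apply/funext => v; apply/seteqP; split=> z.
    move=> [[h1 h2] h0]; split=> //; split=> // -[|i] // /andP[_ il]; exact: (h1 i).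
  by move=> [[h0 h1] h2]; split=> //; split=> // i il; exact: h1.
by rewrite addeAC -addeA addeC -!addeA; congr (_ + _); rewrite addeC.
Qed.

Variable a : R.
Hypothesis drift_a : mass point (enters 0) = mass point (leaves 0) + a%:E.

(** By [enters_leaves_step] the difference of the two masses does not depend on [l]. *)
Lemma drift_eq l : mass point (enters l) = mass point (leaves l) + a%:E.
Proof.
elim: l => [//|l IH]; have := enters_leaves_step point l; rewrite IH.
have f1 : mass point (leaves l) \is a fin_num by rewrite ge0_fin_numE ?leaves_fin ?mass_ge0.
have f2 : mass point (leaves l.+1) \is a fin_num by rewrite ge0_fin_numE ?leaves_fin ?mass_ge0.
have f3 : mass point (enters l.+1) \is a fin_num by rewrite ge0_fin_numE ?enters_fin ?mass_ge0.
rewrite -(fineK f1) -(fineK f2) -(fineK f3) -!EFinD => -[h]; congr (_%:E); lra.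
Qed.

Definition to_root : set (pathX X) :=
  [set z | forall v, exists N, forall n, (N <= n)%N -> ~ dsc v (pi (z n))].

Lemma meas_to_root : measurable to_root.
Proof. by apply: measP_forall => // v; apply: measP_ev. Qed.

Lemma prob0_enters_limsup o : Q o to_root = 1 ->
  forall v, Q o (lim_sup_set (fun l => enters l v)) = 0.
Proof.
move=> r1 v; apply: prob0_mono ((prob1C _ meas_to_root).1 r1).
- by apply: bigcapT_measurable => N; apply: bigcup_measurable => n _; exact: meas_enters.
- by apply: measurableC; exact: meas_to_root.
move=> z h rz; have [N hN] := rz v.
have [l /= Nl [_ hl]] := h N I.
by apply: (hN N.+1) => //; apply: hl.
Qed.

(** No T_v is entered for good, so by domination with [enters 0] the mass of [enters l] tends to 0;
    but [drift_eq] keeps it at least [a]. *)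
Lemma to_root_drift : Q point to_root = 1 -> (a <= 0)%R.
Proof.
move=> r1; rewrite leNgt; apply/negP => a0.
have [|| L hL] := @esum_dominated_small R T (fun l v => Q point (enters l v))
  (fun v => Q point (enters 0 v)) _ (enters_fin point 0) _ a a0.
  - move=> l v; rewrite measure_ge0 /=; apply: prob_mono; try exact: meas_enters.
    by move=> z [h1 h2]; split=> // i /andP[i1 il]; apply: h2; rewrite i1 (leq_trans il).
  - move=> v; apply: prob_limsup_null; first by move=> n; exact: meas_enters.
    exact: prob0_enters_limsup.
have := hL L (leqnn L); rewrite -/(mass point (enters L)) drift_eq.
by apply/negP; rewrite -leNgt leeDr // mass_ge0.
Qed.

Definition trapped : set (pathX X) :=
  [set z | exists v N, forall n, (N <= n)%N -> dsc v (pi (z n))].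

Lemma meas_trapped : measurable trapped.
Proof. by apply: measP_exists => // v; apply: measP_ev. Qed.

Definition up b (x : T) := iter b par x.

(* Indexing the vertex [v] left at time [l] as the [b]-th ancestor of the position at
   that time turns the mass of [leaves l] into a sum over [b] that is dominated
   uniformly in [l]. *)
Definition escapes b l : set (pathX X) :=
  [set z | (forall i, (i <= l)%N -> dsc (up b (pi (z l))) (pi (z i))) /\
           ~ dsc (up b (pi (z l))) (pi (z l.+1))].

Lemma meas_escapes b l : measurable (escapes b l).
Proof.
apply: measP_and.
  apply: measP_forall => // i; apply: measP_imp; first exact: measP_const.
  exact: (measP_coord2 Xcount l i (fun x y => dsc (up b (pi x)) (pi y))).
exact: (measP_coord2 Xcount l l.+1 (fun x y => ~ dsc (up b (pi x)) (pi y))).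
Qed.

(** The finitely many early positions are absorbed by replacing the vertex by a higher ancestor. *)
Lemma trapped_all z : trapped z -> exists v, forall n, dsc v (pi (z n)).
Proof.
move=> [v [N h]].
suff [u [uv hu]] : exists u, dsc u v /\ forall n, (n < N)%N -> dsc u (pi (z n)).
  exists u => n; case: (ltnP n N) => [|Nn]; first exact: hu.
  exact: dsc_trans uv (h n Nn).
elim: N {h} => [|N [u [uv hu]]]; first by exists v; split=> //; exact: dsc_refl.
have [a1 [a2 ab]] := common_ancestor w u (pi (z N)).
exists (iter a1 par u); have au : dsc (iter a1 par u) u by exact: dsc_iter.
split; first exact: dsc_trans au uv.
move=> n; rewrite ltnS leq_eqVlt => /orP[/eqP->|nN]; last exact: dsc_trans au (hu n nN).
by rewrite ab; exact: dsc_iter.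
Qed.

(** The vertex left at a later escape has all earlier positions below it, including one outside the
    subtree left before, so it is a proper ancestor of the previous one. The heights thus drop at
    each escape; but an ancestor of a vertex that confines the path forever is never left. *)
Lemma escapes_finitely b z : trapped z -> ~ lim_sup_set (escapes b) z.
Proof.
move=> /trapped_all [v hv] io.
pose lev (x : T) := busemann w x.
have ex N : exists2 l, (N <= l)%N & escapes b l z by exact: io N I.
suff desc k : exists2 l, escapes b l z & (lev (up b (pi (z l))) <= lev (pi (z 0%N)) - k%:Z)%R.
  (* After this many escapes the vertex left is higher up than [v], so it is an ancestor of [v]. *)
  have [l [h1 h2]] := desc (`|lev (pi (z 0%N)) - lev v|.+1)%N.
  have := h1 0%N isT; set u := up b _ => uz.
  have vz := hv 0%N.
  have [/dsc_level|vu] := dsc_comparable vz uz; first by rewrite /lev /u; lia.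
  by case: h2; exact: dsc_trans vu (hv l.+1).
elim: k => [|k [l [h1 h2] hl]].
  have [l _ el] := ex 0%N; exists l => //; rewrite subr0; apply: dsc_level.
  exact: el.1.
have [l' ll' [h1' h2']] := ex l.+1; exists l' => //.
have c := dsc_comparable (h1 0%N isT) (h1' 0%N isT).
case: c => [c|c]; first by case: h2; exact: dsc_trans c (h1' l.+1 ll').
have : up b (pi (z l')) <> up b (pi (z l)).
  by move=> E; apply: h2; rewrite -E; exact: h1'.
move: c hl; set u := up b (pi (z l)); set u' := up b (pi (z l')) => -[[|n] <-] // hl _.
by rewrite /lev busemann_iter in hl *; lia.
Qed.

Lemma escapes_limsup_null o b : Q o trapped = 1 -> Q o (lim_sup_set (escapes b)) = 0.
Proof.
move=> t1; apply: prob0_mono ((prob1C _ meas_trapped).1 t1).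
- by apply: bigcapT_measurable => N; apply: bigcup_measurable => n _; exact: meas_escapes.
- by apply: measurableC; exact: meas_trapped.
by move=> z h tz; exact: escapes_finitely tz h.
Qed.

Let first_escape b v : set (pathX X) := [set z | ~ dsc (up b v) (pi (z 1%N))].

(** Only the step after time [l] is kept: leaving the subtree of the [b]-th ancestor of the current
    vertex has a probability that depends neither on the state nor on [l]. *)
Lemma escapes_le o b l : Q o (escapes b l) <= Q o (first_escape b (pi o)).
Proof.
have mfe v : measurable (first_escape b v) by exact: meas_ndsc.
have efe : equivariant p w pi (first_escape b).
  move=> G g v z sG; have [_ _ _ piG gpar] := sG.
  have gi n (u : T) : g (up n u) = up n (g u) by elim: n => //= n IH; rewrite gpar IH.
  by rewrite /first_escape /= -gi piG; have := symm_dsc (up b v) (pi (z 1%N)) sG; tauto.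
pose A : set (pathX X) := [set z | ~ dsc (up b (pi (z 0%N))) (pi (z 1%N))].
have mA : measurable A.
  exact: (measP_coord2 Xcount 0 1 (fun x y => ~ dsc (up b (pi x)) (pi y))).
have AE y : Q y A = Q o (first_escape b (pi o)).
  rewrite (Q_diag Q_cyl sym_trans o y efe mfe).
  have ms : measurable ([set z | z 0%N = y] : set (pathX X)).
    exact: (measP_coord Xcount 0 (fun x => x = y)).
  rewrite -(Q_as mA ms (Q_start Q_cyl y)) -(Q_as (mfe (pi y)) ms (Q_start Q_cyl y)).
  congr (Q y _); apply/seteqP.
  by split=> z [/= zy h]; split=> //; move: h; rewrite /A /first_escape /= zy.
have := markov_const Xcount p_ge0 p_sum Q_cyl l o (A := fun=> True) mA (fun y _ => AE y).
rewrite (_ : [set z | True] = setT) ?probability_setT ?mul1e => [<-|]; last by apply/seteqP; split.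
apply: prob_mono; first exact: meas_escapes.
- by apply: measP_and; first exact: measP_const; apply: measurable_tshift.
- by move=> z [_ h]; split=> //; rewrite /A /tshift /= addn0 addn1.
Qed.

Lemma leaves_le_escapes o l : mass o (leaves l) <= \esum_(b in [set: nat]) Q o (escapes b l).
Proof.
pose F b v : set (pathX X) := [set z | up b (pi (z l)) = v /\ escapes b l z].
have mF b v : measurable (F b v).
  apply: measP_and; last exact: meas_escapes.
  exact: (measP_coord Xcount l (fun x => up b (pi x) = v)).
apply: (@le_trans _ _ (\esum_(v in [set: T]) \esum_(b in [set: nat]) Q o (F b v))).
  apply: le_esum => v _; rewrite -nneseries_esumT //.
  apply: (measure_sigma_subadditive (Q o) (F := fun b => F b v)) => //.
    exact: meas_leaves.
  move=> z [h1 h2]; have [b bv] := h1 l (leqnn l).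
  by exists b => //; split=> //; split; rewrite /up bv.
rewrite exchange_esum //; apply: le_esum => b _.
apply: prob_fibers_le => //; first exact: meas_escapes.
  by move=> v z [].
by move=> u v _ _ [z [[<- _] [<- _]]].
Qed.

Lemma leaves_small : Q point trapped = 1 -> forall e : R, (0 < e)%R ->
  exists l, mass point (leaves l) < e%:E.
Proof.
move=> t1 e e0.
have [||| L hL] := @esum_dominated_small R nat (fun l b => Q point (escapes b l))
  (fun b => Q point (first_escape b (pi point))) _ _ _ e e0.
- by move=> l b; rewrite measure_ge0 escapes_le.
(* The ancestors of the starting vertex are distinct, so the dominating sum over [b] is part of the
   mass of [leaves 0]. *)
- apply: le_lt_trans (leaves_fin point 0).
  rewrite -(@esum_image _ _ _ setT (fun b => up b (pi point)) (fun v =>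
     Q point [set z | ~ dsc v (pi (z 1%N))])); last first.
    by move=> b b' _ _; exact: iter_par_inj.
  rewrite /mass [leLHS]esum_mkcond; apply: le_esum => v _.
  case: ifPn => //; rewrite inE => -[b _ bv].
  have ms : measurable ([set z | z 0%N = point] : set (pathX X)).
    exact: (measP_coord Xcount 0 (fun x => x = point)).
  rewrite -(Q_as (meas_ndsc 1 v) ms (Q_start Q_cyl point)).
  apply: prob_mono; [exact: measurableI|exact: meas_leaves|].
  move=> z [/= z0 h]; split=> // i; rewrite leqn0 => /eqP->; rewrite z0.
  by exists b.
- move=> b; apply: prob_limsup_null; first by move=> n; exact: meas_escapes.
  exact: escapes_limsup_null.
by exists L; apply: le_lt_trans (leaves_le_escapes point L) (hL L (leqnn L)).
Qed.

Lemma settles_child v z : (forall v, settles w pi v z) ->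
  (exists N, forall n, (N <= n)%N -> dsc v (pi (z n))) ->
  exists2 c, par c = v & exists N, forall n, (N <= n)%N -> dsc c (pi (z n)).
Proof.
move=> sz [N h]; have [M hM] := sz v.
have [[c [cv cx _]]|[+ _]] := hM _ (leq_maxr N M); last by have := h _ (leq_maxl N M).
exists c => //; exists (maxn N M) => n /subnKC <-.
elim: (n - _)%N => [|k IH]; first by rewrite addn0.
have [|[c' [cv' cy cz]]|[+ _]] := hM (maxn N M + k)%N _.
- by rewrite (leq_trans (leq_maxr N M)) // leq_addr.
- by rewrite addnS (@dsc_child_unique _ _ w c c' (pi (z (maxn N M + k)%N))) // cv cv'.
- by have := h (maxn N M + k)%N; rewrite (leq_trans (leq_maxl N M)) ?leq_addr // => /(_ isT).
Qed.

Lemma settles_deep k v z : (forall v, settles w pi v z) ->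
  (exists N, forall n, (N <= n)%N -> dsc v (pi (z n))) ->
  exists u, [/\ dsc v u, (busemann w u = busemann w v + k%:Z)%R &
    exists N, forall n, (N <= n)%N -> dsc u (pi (z n))].
Proof.
move=> sz hv; elim: k => [|k [u [vu ulev hu]]].
  by exists v; split=> //; [exact: dsc_refl|rewrite addr0].
have [c cu hc] := settles_child sz hu; exists c; split=> //.
  by apply: dsc_trans vu _; rewrite -cu; exact: dsc_par.
by have := busemann_par w c; rewrite cu ulev; lia.
Qed.

(** Not tending to [w] means that some T_v is visited at arbitrarily late times; once crossings of
    [v] have stopped, such a visit is permanent. *)
Lemma settles_dichotomy z : (forall v, settles w pi v z) -> ~ to_root z -> trapped z.
Proof.
move=> sz; rewrite /to_root /= => nr.
have [v hv] : exists v, ~ exists N, forall n, (N <= n)%N -> ~ dsc v (pi (z n)).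
  by apply: contrapT => h; apply: nr => v; apply: contrapT => h'; apply: h; exists v.
have [N hN] := sz v.
have [n Nn vn] : exists2 n, (N <= n)%N & dsc v (pi (z n)).
  apply: contrapT => h; apply: hv; exists N => n Nn vn; apply: h; exists n => //.
exists v, n => m /subnKC <-; elim: (m - n)%N => [|k IH]; first by rewrite addn0.
rewrite addnS; apply/(same_comp_chd (hN (n + k)%N _)) => //.
by rewrite (leq_trans Nn) // leq_addr.
Qed.

Let stays v : set (pathX X) :=
  [set z | ~ dsc v (pi (z 0%N)) /\ forall i, (1 <= i)%N -> dsc v (pi (z i))].

(** If [a <= 0], the mass of [stays] is at most that of [leaves l], which is arbitrarily small, so
    almost surely no T_v is ever entered for good. A trapped path that settles does exactly this at
    a vertex far enough down. *)
Lemma trapped_drift : Q point trapped = 1 -> (0 < a)%R.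
Proof.
move=> t1; rewrite ltNge; apply/negP => a0.
have ms v : measurable (stays v).
  apply: measP_and => //; apply: measP_forall => // i; apply: measP_imp => //; first exact: measP_const.
have es : equivariant p w pi stays.
  move=> G g v z sG; split=> -[h1 h2]; split=> [h|i il].
  - by apply: h1; apply/(gdsc v z 0 sG).
  - by apply/(gdsc v z i sG); exact: h2.
  - by apply: h1; apply/(gdsc v z 0 sG).
  - by apply/(gdsc v z i sG); exact: h2.
have le_s l : mass point stays <= mass point (enters l).
  apply: mass_le => [//|v|v z [h1 h2]]; first exact: meas_enters.
  by split=> // i /andP[i1 _]; exact: h2.
have s0 : mass point stays = 0.
  apply/eqP; rewrite eq_le mass_ge0 andbT leNgt; apply/negP => pos.
  have sfin : mass point stays \is a fin_num.
    by rewrite ge0_fin_numE ?mass_ge0 // (le_lt_trans (le_s 0%N)) // enters_fin.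
  rewrite -(fineK sfin) lte_fin in pos.
  have [l hl] := leaves_small t1 pos.
  move: (le_s l); rewrite drift_eq leNgt => /negP; apply.
  rewrite fineK // in hl; apply: le_lt_trans hl.
  by rewrite -[leRHS]adde0 leeD2l // lee_fin.
have sfin : mass point stays < +oo by rewrite s0.
have null k v : Q point (tshift k @^-1` stays v) = 0.
  have := mshift k es ms sfin; rewrite s0 => h.
  exact: (esum_eq0P (fun v _ => measure_ge0 (Q point) _) h).
have mt k v : measurable (tshift k @^-1` stays v : set (pathX X)) by exact: measurable_tshift.
have null2 : Q point (\bigcup_k \bigcup_v (tshift k @^-1` stays v)) = 0.
  apply: prob_exists0 => // k; first by apply: countable_bigcupT_measurable.
  exact: prob_exists0.
have m2 : measurable (\bigcup_k \bigcup_v (tshift k @^-1` stays v) : set (pathX X)).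
  by apply: bigcupT_measurable => k; apply: countable_bigcupT_measurable.
have mset : measurable ([set z | forall v, settles w pi v z] : set (pathX X)).
  apply: measP_forall => // v; apply: measP_ev => // n.
  exact: (measP_coord2 Xcount n n.+1 (fun x y => same_comp w v (pi x) (pi y))).
have [z [[tz sz] nz]] : exists z, (trapped `&` [set z | forall v, settles w pi v z] `&`
    ~` \bigcup_k \bigcup_v (tshift k @^-1` stays v)) z.
  apply: (@prob1_inhabited _ (pathX X) R (Q point)).
  apply: prob1_and; [|exact: measurableC| |].
  - by apply: measurableI => //; exact: meas_trapped.
  - apply: prob1_and => //; first exact: meas_trapped.
    exact: (Q_settles Xcount p_ge0 p_sum Q_cyl irr q_ge2 Tcount pi_surj sym_trans crossing_mass).
  - by apply/prob1C; [exact: measurableC|rewrite setCK].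
have [v hv] := tz.
(* Deep enough that [u] is further down than the starting vertex, which therefore lies outside
   T_u. *)
pose k := `|busemann w (pi (z 0%N)) - busemann w v|.+1%N.
have [u [_ ulev [N hN]]] := settles_deep k sz hv.
have u0 : ~ dsc u (pi (z 0%N)) by move=> /dsc_level; rewrite ulev /k; lia.
have ex : exists n, `[< ~ dsc u (pi (z n)) >] by exists 0%N; apply/asboolP.
have bd n : `[< ~ dsc u (pi (z n)) >] -> (n <= N)%N.
  by move=> /asboolP un; rewrite leqNgt; apply/negP => Nn; apply: un; apply: hN; exact: ltnW.
(* After its last time [m] outside T_u, the path has entered T_u for good. *)
case: (ex_maxnP ex bd) => m /asboolP um mmax.
apply: nz; exists m => //; exists u => //; split; first by rewrite /tshift addn0.
move=> i i1; apply: contrapT => ui; have := mmax (m + i)%N.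
by rewrite asboolT // => /(_ isT); lia.
Qed.

Lemma to_root_invariant : shift_invariant to_root.
Proof.
move=> z; split=> h v; have [N hN] := h v.
  by exists N.+1 => -[|n] // Nn; exact: (hN n).
by exists N => n Nn; apply: (hN n.+1); exact: leqW.
Qed.

(** Seen as a family that does not depend on the vertex, [to_root] is equivariant. *)
Lemma to_root_const x y : Q x to_root = Q y to_root.
Proof.
apply: (Q_diag Q_cyl sym_trans x y (B := fun=> to_root)); last first.
  by move=> _; exact: meas_to_root.
move=> G g _ z sG; have [_ _ [g' gK g'K] _ _] := sG; split=> h v.
  have [N hN] := h (g v); exists N => n Nn vz; apply: (hN n Nn).
  exact/(gdsc v z n sG).
have [N hN] := h (g' v); exists N => n Nn vz; apply: (hN n Nn).
by apply/(gdsc (g' v) z n sG); rewrite g'K.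
Qed.

(** The zero-one law and the dichotomy make one of the two behaviours almost sure; each is
    compatible with one sign of [a] only. *)
Theorem drift_limit :
  ((a <= 0)%R -> forall x, Q x to_root = 1) /\
  ((0 < a)%R -> forall x, Q x trapped = 1).
Proof.
have mset : measurable ([set z | forall v, settles w pi v z] : set (pathX X)).
  apply: measP_forall => // v; apply: measP_ev => // n.
  exact: (measP_coord2 Xcount n n.+1 (fun x y => same_comp w v (pi x) (pi y))).
have tr x : Q x to_root = 0 -> Q x trapped = 1.
  move=> r0; apply: (@prob1_mono _ _ _ (Q x)
     ([set z | forall v, settles w pi v z] `&` ~` to_root)).
  - by apply: measurableI => //; apply: measurableC; exact: meas_to_root.
  - exact: meas_trapped.
  - by move=> z [sz nr]; exact: settles_dichotomy.
  apply: prob1_and => //.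
  - by apply: measurableC; exact: meas_to_root.
  - exact: (Q_settles Xcount p_ge0 p_sum Q_cyl irr q_ge2 Tcount pi_surj sym_trans crossing_mass).
  apply/prob1C; first by apply: measurableC; exact: meas_to_root.
  by rewrite setCK.
have z1 := zero_one Xcount p_ge0 p_sum Q_cyl (x := point) meas_to_root to_root_invariant
  (fun y => to_root_const y point).
split=> a0 x.
  rewrite (to_root_const x point); case: z1 => // /tr /trapped_drift.
  by rewrite ltNge a0.
apply: tr; rewrite (to_root_const x point); case: z1 => // /to_root_drift.
by rewrite leNgt a0.
Qed.

End Drift.

(** * The graph DL *)

Section TreeMore.
Variables (q : nat) (T : homTree q) (w : tree_end T).
Implicit Types (u v x y : T).
Local Notation par := (par w).

(** Every vertex is encoded by a finite word telling which neighbour to take at each step from the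
    origin. *)
Lemma tree_countable : countable [set: T].
Proof.
have nbE x : exists f : nat -> T, forall y, adj T x y -> exists n, f n = y.
  have fin : finite_set [set y | adj T x y].
    by apply/finite_setP; exists q.+1; exact: adj_regular.
  have /countable_injP [f finj] := finite_set_countable fin.
  exists (fun n => xget x [set y | adj T x y /\ f y = n]) => y xy.
  exists (f y); case: xgetP => [y' _ [xy' E]|/(_ y) []//].
  by apply: finj => //; rewrite inE.
have [nb nbP] := choice nbE.
pose walk := foldl nb (origin T).
have surj x : exists s, walk s = x.
  have [s ps <-] := adj_connected (origin T) x.
  elim/last_ind: s ps => [|s a IH] ps; first by exists [::].
  move: ps; rewrite rcons_path last_rcons => /andP[ps sa].
  have [s' s'E] := IH ps; have [n nE] := nbP _ _ sa.
  by exists (rcons s' n); rewrite /walk foldl_rcons -/(walk s') s'E.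
have -> : [set: T] = walk @` setT.
  by apply/seteqP; split=> x // _; have [s <-] := surj x; exists s.
exact: card_le_trans (card_image_le _ _) (countableP _).
Qed.

Lemma minimal_meet x y : exists m n, [/\ iter m par x = iter n par y,
  forall i, (i < m)%N -> ~ dsc w (iter i par x) y &
  forall i, (i < n)%N -> ~ dsc w (iter i par y) x].
Proof.
have [a [b ab]] := common_ancestor w x y.
have ex : exists m, `[< dsc w (iter m par x) y >] by exists a; apply/asboolP; exists b.
case: (ex_minnP ex) => m /asboolP [n nm] mmin.
exists m, n; split=> // [i im d|i iin [k kx]].
  by have := mmin i; rewrite asboolT // leqNgt im => /(_ isT).
have mk : (m <= k)%N by apply: mmin; apply/asboolP; exists i.
have : iter (k - m + n) par y = iter i par y by rewrite iterD nm -iterD subnK.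
by move/iter_par_inj; lia.
Qed.

Lemma esum_card (R : realType) (P : T -> Prop) (f : nat -> T) n :
  injective f -> (forall v, P v <-> exists2 i, (i < n)%N & f i = v) ->
  (\esum_(v in [set: T]) (if `[< P v >] then 1 else 0 : \bar R) = n%:R%:E)%E.
Proof.
move=> finj PE.
have -> : (\esum_(v in [set: T]) (if `[< P v >] then 1 else 0 : \bar R) =
    \esum_(v in f @` `I_n) 1)%E.
  rewrite [in RHS]esum_mkcond; apply: eq_esum => v _; congr (if _ then _ else _).
  by apply/asboolP/idP; rewrite inE PE => -[i im <-]; exists i.
rewrite esum_image; last by move=> i j _ _; exact: finj.
rewrite esum_fset //.
by rewrite -(@fsbig_ord _ _ _ n (fun=> 1%E)) sumEFin sumr_const card_ord.
Qed.

Lemma esum_le_size (R : realType) (P : T -> Prop) (s : seq T) :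
  (forall v, P v -> v \in s) ->
  (\esum_(v in [set: T]) (if `[< P v >] then 1 else 0 : \bar R) <= (size s)%:R%:E)%E.
Proof.
move=> Ps.
have s1 (t : seq T) : (\sum_(u <- t) (1 : \bar R) = (size t)%:R%:E)%E.
  by elim: t => [|a t IH]; rewrite ?big_nil // big_cons IH -EFinD -natr1 addrC.
apply: (@le_trans _ _ (\esum_(v in [set` undup s]) 1%E)).
  rewrite [leRHS]esum_mkcond; apply: le_esum => v _.
  case: asboolP => [/Ps vs|_]; last by case: ifP.
  by rewrite ifT // inE /= mem_undup.
rewrite esum_fset // -fsbig_seq ?undup_uniq // s1 lee_fin ler_nat.
exact: size_undup.
Qed.

Lemma Aff_busemann g x : in_Aff w g ->
  busemann w (g x) = busemann w x + busemann_shift w g.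
Proof.
move=> Ag; have [a [b ab]] := common_ancestor w x (origin T).
have gi n u : g (iter n par u) = iter n par (g u).
  by elim: n => //= n IH; rewrite (Aff_par _ Ag) IH.
have := congr1 (fun u => busemann w (g u)) ab.
rewrite /= !gi !busemann_iter /busemann_shift busemann_origin.
by rewrite (busemannE ab); lia.
Qed.

Hypothesis q_ge2 : (2 <= q)%N.

Lemma descend x n : exists u, iter n par u = x.
Proof.
elim: n x => [|n IH] x; first by exists x.
have [c [_ [_ cx _]]] := two_children w x q_ge2.
by have [u uc] := IH c; exists u; rewrite iterS uc.
Qed.

Lemma level_surj (k : int) : exists u, busemann w u = k.
Proof.
case: k => n.
  have [u uo] := descend (origin T) n; exists u.
  by have := busemann_iter w u n; rewrite uo busemann_origin; lia.
by exists (iter n.+1 par (origin T)); rewrite busemann_iter busemann_origin; lia.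
Qed.

End TreeMore.

Section DLGraph.
Variables (d : nat) (q : 'I_d -> nat) (T : forall j, homTree (q j)).
Variable w : forall j, tree_end (T j).
Hypothesis hd : (2 <= d)%N.
Hypothesis hq : forall j, (2 <= q j)%N.
Local Notation DL := (DL w).
Implicit Types (x y : DL).

HB.instance Definition _ := isPointed.Build DL (dl_origin w).

Lemma dl_val_inj x y : (forall j, x j = y j) -> x = y.
Proof.
case: x y => [x xs] [y ys] /= E.
have {E} E : x = y by apply: functional_extensionality_dep.
by subst y; congr MkDL; exact: eq_irrelevance.
Qed.

Lemma DL_countable : countable [set: DL].
Proof.
have inj j : exists f : T j -> nat, injective f.
  have /countable_injP [f finj] := tree_countable (T j).
  by exists f => u v; apply: finj; rewrite inE.
pose f j := sval (cid (inj j)).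
have finj j : injective (f j) by exact: (svalP (cid (inj j))).
apply/countable_injP; exists (fun x => choice.pickle [seq f j (x j) | j <- enum 'I_d]) => x y _ _.
move=> /(pcan_inj choice.pickleK) /eq_in_map E; apply: dl_val_inj => j; apply: (@finj j).
by apply: E; rewrite mem_enum.
Qed.

Lemma other_coord (i : 'I_d) : exists j : 'I_d, j != i.
Proof.
have h0 : (0 < d)%N by exact: leq_trans hd.
have [->|] := eqVneq i (Ordinal h0); last by exists (Ordinal h0); rewrite eq_sym.
by exists (Ordinal hd).
Qed.

(** Every integer is the height of some vertex, so the one free coordinate can balance the
    others. *)
Lemma DL_complete (i : 'I_d) (y : forall k, T k) :
  exists x, forall k, k != i -> x k = y k.
Proof.
pose S := \sum_(k | k != i) busemann (w k) (y k).
have [u uS] := level_surj (w i) (hq i) (- S).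
have E : \sum_k busemann (w k) (dfwith y i u k) == 0.
  rewrite (bigD1 i) //= dfwithin uS (eq_bigr (fun k => busemann (w k) (y k))).
    by rewrite addNr.
  by move=> k ki; rewrite dfwithout // eq_sym.
by exists (MkDL E) => k ki /=; rewrite dfwithout // eq_sym.
Qed.

Lemma coord_surj j (v : T j) : exists x, x j = v.
Proof.
have [i ij] := other_coord j.
have [x h] := DL_complete i (dfwith (fun k => origin (T k)) j v).
by exists x; rewrite h 1?eq_sym // dfwithin.
Qed.

Definition linked x y := exists s, path (@dl_adj d q T w) x s /\ last x s = y.

Lemma linked_refl x : linked x x. Proof. by exists [::]. Qed.

Lemma linked_trans x y z : linked x y -> linked y z -> linked x z.
Proof.
move=> [s [ps ls]] [t [pt lt]]; exists (s ++ t).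
by rewrite cat_path last_cat ps ls.
Qed.

Lemma dl_step x i j (b : T i) : i != j -> par (w i) b = x i ->
  exists y, [/\ dl_adj x y, y i = b, y j = par (w j) (x j) &
    forall k, k != i -> k != j -> y k = x k].
Proof.
move=> ij bi; pose y := dfwith (dfwith x j (par (w j) (x j))) i b.
have yi : y i = b by rewrite /y dfwithin.
have yj : y j = par (w j) (x j) by rewrite /y dfwithout // dfwithin.
have yk k : k != i -> k != j -> y k = x k.
  by move=> ki kj; rewrite /y !dfwithout // eq_sym.
have E : \sum_k busemann (w k) (y k) == 0.
  have := dl_sum x; rewrite (bigD1 i) //= (bigD1 j) /=; last by rewrite eq_sym.
  rewrite [X in _ -> X == 0](bigD1 i) //= [X in _ -> _ + X == 0](bigD1 j) /=; last by rewrite eq_sym.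
  have -> : \sum_(k | (k != i) && (k != j)) busemann (w k) (y k) =
      \sum_(k | (k != i) && (k != j)) busemann (w k) (x k).
    by apply: eq_bigr => k /andP[ki kj]; rewrite yk.
  rewrite yi yj.
  have := busemann_par (w i) b; rewrite bi busemann_par.
  by move: (\sum_(_ | _) _) => S; lia.
exists (MkDL E); split=> //; apply/asboolP; exists i, j; split=> //=.
- by rewrite yi -bi adj_sym; exact: adj_par.
- by rewrite yj; exact: adj_par.
- by move=> k ki kj; rewrite yk.
Qed.

Lemma dl_descend x i j n (u : T i) : i != j -> iter n (par (w i)) u = x i ->
  exists y, [/\ linked x y, y i = u, y j = iter n (par (w j)) (x j) &
    forall k, k != i -> k != j -> y k = x k].
Proof.
move=> ij; elim: n u => [|n IH] u /= ui; first by exists x; split=> //; exact: linked_refl.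
rewrite -iterS iterSr in ui; have [y [xy yi yj yk]] := IH _ ui.
have [z [yz zi zj zk]] := dl_step ij (esym yi).
exists z; split=> //; first by apply: linked_trans xy _; exists [:: z]; rewrite /= yz.
  by rewrite zj yj.
by move=> k ki kj; rewrite zk // yk.
Qed.

(** Coordinate [i] is the counterweight: it descends while [j] climbs to a common ancestor with its
    origin, and climbs back while [j] descends. *)
Lemma dl_to_origin x i j : i != j ->
  exists y, [/\ linked x y, y j = origin (T j) & forall k, k != i -> k != j -> y k = x k].
Proof.
move=> ij; have [a [b ab]] := common_ancestor (w j) (x j) (origin (T j)).
have [u ui] := descend (w i) (hq i) (x i) a.
have [y [xy yi yj yk]] := dl_descend ij ui.
have ji : j != i by rewrite eq_sym.
have [|z [yz zj zi zk]] := @dl_descend y j i b (origin (T j)) ji; first by rewrite yj -ab.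
exists z; split=> //; first exact: linked_trans xy yz.
by move=> k ki kj; rewrite zk // yk.
Qed.

Lemma dl_connected_to x : linked x (dl_origin w).
Proof.
have h0 : (0 < d)%N by exact: leq_trans hd.
pose i := Ordinal h0.
have [y [xy yk]] : exists y, linked x y /\ forall k, k != i -> y k = origin (T k).
  suff [y [xy yk]] : exists y, linked x y /\
      forall k, k \in enum 'I_d -> k != i -> y k = origin (T k).
    by exists y; split=> // k ki; apply: yk => //; rewrite mem_enum.
  elim: (enum 'I_d) => [|j s [y [xy yk]]]; first by exists x; split=> //; exact: linked_refl.
  have [->|ji] := eqVneq j i.
    by exists y; split=> // k; rewrite inE => /orP[/eqP->|ks] ki; [rewrite eqxx in ki|exact: yk].
  have [|z [yz zj zk]] := @dl_to_origin y i j; first by rewrite eq_sym.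
  exists z; split; first exact: linked_trans xy yz.
  move=> k; rewrite inE; have [->//|kj] := eqVneq k j => /= ks ki.
  by rewrite zk // yk.
have [j ji] := other_coord i.
(* The last coordinate has height 0 like its origin, so it goes up and down by the same number [a]
   of steps; coordinate [j] descends by [a] meanwhile and returns to its origin. *)
have yi0 : busemann (w i) (y i) = 0.
  have := dl_sum y; rewrite (bigD1 i) //= big1 ?addr0 => [/eqP//|k ki].
  by rewrite yk // busemann_origin.
have [a [b ab]] := common_ancestor (w i) (y i) (origin (T i)).
have {b} ab : iter a (par (w i)) (y i) = iter a (par (w i)) (origin (T i)).
  by rewrite ab; congr iter; move: yi0; rewrite (busemannE ab); lia.
have [u uj] := descend (w j) (hq j) (y j) a.
have [z [yz zj zi zk]] := dl_descend ji uj.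
have ij : i != j by rewrite eq_sym.
have [|t [zt ti tj tk]] := @dl_descend z i j a (origin (T i)) ij; first by rewrite zi -ab.
have -> : dl_origin w = t.
  apply: dl_val_inj => k /=; have [->//|ki] := eqVneq k i.
  have [->|kj] := eqVneq k j; first by rewrite tj zj uj yk.
  by rewrite tk // zk // yk.
exact: linked_trans xy (linked_trans yz zt).
Qed.

Lemma dl_adj_sym : symmetric (@dl_adj d q T w).
Proof.
move=> x y; apply/asboolP/asboolP => -[i [j [ij h1 h2 h3]]]; exists i, j; split=> //;
  by [rewrite adj_sym|move=> k ki kj; rewrite h3].
Qed.

Lemma dl_gdist_path x : exists s, [/\ path (@dl_adj d q T w) (dl_origin w) s,
  last (dl_origin w) s = x & size s = gdist (@dl_adj d q T w) (dl_origin w) x].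
Proof.
have [s [ps ls]] := dl_connected_to x.
have h : [set n | exists s, [/\ path (@dl_adj d q T w) (dl_origin w) s,
    last (dl_origin w) s = x & size s = n]] (size (rev (belast x s))).
  exists (rev (belast x s)); split=> //.
    by rewrite -ls rev_path_sym //; exact: dl_adj_sym.
  rewrite -ls; case: (s) ls => //= a t ls; first by rewrite rev_cons last_rcons.
by have [] := least_ex h.
Qed.

(** The projected path must pass through any vertex that separates its two ends. Hence a step of
    length [n] crosses at most [n + 1] vertices, which ties the crossing mass to the first
    moment. *)
Lemma dl_path_coord j x s v : path (@dl_adj d q T w) x s ->
  ~ same_comp (w j) v (x j) ((last x s) j) -> v \in [seq (y : DL) j | y <- x :: s].
Proof.
move=> ps; apply: contra_notT => /= nv.
suff : same_comp (w j) v (x j) (last (x j) [seq (y : DL) j | y <- s]) by rewrite last_map.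
apply: same_comp_path => //.
elim: s x ps {nv} => //= a s IH x /andP[xa pa].
rewrite IH // andbT; apply/asboolP; move: xa => /asboolP [i [k [ik h1 h2 h3]]].
have [->|ji] := eqVneq j i; first by right.
have [->|jk] := eqVneq j k; first by right.
by left; rewrite h3.
Qed.

End DLGraph.

(** * The walk on DL: path law, symmetries and drift of a coordinate *)

Section DLWalk.
Variables (R : realType) (d : nat) (hd : (2 <= d)%N).
Variables (q : 'I_d -> nat) (hq : forall j, (2 <= q j)%N).
Variables (T : forall j, homTree (q j)) (w : forall j, tree_end (T j)).
Variable p : DL w -> DL w -> R.
Hypothesis hstoch : stochastic p.
Hypothesis hirr : irreducible p.
Hypothesis hinv : Gamma_transitive p.
Hypothesis hmom : finite_first_moment p.
Variables (dO : measure_display) (Om : measurableType dO).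
Variables (Pr : DL w -> probability Om R) (Z : nat -> Om -> DL w).
Hypothesis hZ : random_walk p Pr Z.
Implicit Types (x y : DL w) (j : 'I_d).

Local Notation DL := (DL w).
Local Notation o := (dl_origin w).

Let Xc : countable [set: DL] := DL_countable w.
Let p_ge0 : forall x y, 0 <= p x y := hstoch.1.
Let p_sum : forall x, \esum_(y in [set: DL]) (p x y)%:E = 1%E := hstoch.2.

Definition Zpath (om : Om) : pathX DL := fun n => Z n om.

Lemma measurable_Zpath : measurable_fun setT Zpath.
Proof.
move=> _; apply: smallest_sub.
  split=> [|A /= mA|F /= mF].
  - by rewrite preimage_set0 setI0; exact: measurable0.
  - by rewrite setTD preimage_setC !setTI in mA *; exact: measurableC.
  - rewrite preimage_bigcup setTI; apply: bigcupT_measurable => i.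
    by have := mF i; rewrite setTI.
move=> _ [->|[->|[n [xs ->]]]] /=; rewrite setTI.
- by rewrite preimage_set0; exact: measurable0.
- by rewrite preimage_setT; exact: measurableT.
rewrite (_ : _ @^-1` _ = \bigcap_(i in `I_n.+1) (Z i @^-1` [set xs i])).
  by apply: bigcap_measurableType => i _; exact: hZ.1.
apply/seteqP; split=> om h i /=; first by rewrite ltnS; exact: h.
by rewrite -ltnS; exact: h.
Qed.

HB.instance Definition _ := isMeasurableFun.Build _ _ _ _ Zpath measurable_Zpath.

Definition path_law x : probability (pathX DL) R := distribution (Pr x) Zpath.
Local Notation Q := path_law.

Lemma Q_cyl x n xs : Q x (cyl n xs) =
  ((xs 0%N == x)%:R * \prod_(i < n) p (xs i) (xs i.+1))%:E.
Proof. exact: hZ.2. Qed.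

Lemma pstepE n x y : pstep p n x y = Q x [set z | z n = y].
Proof.
elim: n x => [|n IH] x.
  have := Q_start_cond Xc Q_cyl x (fun x => x = y) (@measurableT _ (pathX DL)).
  rewrite (_ : [set z | _] = [set z | z 0%N = y]) => [->|].
    rewrite probability_setT /=; case: asboolP => [->|xy]; first by rewrite eqxx.
    by rewrite (introF eqP xy).
  by apply/seteqP; split=> z; [case|].
have mn : measurable ([set z | z n = y] : set (pathX DL)).
  exact: (measP_coord Xc n (fun x => x = y)).
have := markov1 Xc p_ge0 p_sum Q_cyl x mn => /= ->.
by apply: eq_esum => z _; rewrite IH.
Qed.

Lemma Q_irr x y : exists n, (0 < Q x [set z | z n = y])%E.
Proof. by have [n h] := hirr x y; exists n; rewrite -pstepE. Qed.

(** [g] acts on the whole product of trees; it preserves the sum of heights, so it restricts to a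
    bijection [G] of DL. *)
Lemma Gamma_symm g : in_Gamma p g -> exists G : DL -> DL,
  (forall x, dl_val (G x) = coord_act g x) /\
  forall j, symm p (w j) (fun x : DL => x j) G (g j).
Proof.
move=> [[Ag sg] pg].
have sumg (x : forall j, T j) : \sum_j busemann (w j) (g j (x j)) = \sum_j busemann (w j) (x j).
  rewrite (eq_bigr (fun j => busemann (w j) (x j) + busemann_shift (w j) (g j))).
    by rewrite big_split /= sg addr0.
  by move=> j _; exact: Aff_busemann.
have inD x : \sum_j busemann (w j) (coord_act g x j) == 0.
  by rewrite /coord_act sumg dl_sum.
pose G x := MkDL (inD x).
have Ginj : injective G.
  move=> x y E; apply: dl_val_inj => j.
  have [bg _ _] := Ag j; apply: (bij_inj bg).
  by have := congr1 (fun z : DL => z j) E.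
have Gsurj y : exists x, G x = y.
  have gs j : exists u, g j u = y j.
    by have [[g' _ g'K] _ _] := Ag j; exists (g' (y j)).
  pose x j := sval (cid (gs j)).
  have xE j : g j (x j) = y j by exact: (svalP (cid (gs j))).
  have sx : \sum_j busemann (w j) (x j) == 0.
    by rewrite -sumg; under eq_bigr do rewrite xE; exact: dl_sum.
  by exists (MkDL sx); apply: dl_val_inj => j; exact: xE.
have bG : bijective G.
  have [G' GK'] := choice Gsurj; exists G' => // x.
  by apply: Ginj; rewrite GK'.
exists G; split=> // j; split=> //.
- by move=> x y; exact: pg.
- by have [] := Ag j.
- by move=> v; exact: Aff_par.
Qed.

Lemma DL_sym_trans j x y : exists G g, symm p (w j) (fun x : DL => x j) G g /\ G x = y.
Proof.
have [g gG gy] := hinv x y; have [G [GE Gs]] := Gamma_symm gG.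
exists G, (g j); split=> //; apply: dl_val_inj => k.
by rewrite GE -gy.
Qed.

Section OneStep.
Local Open Scope ereal_scope.

Lemma Q_one_step x (A : DL -> DL -> Prop) : Q x [set z | A (z 0%N) (z 1%N)] =
  \esum_(y in [set: DL]) ((p x y)%:E * (if `[< A x y >] then 1 else 0)).
Proof.
have mA1 : measurable ([set z | A x (z 0%N)] : set (pathX DL)) by exact: measP_coord.
have ms : measurable ([set z | z 0%N = x] : set (pathX DL)).
  exact: (measP_coord Xc 0 (fun y => y = x)).
have mA2 : measurable ([set z | A (z 0%N) (z 1%N)] : set (pathX DL)) by exact: measP_coord2.
have -> : Q x [set z | A (z 0%N) (z 1%N)] = Q x (tshift 1 @^-1` [set z | A x (z 0%N)]).
  rewrite -(Q_as mA2 ms (Q_start Q_cyl x)).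
  rewrite -[RHS](Q_as _ ms (Q_start Q_cyl x)); last exact: measurable_tshift.
  by congr (Q x _); apply/seteqP; split=> z [/= zx]; rewrite /tshift /= zx.
rewrite (markov1 Xc p_ge0 p_sum Q_cyl) //; apply: eq_esum => y _; congr (_ * _).
have := Q_start_cond Xc Q_cyl y (A x) (@measurableT _ (pathX DL)).
rewrite probability_setT => <-.
by congr (Q y _); apply/seteqP; split=> z; [split|case].
Qed.

Lemma mass_one_step j (A : T j -> T j -> T j -> Prop) x :
  mass Q x (fun v => [set z : pathX DL | A v ((z 0%N) j) ((z 1%N) j)]) =
  \esum_(y in [set: DL]) ((p x y)%:E *
    \esum_(v in [set: T j]) (if `[< A v (x j) (y j) >] then 1 else 0)).
Proof.
rewrite /mass.
under eq_esum do rewrite (Q_one_step x (fun x y : DL => A _ (x j) (y j))).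
rewrite exchange_esum; last by move=> v y; rewrite mule_ge0 ?lee_fin //; case: ifP.
by apply: eq_esum => y _; rewrite esumZl // => v _; case: ifP.
Qed.

Lemma crossing_mass j : mass Q o (crossing (w j) (fun x : DL => x j)) < +oo.
Proof.
rewrite /crossing (mass_one_step (fun v a b => ~ same_comp (w j) v a b)).
have : \esum_(y in [set: DL]) ((p o y)%:E + (p o y * (gdist (@dl_adj d q T w) o y)%:R)%:E) < +oo.
  rewrite esumD; first by rewrite p_sum lte_add_pinfty ?ltry.
    by move=> y _; rewrite lee_fin.
  by move=> y _; rewrite lee_fin mulr_ge0.
apply: le_lt_trans; apply: le_esum => y _.
have [s [ps ls sz]] := dl_gdist_path hd hq y.
rewrite -EFinD -{2}[p o y]mulr1 -mulrDr EFinM; apply: lee_wpmul2l; first by rewrite lee_fin.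
have -> : (1 + (gdist (@dl_adj d q T w) o y)%:R = (size [seq (z : DL) j | z <- o :: s])%:R :> R)%R.
  by rewrite -sz /= size_map -natr1 addrC.
apply: esum_le_size => v nv; apply: (dl_path_coord ps).
by rewrite ls.
Qed.

Definition enter_count j y :=
  \esum_(v in [set: T j]) (if `[< ~ dsc (w j) v (o j) /\ dsc (w j) v (y j) >] then 1 else 0 : \bar R).
Definition leave_count j y :=
  \esum_(v in [set: T j]) (if `[< dsc (w j) v (o j) /\ ~ dsc (w j) v (y j) >] then 1 else 0 : \bar R).

(** The subtrees entered belong to the ancestors of [y j] below its confluent with the origin, the
    subtrees left to those of the origin. Thus the expected height increment is the mass entered
    minus the mass left. *)
Lemma counts j y : exists m n : nat, [/\ enter_count j y = m%:R%:E,
  leave_count j y = n%:R%:E & busemann (w j) (y j) = (m%:Z - n%:Z)%R].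
Proof.
have [m [n [mn hm hn]]] := minimal_meet (w j) (y j) (o j).
exists m, n; split; last exact: busemannE mn.
  apply: (@esum_card _ _ R (fun v => ~ dsc (w j) v (o j) /\ dsc (w j) v (y j))
     (fun i => iter i (par (w j)) (y j))).
    by move=> a b; exact: iter_par_inj.
  move=> v; split=> [[nv [i iv]]|[i im <-]]; last by split; [exact: hm|exact: dsc_iter].
  exists i => //; rewrite ltnNge; apply/negP => mi; apply: nv.
  by exists (i - m + n)%N; rewrite iterD -mn -iterD subnK.
apply: (@esum_card _ _ R (fun v => dsc (w j) v (o j) /\ ~ dsc (w j) v (y j))
     (fun i => iter i (par (w j)) (o j))).
  by move=> a b; exact: iter_par_inj.
move=> v; split=> [[[i iv] nv]|[i im <-]]; last by split; [exact: dsc_iter|exact: hn].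
exists i => //; rewrite ltnNge; apply/negP => mi; apply: nv.
by exists (i - n + m)%N; rewrite iterD mn -iterD subnK.
Qed.

Definition pos_part j y := Num.max ((busemann (w j) (y j))%:~R : R) 0%R.
Definition neg_part j y := Num.max (- (busemann (w j) (y j))%:~R : R)%R 0%R.

Lemma alphaE j : alpha p j =
  fine (\esum_(y in [set: DL]) (p o y * pos_part j y)%:E -
        \esum_(y in [set: DL]) (p o y * neg_part j y)%:E).
Proof.
rewrite /alpha; congr (fine (_ - _)); apply: eq_esum => y _.
  by rewrite funeposE -EFin_max /pos_part maxr_pMr // mulr0.
by rewrite funenegE -EFin_max /neg_part maxr_pMr // mulr0 mulrN.
Qed.

Lemma enters0 j : mass Q o (enters (w j) (fun x : DL => x j) 0) =
  \esum_(y in [set: DL]) ((p o y)%:E * enter_count j y).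
Proof.
rewrite -(mass_one_step (fun v a b => ~ dsc (w j) v a /\ dsc (w j) v b)).
congr mass; apply/funext => v; apply/seteqP; split=> z [h1 h2]; split=> //; first exact: (h2 1%N).
by move=> [|[|i]].
Qed.

Lemma leaves0 j : mass Q o (leaves (w j) (fun x : DL => x j) 0) =
  \esum_(y in [set: DL]) ((p o y)%:E * leave_count j y).
Proof.
rewrite -(mass_one_step (fun v a b => dsc (w j) v a /\ ~ dsc (w j) v b)).
congr mass; apply/funext => v; apply/seteqP; split=> z [h1 h2]; split=> //; first exact: (h1 0%N).
by move=> [|i].
Qed.

(** The balance is written without subtraction to be summed in the extended reals; the two
    inequalities yield finiteness of the sums defining [alpha]. *)
Lemma count_parts j y :
  enter_count j y + (neg_part j y)%:E = leave_count j y + (pos_part j y)%:E /\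
  (pos_part j y)%:E <= enter_count j y /\ (neg_part j y)%:E <= leave_count j y.
Proof.
have [m [n [-> -> h]]] := counts j y.
have hR : (busemann (w j) (y j))%:~R = (m%:R - n%:R :> R)%R.
  by rewrite h intrB -!pmulrn.
have m0 : (0 <= m%:R :> R)%R by []. have n0 : (0 <= n%:R :> R)%R by [].
rewrite /pos_part /neg_part hR -!EFinD !lee_fin.
rewrite /Num.max; case: ifP => h1; case: ifP => h2; split; try (congr (_%:E)); try split; try lra.
Qed.

Lemma pos_part_ge0 j y : (0 <= pos_part j y)%R.
Proof. by rewrite le_max lexx orbT. Qed.

Lemma neg_part_ge0 j y : (0 <= neg_part j y)%R.
Proof. by rewrite le_max lexx orbT. Qed.

Let sumP j := \esum_(y in [set: DL]) (p o y * pos_part j y)%:E.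
Let sumN j := \esum_(y in [set: DL]) (p o y * neg_part j y)%:E.

Lemma enter_mass_fin j : mass Q o (enters (w j) (fun x : DL => x j) 0) < +oo.
Proof. exact: (enters_fin Xc Q_cyl (DL_sym_trans j) (crossing_mass j)). Qed.

Lemma leave_mass_fin j : mass Q o (leaves (w j) (fun x : DL => x j) 0) < +oo.
Proof. exact: (leaves_fin Xc p_ge0 p_sum Q_cyl (DL_sym_trans j) (crossing_mass j)). Qed.

Lemma sumP_fin j : sumP j \is a fin_num.
Proof.
rewrite ge0_fin_numE; last first.
  by apply: esum_ge0 => y _; rewrite lee_fin mulr_ge0 // pos_part_ge0.
apply: le_lt_trans (enter_mass_fin j); rewrite enters0; apply: le_esum => y _.
by rewrite EFinM lee_wpmul2l ?lee_fin //; have [_ []] := count_parts j y.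
Qed.

Lemma sumN_fin j : sumN j \is a fin_num.
Proof.
rewrite ge0_fin_numE; last first.
  by apply: esum_ge0 => y _; rewrite lee_fin mulr_ge0 // neg_part_ge0.
apply: le_lt_trans (leave_mass_fin j); rewrite leaves0; apply: le_esum => y _.
by rewrite EFinM lee_wpmul2l ?lee_fin //; have [_ []] := count_parts j y.
Qed.

Lemma alpha_fine j : alpha p j = (fine (sumP j) - fine (sumN j))%R.
Proof. rewrite alphaE; exact: (fineB (sumP_fin j) (sumN_fin j)). Qed.

Lemma drift_alpha j : mass Q o (enters (w j) (fun x : DL => x j) 0) =
  mass Q o (leaves (w j) (fun x : DL => x j) 0) + (alpha p j)%:E.
Proof.
have c0 i y : 0 <= enter_count i y by apply: esum_ge0 => v _; case: ifP.
have l0 i y : 0 <= leave_count i y by apply: esum_ge0 => v _; case: ifP.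
have E : mass Q o (enters (w j) (fun x : DL => x j) 0) + sumN j =
    mass Q o (leaves (w j) (fun x : DL => x j) 0) + sumP j.
  rewrite enters0 leaves0 /sumN /sumP -!esumD; first apply: eq_esum => y _.
  all: try by move=> y _; rewrite ?lee_fin ?mulr_ge0 ?mule_ge0 ?lee_fin ?pos_part_ge0 ?neg_part_ge0.
  rewrite !EFinM -!ge0_muleDr ?lee_fin ?pos_part_ge0 ?neg_part_ge0 //.
  by have [-> _] := count_parts j y.
have f1 : mass Q o (enters (w j) (fun x : DL => x j) 0) \is a fin_num.
  by rewrite ge0_fin_numE ?enter_mass_fin ?mass_ge0.
have f2 : mass Q o (leaves (w j) (fun x : DL => x j) 0) \is a fin_num.
  by rewrite ge0_fin_numE ?leave_mass_fin ?mass_ge0.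
move: E; rewrite alpha_fine -(fineK f1) -(fineK f2) -(fineK (sumP_fin j)) -(fineK (sumN_fin j)).
by rewrite -!EFinD /= => -[E]; congr (_%:E); lra.
Qed.

(** The heights of a vertex of DL add up to 0, so positive and negative parts have equal sums before
    averaging. *)
Lemma sum_alpha : (\sum_j alpha p j = 0)%R.
Proof.
have sumPN y : (\sum_j pos_part j y = \sum_j neg_part j y)%R.
  apply/eqP; rewrite -subr_eq0 -sumrB.
  rewrite (eq_bigr (fun j => (busemann (w j) (y j))%:~R)).
    by rewrite -rmorph_sum /= (eqP (dl_sum y)).
  move=> j _; rewrite /pos_part /neg_part; set h := (_ %:~R)%R.
  by rewrite /Num.max; case: ifP => h1; case: ifP => h2; lra.
have E : \sum_j sumP j = \sum_j sumN j.
  rewrite /sumP /sumN -!esum_sum.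
  - apply: eq_esum => y _; rewrite !sumEFin -!mulr_sumr; congr (_ * _)%:E; exact: sumPN.
  - by move=> y j _ _; rewrite lee_fin mulr_ge0 // neg_part_ge0.
  - by move=> y j _ _; rewrite lee_fin mulr_ge0 // pos_part_ge0.
rewrite (eq_bigr (fun j => fine (sumP j) - fine (sumN j))%R); last by move=> j _; exact: alpha_fine.
rewrite sumrB; apply/eqP; rewrite subr_eq0; apply/eqP.
have := E; rewrite (eq_bigr (fun j => (fine (sumP j))%:E)); last by move=> j _; rewrite fineK ?sumP_fin.
rewrite [in RHS](eq_bigr (fun j => (fine (sumN j))%:E)); last by move=> j _; rewrite fineK ?sumN_fin.
by rewrite !sumEFin => -[].
Qed.

Lemma walk_limit j :
  (alpha p j <= 0 -> forall x, Q x (to_root (w j) (fun x : DL => x j)) = 1%E)%R /\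
  (0 < alpha p j -> forall x, Q x (trapped (w j) (fun x : DL => x j)) = 1%E)%R.
Proof.
exact: (drift_limit Xc p_ge0 p_sum Q_cyl Q_irr (hq j) (tree_countable (T j)) (@coord_surj d q T w hd hq j)
  (DL_sym_trans j) (crossing_mass j) (drift_alpha j)).
Qed.

Lemma walk_settles j x :
  Q x [set z | forall v, settles (w j) (fun x : DL => x j) v z] = 1.
Proof.
exact: (Q_settles Xc p_ge0 p_sum Q_cyl Q_irr (hq j) (tree_countable (T j)) (@coord_surj d q T w hd hq j)
  (DL_sym_trans j) (crossing_mass j)).
Qed.

End OneStep.
End DLWalk.

(** * The end compactification *)

Section EndCompactification.
Variables (q : nat) (T : homTree q) (w : tree_end T).
Implicit Types (u v c : T) (e : tree_hat T) (xi : tree_end T).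

Lemma hat_cvg (F : set_system (tree_hat T)) e : Filter F ->
  (forall v, below w v e -> F (below w v)) ->
  (forall v, ~ below w v e -> F (~` below w v)) -> F --> e.
Proof.
move=> FF h1 h2 A; rewrite /= nbhsE => -[B [Bop Be] BA].
rewrite nbhs_filterE; apply: filterS BA _.
move: Bop Be => [D sD <-] [C DC Ce]; apply: (@filterS _ _ _ C); first by move=> z; exists C.
have /sD [s ss Es] := DC; rewrite -Es; apply: filter_bigI => E sE.
have /set_mem [x [y Exy]] := ss _ sE; have Ee : E e by move: Ce; rewrite -Es; exact.
have [ET|[v [Ev|Ev]]] := cone_cases w x y; move: Ee; rewrite Exy ?ET ?Ev.
- by move=> _; exact: filterT.
- exact: h1.
- exact: h2.
Qed.

Lemma below_open v : open (below w v).
Proof.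
exists [set below w v]; last by rewrite bigcup_set1.
by move=> _ ->; apply: finI_from1; exists (par w v), v.
Qed.

Lemma is_root_end e : e = End w <-> forall v, ~ below w v e.
Proof.
split=> [-> v|]; first exact: below_root.
case: e => [u /(_ u)|xi h]; first by move/below_vertex; have := dsc_refl w u.
apply: contrapT => ne; have [|v hv] := @below_nonroot _ _ w xi; last exact: h hv.
by move=> E; apply: ne; rewrite E.
Qed.

(** An end below [u] is also below a child of [u]. Telling vertices from ends by the sets [below]
    makes [Lambda p] measurable. *)
Lemma is_vertex u e :
  e = Vertex u <-> below w u e /\ forall c, par w c = u -> ~ below w c e.
Proof.
split=> [->|[]].
  split=> [|c cu /below_vertex]; first exact/below_vertex/dsc_refl.
  by rewrite -cu; exact: dsc_par_proper.
case: e => [v /below_vertex /dsc_cases [->//|[c cu cv]] h|xi ux h].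
  by have := h _ cu; rewrite below_vertex.
by have [c cu /(h _ cu)] := below_child ux.
Qed.

Lemma chain_level (v : nat -> T) n : (forall n, par w (v n.+1) = v n) ->
  busemann w (v n) = busemann w (v 0%N) + n%:Z.
Proof.
move=> h; elim: n => [|n IH]; first by rewrite addr0.
have := busemann_par w (v n.+1); rewrite h IH => E; lia.
Qed.

Lemma chain_iter (v : nat -> T) m n : (forall n, par w (v n.+1) = v n) ->
  iter n (par w) (v (m + n)%N) = v m.
Proof. by move=> h; elim: n => [|n IH]; rewrite ?addn0 // addnS iterSr h. Qed.

Lemma chain_passes (v : nat -> T) u : (forall n, par w (v n.+1) = v n) ->
  (forall n, dsc w u (v n) \/ dsc w (v n) u) -> exists n, dsc w u (v n).
Proof.
move=> vE h; have [n un] : exists n : nat, busemann w u < busemann w (v 0%N) + n%:Z.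
  by exists (`|busemann w u - busemann w (v 0%N)|.+1)%N; lia.
exists n; have [//|/dsc_level] := h n; rewrite chain_level // leNgt un.
by [].
Qed.

(** Along a descending chain to [xi] each test [s i] is decided at some depth: the chain enters the
    subtree of [s i], or it gets deeper than [s i] and is separated from it. The maximum of [n] such
    depths works. *)
Lemma deep_below n (s : nat -> T) xi : xi <> w -> exists v, below w v (End xi) /\
  forall e, below w v e -> forall i, (i < n)%N -> below w (s i) e <-> below w (s i) (End xi).
Proof.
move=> xiw; have [v0 xv0] := below_nonroot xiw.
have [c [c0 cE cxi]] := below_chain xv0.
have key i : exists k, forall m e, (k <= m)%N -> below w (c m) e ->
    below w (s i) e <-> below w (s i) (End xi).
  have [sxi|sxi] := pselect (below w (s i) (End xi)).
    have [|k sk] := @chain_passes c (s i) cE.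
      by move=> m; apply: below_meet sxi (cxi m).
    exists k => m e km cme; split=> // _; apply: below_desc cme.
    apply: (dsc_trans sk); by exists (m - k)%N; rewrite -[in c m](subnKC km) chain_iter.
  have [k sk] : exists k : nat, busemann w (s i) < busemann w (c 0%N) + k%:Z.
    by exists (`|busemann w (s i) - busemann w (c 0%N)|.+1)%N; lia.
  exists k => m e km cme; split=> // sie; exfalso.
  have [/dsc_level|sc] := below_meet cme sie.
    by rewrite chain_level // leNgt (lt_le_trans sk) // lerD2l lez_nat.
  by apply: sxi; apply: below_desc (cxi m).
have [f hf] := choice key.
exists (c (\max_(i < n) f i)); split; first exact: cxi.
move=> e ce i il; apply: hf ce.
exact: (@leq_bigmax _ (fun i : 'I_n => f i) (Ordinal il)).
Qed.
End EndCompactification.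

Section ProductBoundary.
Variables (d : nat) (q : 'I_d -> nat) (T : forall j, homTree (q j)).
Variable w : forall j, tree_end (T j).
Implicit Types (e : prod_hat T) (U : set (prod_hat T)).

Lemma prod_hat_cvg (F : set_system (prod_hat T)) e : Filter F ->
  (forall j v, below (w j) v (e j) -> F [set e' | below (w j) v (e' j)]) ->
  (forall j v, ~ below (w j) v (e j) -> F [set e' | ~ below (w j) v (e' j)]) ->
  F --> e.
Proof.
move=> FF h1 h2; apply/cvg_sup => j.
have hj : (fun e : prod_hat T => e j) @ F --> e j.
  by apply: (@hat_cvg _ _ (w j)) => v; [exact: h1|exact: h2].
move=> A; rewrite (@nbhsE (initial_topology (fun e : prod_hat T => e j))).
move=> -[_ [[B Bop <-] Be] BA].
rewrite nbhs_filterE; apply: filterS BA _.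
by apply: hj; apply: open_nbhs_nbhs.
Qed.

Variable en : forall j, nat -> T j.
Hypothesis en_surj : forall j v, exists n, en j n = v.

(** The points agreeing with [e] on the first [n] tests in every coordinate form a filter base that
    converges to [e] by [prod_hat_cvg], so one of these sets lies in [U]. *)
Lemma open_hat_below U e : open U -> U e -> exists n, forall e',
  (forall j i, (i < n)%N -> below (w j) (en j i) (e' j) <-> below (w j) (en j i) (e j)) ->
  U e'.
Proof.
move=> Uop Ue.
pose N n := [set e' : prod_hat T | forall j i, (i < n)%N ->
  below (w j) (en j i) (e' j) <-> below (w j) (en j i) (e j)].
have FF : Filter (filter_from setT N).
  apply: filter_from_filter; first by exists 0%N.
  move=> m n _ _; exists (maxn m n) => // e' he'.
  by split=> j i il; apply: he'; rewrite (leq_trans il) // ?leq_maxl // leq_maxr.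
have : filter_from setT N --> e.
  apply: prod_hat_cvg => j v ev; have [n nv] := en_surj v.
    by exists n.+1 => // e' /(_ j n (ltnSn n)) /=; rewrite nv => ->.
  by exists n.+1 => // e' /(_ j n (ltnSn n)) /=; rewrite nv => ->.
move=> /(_ U) []; first exact: open_nbhs_nbhs.
by move=> n _ h; exists n => e' he'; exact: h.
Qed.

(** An open set is a countable union of sets given by a finite pattern of answers [g] to the first
    [n] tests. *)
Lemma measurable_hat dO (Om : measurableType dO) (f : Om -> borel_hat T) :
  (forall j v, measurable [set om | below (w j) v (f om j)]) -> measurable_fun setT f.
Proof.
move=> mf _; apply: smallest_sub.
  split=> [|A /= mA|F /= mF].
  - by rewrite preimage_set0 setI0; exact: measurable0.
  - by rewrite setTD preimage_setC !setTI in mA *; exact: measurableC.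
  - rewrite preimage_bigcup setTI; apply: bigcupT_measurable => i.
    by have := mF i; rewrite setTI.
move=> U Uop; rewrite /= setTI.
pose same n (g : {ffun 'I_d * 'I_n -> bool}) (e : prod_hat T) :=
  forall j (i : 'I_n), below (w j) (en j i) (e j) <-> g (j, i).
rewrite (_ : f @^-1` U = [set om | exists n, exists g : {ffun 'I_d * 'I_n -> bool},
    (forall e, same n g e -> U e) /\ same n g (f om)]).
  apply: measP_exists => // n; apply: measP_exists; first exact: finite_set_countable.
  move=> g; apply: measP_and; first exact: measP_const.
  apply: measP_forall => [|j]; first exact: finite_set_countable.
  apply: measP_forall => [|i]; first exact: finite_set_countable.
  by apply: measP_iff => //; exact: measP_const.
apply/seteqP; split=> om /=; last by move=> [n [g [h /h]]].
move=> Uf; have [n hn] := open_hat_below Uop Uf; exists n.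
exists [ffun x : 'I_d * 'I_n => `[< below (w x.1) (en x.1 x.2) (f om x.1) >]].
split=> [e he|j i]; last by rewrite ffunE /=; split=> [/asboolP|/asboolP].
apply: hn => j i il; have := he j (Ordinal il); rewrite ffunE /= => ->.
by split=> /asboolP.
Qed.

Lemma measurable_below j v : measurable ([set e | below (w j) v (e j)] : set (borel_hat T)).
Proof.
apply: sub_sigma_algebra.
rewrite (_ : mkset _ = (fun e : prod_hat T => e j) @^-1` below (w j) v) //.
apply: open_comp; last exact: below_open.
by move=> e _; exact: proj_continuous.
Qed.
End ProductBoundary.

(** * The limit law *)

Section BoundaryLaw.
Variables (R : realType) (d : nat) (hd : (2 <= d)%N).
Variables (q : 'I_d -> nat) (hq : forall j, (2 <= q j)%N).
Variables (T : forall j, homTree (q j)) (w : forall j, tree_end (T j)).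
Variable p : DL w -> DL w -> R.
Hypothesis p_ge0 : forall x y, 0 <= p x y.
Hypothesis p_sum : forall x, \esum_(y in [set: DL w]) (p x y)%:E = 1%E.
Hypothesis hinv : Gamma_transitive p.
Variable Q : DL w -> probability (pathX (DL w)) R.
Hypothesis Q_cyl : forall (x : DL w) n (xs : nat -> DL w), Q x (cyl n xs) =
  ((xs 0%N == x)%:R * \prod_(i < n) p (xs i) (xs i.+1))%:E.
Hypothesis Q_irr : forall x y, exists n, (0 < Q x [set z | z n = y])%E.
Hypothesis sum_alpha0 : \sum_j alpha p j = 0.
Implicit Types (x y : DL w) (j : 'I_d) (e : prod_hat T) (z : pathX (DL w)).

Local Notation DL := (DL w).
Local Notation o := (dl_origin w).
Local Notation coord j := (fun x : DL => x j).

Hypothesis to_root1 : forall j x, alpha p j <= 0 ->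
  Q x (to_root (w j) (coord j)) = 1%E.
Hypothesis trapped1 : forall j x, 0 < alpha p j ->
  Q x (trapped (w j) (coord j)) = 1%E.
Hypothesis settles1 : forall j x,
  Q x [set z | forall v, settles (w j) (coord j) v z] = 1%E.

Let Xc : countable [set: DL] := DL_countable w.
Let Ic : countable [set: 'I_d].
Proof. exact: finite_set_countable. Qed.
Let Tc j : countable [set: T j] := tree_countable (T j).

Lemma Lambda_root j (e : tree_hat (T j)) : alpha p j <= 0 ->
  Lambda_ p j e <-> e = End (w j).
Proof. by rewrite /Lambda_ => ->. Qed.

Lemma Lambda_end j (e : tree_hat (T j)) : 0 < alpha p j ->
  Lambda_ p j e <-> exists2 xi, xi <> w j & End xi = e.
Proof. by rewrite /Lambda_ leNgt => ->. Qed.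

Lemma alpha_pos_or_le j : 0 < alpha p j \/ alpha p j <= 0.
Proof. by case: ltP => h; [left|right]. Qed.

Lemma alpha_nonpos : exists j, alpha p j <= 0.
Proof.
apply: contrapT => h; suff : 0 < \sum_j alpha p j by rewrite sum_alpha0 ltxx.
have pos j : 0 < alpha p j by have [//|aj] := alpha_pos_or_le j; case: h; exists j.
rewrite (bigD1 (Ordinal (ltnW hd))) //= ltr_wpDr //.
by apply: sumr_ge0 => j _; exact: ltW.
Qed.

Lemma alpha_pos_or_zero : (exists j, 0 < alpha p j) \/ forall j, alpha p j = 0.
Proof.
have [|none] := pselect (exists j, 0 < alpha p j); [by left|right=> j].
have np i : alpha p i <= 0.
  by have [h|//] := alpha_pos_or_le i; case: none; exists i.
have := sum_alpha0; move/eqP; rewrite -oppr_eq0 -sumrN psumr_eq0.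
  by move/allP => /(_ j); rewrite mem_index_enum => /(_ isT) /=; rewrite oppr_eq0 => /eqP.
by move=> i _; rewrite oppr_ge0.
Qed.

Lemma Lambda_unique e e' : Lambda p e -> Lambda p e' ->
  (forall j v, below (w j) v (e j) <-> below (w j) v (e' j)) -> e = e'.
Proof.
move=> Le Le' h; apply/functional_extensionality_dep => j.
have := Le j; have := Le' j; have [aj|aj] := alpha_pos_or_le j; last first.
  by move=> /(Lambda_root _ aj) -> /(Lambda_root _ aj) ->.
move=> /(Lambda_end _ aj) [xi' _ E'] /(Lambda_end _ aj) [xi _ E].
rewrite -E -E'; congr End; apply: (@ends_separated _ _ (w j)) => v.
by rewrite E E'.
Qed.

Definition ends_in j (v : T j) z := exists N, forall n, (N <= n)%N -> dsc (w j) v (z n j).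

Definition coord_regular j z :=
  (alpha p j <= 0 -> to_root (w j) (coord j) z) /\
  (0 < alpha p j -> trapped (w j) (coord j) z /\ forall v, settles (w j) (coord j) v z).

Definition regular z := forall j, coord_regular j z.

Lemma meas_ends_in j (v : T j) : measurable (ends_in v).
Proof. by apply: measP_ev => n; exact: (measP_coord Xc n (fun x => dsc (w j) v (x j))). Qed.

Lemma meas_settles j : measurable [set z : pathX DL | forall v, settles (w j) (coord j) v z].
Proof.
apply: measP_forall => // v; apply: measP_ev => n.
exact: (measP_coord2 Xc n n.+1 (fun x y => same_comp (w j) v (x j) (y j))).
Qed.

Lemma meas_coord_regular j : measurable (coord_regular j).
Proof.
apply: measP_and; apply: measP_imp; try exact: measP_const.
  exact: (meas_to_root Xc (w j) (coord j) (Tc j)).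
by apply: measP_and; [exact: (meas_trapped Xc (w j) (coord j) (Tc j))|exact: meas_settles].
Qed.

Lemma meas_regular : measurable regular.
Proof. by apply: measP_forall => // j; exact: meas_coord_regular. Qed.

Lemma regular1 x : Q x regular = 1%E.
Proof.
apply: (prob1_forall Ic meas_coord_regular) => j.
have [aj|aj] := alpha_pos_or_le j.
  apply: prob1_mono (prob1_and _ _ (trapped1 x aj) (settles1 j x)).
  - by apply: measurableI; [exact: (meas_trapped Xc (w j) (coord j) (Tc j))|exact: meas_settles].
  - exact: meas_coord_regular.
  - by move=> z [h1 h2]; split=> //; rewrite leNgt aj.
  - exact: (meas_trapped Xc (w j) (coord j) (Tc j)).
  - exact: meas_settles.
apply: prob1_mono (to_root1 x aj); first exact: (meas_to_root Xc (w j) (coord j) (Tc j)).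
  exact: meas_coord_regular.
by move=> z h; split=> //; rewrite ltNge aj.
Qed.

Lemma ev_tshift (P : nat -> Prop) :
  (exists N, forall n, (N <= n)%N -> P n.+1) <-> exists N, forall n, (N <= n)%N -> P n.
Proof.
split=> -[N h]; last by exists N => n Nn; apply: h; exact: leqW.
by exists N.+1 => -[|n] // Nn; exact: h.
Qed.

Lemma ends_in_tshift j (v : T j) z : ends_in v (tshift 1 z) <-> ends_in v z.
Proof. exact: (ev_tshift (fun n => dsc (w j) v (z n j))). Qed.

Lemma regular_invariant : shift_invariant regular.
Proof.
move=> z; suff E j : coord_regular j (tshift 1 z) = coord_regular j z.
  by split=> h j; [rewrite -E|rewrite E].
rewrite /coord_regular.
have -> : (forall v, settles (w j) (coord j) v (tshift 1 z)) =
    (forall v, settles (w j) (coord j) v z).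
  by apply/propext; split=> h v; apply/(ev_tshift (fun n => same_comp (w j) v (z n j) (z n.+1 j))); exact: h.
have -> : to_root (w j) (coord j) (tshift 1 z) = to_root (w j) (coord j) z.
  by apply/propext; exact: to_root_invariant.
suff -> : trapped (w j) (coord j) (tshift 1 z) = trapped (w j) (coord j) z by [].
apply/propext; split=> -[v hv]; exists v; exact/ends_in_tshift.
Qed.

Lemma ends_in_meet j (u v : T j) z : ends_in u z -> ends_in v z ->
  dsc (w j) u v \/ dsc (w j) v u.
Proof.
move=> [M hM] [N hN]; apply: (@dsc_comparable _ _ _ _ _ (z (maxn M N) j)).
  by apply: hM; exact: leq_maxl.
by apply: hN; exact: leq_maxr.
Qed.

Lemma ends_in_desc j (u v : T j) z : dsc (w j) u v -> ends_in v z -> ends_in u z.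
Proof. by move=> uv [N h]; exists N => n /h; exact: dsc_trans. Qed.

Lemma regular_limit z : regular z ->
  exists e, Lambda p e /\ forall j v, below (w j) v (e j) <-> ends_in v z.
Proof.
move=> rz.
suff h j : exists ej : tree_hat (T j), Lambda_ p j ej /\
    forall v, below (w j) v ej <-> ends_in v z.
  exists (fun j => sval (cid (h j))).
  by split=> j; have [] := svalP (cid (h j)).
have [aj|aj] := alpha_pos_or_le j; last first.
  exists (End (w j)); split=> [|v]; first exact/Lambda_root.
  split=> [/below_root//|[N hN]]; exfalso.
  have [M hM] := (rz j).1 aj v.
  by apply: (hM _ (leq_maxl M N)); apply: hN; exact: leq_maxr.
have [[v0 hv0] sz] := (rz j).2 aj.
(* Settling lets the eventual position be refined from a vertex to one of its children; iterating
   gives a chain that defines the limit end. *)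
have : forall v : {v : T j | ends_in v z}, exists c : {v : T j | ends_in v z},
    par (w j) (sval c) = sval v.
  by move=> [v hv]; have [c cv hc] := settles_child sz hv; exists (exist _ c hc).
move=> /choice [f fE].
pose c n := sval (iter n f (exist _ v0 hv0)).
have cE n : par (w j) (c n.+1) = c n by exact: fE.
have cin n : ends_in (c n) z by exact: (svalP (iter n f _)).
have [xi hxi] := chain_end cE; exists (End xi); split.
  apply/Lambda_end => //; exists xi => // E.
  by have := hxi 0%N; rewrite E; exact: below_root.
move=> v; split=> hv.
  have [n vn] := chain_passes (u := v) cE (fun n => below_meet hv (hxi n)).
  exact: ends_in_desc vn (cin n).
have [n vn] := chain_passes (u := v) cE (fun n => ends_in_meet hv (cin n)).
exact: below_desc vn (hxi n).
Qed.

Lemma regular_leaves z j (v : T j) : regular z -> ~ ends_in v z ->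
  exists N, forall n, (N <= n)%N -> ~ dsc (w j) v (z n j).
Proof.
move=> rz nv; have [aj|aj] := alpha_pos_or_le j; last exact: (rz j).1 aj v.
have [_ /(_ v) [N hN]] := (rz j).2 aj.
have step n : (N <= n)%N -> dsc (w j) v (z n j) <-> dsc (w j) v (z n.+1 j).
  move=> Nn; have [[c [cv cx cy]]|[nx ny]] := hN n Nn; last by [].
  by split=> _; rewrite -cv; apply: dsc_parl.
exists N => n Nn vn; apply: nv; exists n => m /subnKC <-.
elim: (m - n)%N => [|k IH]; first by rewrite addn0.
by rewrite addnS -step // (leq_trans Nn) // leq_addr.
Qed.

Lemma exists_regular : exists z, regular z.
Proof. by have := prob1_inhabited (regular1 o). Qed.

(* On irregular paths the limit is taken to be that of a fixed regular path, so that it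
   always lies in [Lambda p]. *)
Definition regularize z := if `[< regular z >] then z else sval (cid exists_regular).

Lemma regularize_regular z : regular (regularize z).
Proof. by rewrite /regularize; case: asboolP => // _; exact: (svalP (cid _)). Qed.

Lemma regularizeE z : regular z -> regularize z = z.
Proof. by rewrite /regularize; case: asboolP. Qed.

Definition path_limit z : borel_hat T :=
  sval (cid (regular_limit (regularize_regular z))).

Lemma path_limit_Lambda z : Lambda p (path_limit z : prod_hat T).
Proof. by have [] := svalP (cid (regular_limit (regularize_regular z))). Qed.

Lemma path_limit_below z j (v : T j) :
  below (w j) v (path_limit z j) <-> ends_in v (regularize z).
Proof. by rewrite /path_limit; have [_ h] := svalP (cid (regular_limit (regularize_regular z))). Qed.

Lemma path_limit_tshift z : path_limit (tshift 1 z) = path_limit z.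
Proof.
apply: Lambda_unique; try exact: path_limit_Lambda.
move=> j v; rewrite !path_limit_below /regularize.
have -> : `[< regular (tshift 1 z) >] = `[< regular z >].
  by apply: asbool_equiv_eq; exact: regular_invariant.
by case: asboolP => // _; exact: ends_in_tshift.
Qed.

Lemma path_limit_invariant (B : set (borel_hat T)) : shift_invariant (path_limit @^-1` B).
Proof. by move=> z; rewrite /preimage /= path_limit_tshift. Qed.

Lemma tree_enum : exists en : forall j, nat -> T j, forall j v, exists n, en j n = v.
Proof.
have h j : exists en : nat -> T j, forall v, exists n, en n = v.
  have [en he] := countable_enum (Tc j).
  exists (fun n => odflt (origin (T j)) (en n)) => v.
  by have [n En] := he v; exists n; rewrite En.
by exists (fun j => sval (cid (h j))) => j; exact: (svalP (cid (h j))).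
Qed.

Lemma measurable_path_limit : measurable_fun setT path_limit.
Proof.
have [en he] := tree_enum; apply: (measurable_hat (w := w) he) => j v.
rewrite (_ : mkset _ = [set z : pathX DL | (regular z /\ ends_in v z) \/
    (~ regular z /\ ends_in v (sval (cid exists_regular)))]).
  apply: measP_or; apply: measP_and.
  - exact: meas_regular.
  - exact: meas_ends_in.
  - by apply: measP_not; exact: meas_regular.
  - exact: measP_const.
apply/seteqP; split=> z /=; rewrite path_limit_below /regularize; case: asboolP => rz.
- by left.
- by right.
- by case=> -[].
- by case=> -[].
Qed.

Lemma path_limit_cvg z : regular z ->
  (fun n => dl_embed (z n)) @ \oo --> (path_limit z : prod_hat T).
Proof.
move=> rz; apply: (@prod_hat_cvg _ _ _ w) => j v.
  rewrite path_limit_below regularizeE // => -[N hN].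
  by exists N => // n /= Nn; apply/below_vertex; exact: hN.
rewrite path_limit_below regularizeE // => /(regular_leaves rz) [N hN].
by exists N => // n /= Nn /below_vertex; exact: hN.
Qed.
Definition ends_below_all (v : forall j, T j) z := forall j, 0 < alpha p j -> ends_in (v j) z.

Lemma meas_ends_below_all v : measurable (ends_below_all v).
Proof.
by apply: measP_forall => // j; apply: measP_imp; [exact: measP_const|exact: meas_ends_in].
Qed.

Lemma ends_below_all_invariant v : shift_invariant (ends_below_all v).
Proof.
by move=> z; split=> h j aj; have := h j aj; [move/ends_in_tshift|move=> ?; apply/ends_in_tshift].
Qed.

Lemma ends_in_symm j G g (v : T j) z : symm p (w j) (coord j) G g ->
  ends_in (g v) (G \o z) <-> ends_in v z.
Proof.
move=> sG; have [_ _ _ piG _] := sG.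
have E n : dsc (w j) (g v) (G (z n) j) <-> dsc (w j) v (z n j).
  by rewrite piG; exact: symm_dsc sG.
by split=> -[N h]; exists N => n /h /E.
Qed.

Local Open Scope ereal_scope.

(** Each trapped coordinate ends up below an ancestor of its origin, and finitely many coordinates
    allow a common [k]; so regular paths are covered by countably many such events. *)
Lemma ends_below_origin : exists k,
  0 < Q o (ends_below_all (fun j => iter k (par (w j)) (origin (T j)))).
Proof.
apply: contrapT => none.
have E0 k : Q o (ends_below_all (fun j => iter k (par (w j)) (origin (T j)))) = 0.
  apply/eqP; rewrite eq_le measure_ge0 andbT leNgt; apply/negP => h.
  by apply: none; exists k.
have mE k := meas_ends_below_all (fun j => iter k (par (w j)) (origin (T j))).
suff : Q o regular = 0 by rewrite regular1 => /eqP; rewrite onee_eq0.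
apply: prob0_mono (prob_exists0 _ mE E0).
- exact: meas_regular.
- exact: bigcupT_measurable.
- move=> z rz; have h j : exists k, (0 < alpha p j)%R ->
      ends_in (iter k (par (w j)) (origin (T j))) z.
    have [aj|aj] := alpha_pos_or_le j; last by exists 0%N; rewrite ltNge aj.
    have [[v hv] _] := (rz j).2 aj; have [a [b ab]] := common_ancestor (w j) v (origin (T j)).
    by exists b => _; rewrite -ab; exact: ends_in_desc (dsc_iter _ _ _) hv.
  have [f hf] := choice h; exists (\max_j f j)%N => // j aj.
  apply: ends_in_desc (hf j aj); exists (\max_j f j - f j)%N.
  by rewrite -iterD subnK // leq_bigmax.
- exact: countableP.
Qed.

Lemma ends_below_pos v x : 0 < Q x (ends_below_all v).
Proof.
have [k hk] := ends_below_origin; have [i ai] := alpha_nonpos.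
(* A symmetry taking the origin to a point [k] levels below [v j] takes the [k]-th ancestor of the
   origin to [v j]. *)
have hu j : exists u, iter k (par (w j)) u = v j by exact: descend.
pose u j := sval (cid (hu j)).
have uE j : iter k (par (w j)) (u j) = v j by exact: (svalP (cid (hu j))).
have [y yu] := DL_complete w hq i u.
have [g gG gy] := hinv o y; have [G [GE Gs]] := Gamma_symm gG.
have Go : G o = y by apply: dl_val_inj => j; rewrite GE -gy.
have y0 : 0 < Q y (ends_below_all v).
  rewrite -Go (Q_map Q_cyl); last exact: meas_ends_below_all.
    rewrite (_ : mkset _ = ends_below_all (fun j => iter k (par (w j)) (origin (T j)))) //.
    have vE j : (0 < alpha p j)%R -> v j = g j (iter k (par (w j)) (origin (T j))).
      move=> aj; have ji : j != i by apply: contraTneq aj => ->; rewrite -leNgt.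
      have [_ _ _ piG gpar] := Gs j.
      rewrite -uE -(yu _ ji) -Go piG; elim: k {hk hu u uE yu} => //= n ->.
      by rewrite gpar.
    apply/seteqP; split=> z h j aj.
      by apply/(ends_in_symm _ _ (Gs j)); rewrite -vE //; exact: h.
    by rewrite vE //; apply/(ends_in_symm _ _ (Gs j)); exact: h.
  by have [] := Gs i.
  by have [] := Gs i.
rewrite lt_neqAle measure_ge0 andbT; apply/eqP => E.
have := null_all Xc p_ge0 p_sum Q_cyl Q_irr y (meas_ends_below_all v)
  (@ends_below_all_invariant v) (esym E).
by move=> E'; rewrite E' ltxx in y0.
Qed.

(** A possible limit in one coordinate, coded by the set of vertices above it. The event makes sense
    for all paths, is shift invariant, and symmetries act on [B] by composition. *)
Definition end_data j (B : T j -> Prop) : set (pathX DL) := [set z | forall v, ends_in v z <-> B v].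

Lemma meas_end_data j (B : T j -> Prop) : measurable (end_data B).
Proof.
apply: measP_forall => // v; apply: measP_iff; first exact: meas_ends_in.
exact: measP_const.
Qed.

Lemma end_data_invariant j (B : T j -> Prop) : shift_invariant (end_data B).
Proof. by move=> z; split=> h v; have := h v; rewrite ends_in_tshift. Qed.

Lemma end_data_inj j (B B' : T j -> Prop) z : end_data B z -> end_data B' z -> B = B'.
Proof.
by move=> h h'; apply/funext => v; apply/propext; rewrite -(h v) -(h' v).
Qed.

(** Without a maximum there would be infinitely many disjoint events of strictly increasing
    probability, all at least that of [B0], with total above 1. *)
Lemma end_data_max j x (B0 : T j -> Prop) : 0 < Q x (end_data B0) ->
  exists B : T j -> Prop, forall B' : T j -> Prop, Q x (end_data B') <= Q x (end_data B).
Proof.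
move=> pos; apply: contrapT => nomax.
have next (B : T j -> Prop) : exists B' : T j -> Prop, Q x (end_data B) < Q x (end_data B').
  apply: contrapT => h; apply: nomax; exists B => B'; rewrite leNgt; apply/negP => lt.
  by apply: h; exists B'.
have [f hf] := choice next.
pose F n := iter n f B0.
have incr m n : (m < n)%N -> Q x (end_data (F m)) < Q x (end_data (F n)).
  elim: n => // n IH; rewrite ltnS leq_eqVlt => /orP[/eqP->|/IH h]; first exact: hf.
  exact: lt_trans h (hf _).
have ge n : Q x (end_data B0) <= Q x (end_data (F n)).
  by case: n => [//|n]; apply: ltW; exact: (incr 0%N).
have m0 : Q x (end_data B0) \is a fin_num by apply: Q_fin; exact: meas_end_data.
have le n : (n%:R * fine (Q x (end_data B0)) <= 1)%R.
  have := @prob_disjoint_le _ _ _ (Q x) n (fun k => end_data (F k)) setT measurableT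
    (fun k => meas_end_data (F k)).
  rewrite probability_setT => le1.
  have : \sum_(k < n) Q x (end_data (F k)) <= 1.
    apply: le1 => // k l z kl _ zk zl.
    by have := incr _ _ kl; rewrite (end_data_inj zk zl) ltxx.
  rewrite -lee_fin; apply: le_trans.
  rewrite (_ : (_ * _)%:E = \sum_(k < n) Q x (end_data B0)).
    by apply: lee_sum => k _; exact: ge.
  by rewrite -[in RHS](fineK m0) sumEFin sumr_const card_ord mulr_natl.
have e0 : (0 < fine (Q x (end_data B0)))%R by rewrite -lte_fin fineK.
have i0 : (0 <= (fine (Q x (end_data B0)))^-1)%R by rewrite invr_ge0 ltW.
have := archi_boundP i0; move: (Num.bound _) => n.
by rewrite -(ltr_pM2r e0) mulVf ?gt_eqF // ltNge le.
Qed.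

Lemma no_end_atom j (B : T j -> Prop) x : (0 < alpha p j)%R -> Q x (end_data B) = 0.
Proof.
move=> aj; apply: contrapT => /eqP; rewrite neq_lt ltNge measure_ge0 /= => pos.
have [B1 max1] := end_data_max pos.
have map G g y (B' : T j -> Prop) : symm p (w j) (coord j) G g ->
    Q (G y) (end_data B') = Q y (end_data (B' \o g)).
  move=> sG; have [bG pG [g' gK g'K] _ _] := sG.
  rewrite (Q_map Q_cyl) //; last exact: meas_end_data.
  congr (Q y _); apply/seteqP; split=> z h v /=.
    by rewrite -(h (g v)) (ends_in_symm _ _ sG).
  by rewrite -[v]g'K (ends_in_symm _ _ sG); exact: h.
(* A symmetry turns an atom seen from [y] into another atom seen from [x], which the maximum over
   all [B] at [x] already covers. *)
have maxall y : Q y (end_data B1) <= Q x (end_data B1).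
  have [g gG gy] := hinv x y; have [G [GE Gs]] := Gamma_symm gG.
  have <- : G x = y by apply: dl_val_inj => k; rewrite GE -gy.
  by rewrite (map _ _ _ _ (Gs j)).
have const y : Q y (end_data B1) = Q x (end_data B1).
  exact: (max_all Xc p_ge0 p_sum Q_cyl Q_irr _ (meas_end_data B1) (@end_data_invariant j B1)).
have [E|E1] := zero_one Xc p_ge0 p_sum Q_cyl (meas_end_data B1) (@end_data_invariant j B1) const.
  by have := max1 B; rewrite E leNgt pos.
(* Every T_v is charged, so an almost sure limit would lie below every vertex, in particular below
   two siblings. *)
have inB v : B1 v.
  apply: contrapT => nB.
  have := ends_below_pos (dfwith (fun k => origin (T k)) j v) x.
  rewrite -(Q_as _ (meas_end_data B1) E1); last exact: meas_ends_below_all.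
  rewrite (_ : _ `&` _ = set0) ?measure0 ?ltxx //; apply/seteqP; split=> // z [h1 h2].
  by apply: nB; apply/h1; have := h2 j aj; rewrite dfwithin.
have [c [c' [cc' c0 c'0]]] := two_children (w j) (origin (T j)) (hq j).
have [z zB] := prob1_inhabited E1.
have [N1 h1] := (zB c).2 (inB c); have [N2 h2] := (zB c').2 (inB c').
apply: cc'; apply: (@dsc_child_unique _ _ (w j) _ _ (z (maxn N1 N2) j)).
- by rewrite c0 c'0.
- by apply: h1; exact: leq_maxl.
- by apply: h2; exact: leq_maxr.
Qed.
Local Close Scope ereal_scope.

Lemma measurable_Lambda : measurable (Lambda p : set (borel_hat T)).
Proof.
have mb j (v : T j) : measurable [set e : borel_hat T | below (w j) v (e j)].
  exact: measurable_below.
apply: (@measP_forall _ (borel_hat T) _ (fun j e => Lambda_ p j (e j))) => // j.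
have [aj|aj] := alpha_pos_or_le j; last first.
  rewrite (_ : mkset _ = [set e : borel_hat T | forall v, ~ below (w j) v (e j)]).
    by apply: measP_forall => // v; exact: measP_not.
  by apply/seteqP; split=> e /=; rewrite Lambda_root // is_root_end.
rewrite (_ : mkset _ = [set e : borel_hat T | (exists v, below (w j) v (e j)) /\
    forall u, ~ (below (w j) u (e j) /\ forall c, par (w j) c = u -> ~ below (w j) c (e j))]).
  apply: measP_and; first exact: measP_exists.
  apply: measP_forall => // u; apply: measP_not; apply: measP_and => //.
  apply: measP_forall => // c; apply: measP_imp; first exact: measP_const.
  exact: measP_not.
apply/seteqP; split=> e /=; rewrite Lambda_end //.
  move=> [xi xiw E]; rewrite -E; split; first exact: below_nonroot.
  by move=> u /is_vertex.
case=> -[v ev] nu; case E: (e j) ev nu => [u|xi] ev nu.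
  by have := nu u; rewrite -is_vertex.
by exists xi => // xiw; rewrite xiw in ev; exact: below_root ev.
Qed.

(** Ending below a deep enough vertex in each coordinate of positive drift decides the finitely many
    tests that guarantee [U]; the other coordinates of the limit are deterministic. *)
Lemma limit_support x e (U : set (prod_hat T)) : Lambda p e -> open U -> U e ->
  (0 < Q x (path_limit @^-1` U))%E.
Proof.
move=> Le Uop Ue; have [en he] := tree_enum.
have [n hn] := open_hat_below w he Uop Ue.
have hv j : exists v : T j, 0 < alpha p j -> below (w j) v (e j) /\
    forall e' : tree_hat (T j), below (w j) v e' -> forall i, (i < n)%N ->
      below (w j) (en j i) e' <-> below (w j) (en j i) (e j).
  have [aj|aj] := alpha_pos_or_le j; last by exists (origin (T j)); rewrite ltNge aj.
  have [xi xiw E] := (Lambda_end _ aj).1 (Le j).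
  by have [v hv] := deep_below n (en j) xiw; exists v; rewrite -E.
pose v j := sval (cid (hv j)); have vE j := svalP (cid (hv j)).
have mU : measurable (path_limit @^-1` U).
  by rewrite -[_ @^-1` _]setTI; apply: measurable_path_limit => //; exact: sub_sigma_algebra.
apply: lt_le_trans (ends_below_pos v x) _.
rewrite -(Q_as _ meas_regular (regular1 x)); last exact: meas_ends_below_all.
apply: prob_mono => //.
  by apply: measurableI; [exact: meas_regular|exact: meas_ends_below_all].
move=> z [rz zv]; apply: hn => j i il; have [aj|aj] := alpha_pos_or_le j.
  have [_ h] := vE j aj; apply: h il; rewrite path_limit_below regularizeE //.
  exact: zv.
have /(Lambda_root _ aj) -> := path_limit_Lambda z j.
by have /(Lambda_root _ aj) -> := Le j.
Qed.

(** The walk itself supplies the approximation: the limit falls into any neighbourhood of [e] with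
    positive probability, and a path converging to such a limit visits the neighbourhood. *)
Lemma Lambda_boundary : Lambda p `<=` DL_boundary w.
Proof.
move=> e Le; split; last first.
  move=> [x _ E]; have := Le (Ordinal (ltnW hd)); rewrite -E.
  set j := Ordinal _; have [aj|aj] := alpha_pos_or_le j.
    by move/(Lambda_end _ aj) => [].
  by move/(Lambda_root _ aj).
move=> B; rewrite nbhsE => -[U [Uop Ue] UB].
have := limit_support o Le Uop Ue.
have mU : measurable (path_limit @^-1` U).
  by rewrite -[_ @^-1` _]setTI; apply: measurable_path_limit => //; exact: sub_sigma_algebra.
rewrite -(Q_as mU meas_regular (regular1 o)) => pos.
have [z [rz Uz]] : regular `&` path_limit @^-1` U !=set0.
  by apply/set0P; apply: contraTneq pos => ->; rewrite measure0 ltxx.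
have : \forall n \near \oo, U (dl_embed (z n)).
  by apply: (path_limit_cvg rz); exact: open_nbhs_nbhs.
move=> [N _ /(_ N (leqnn N)) UN].
by exists (dl_embed (z N)); split; [exists (z N)|exact: UB].
Qed.

Lemma Lambda_trivial : Lambda p = [set omega_pt w] <-> forall j, alpha p j = 0.
Proof.
split=> [E|h].
  have [[j aj]|//] := alpha_pos_or_zero; exfalso.
  have [z _] := exists_regular; have := path_limit_Lambda z; rewrite E => Ez.
  have := path_limit_Lambda z j; rewrite Ez => /(Lambda_end _ aj) [xi xiw].
  by move=> [].
apply/seteqP; split=> e /=.
  move=> Le; apply/functional_extensionality_dep => j.
  by apply/(Lambda_root (e j)); [rewrite h|exact: Le].
by move=> -> j; apply/Lambda_root; rewrite ?h.
Qed.

Lemma limit_no_atom x e : Lambda p <> [set omega_pt w] ->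
  Q x (path_limit @^-1` [set e]) = 0%E.
Proof.
move=> nt; have [[j aj]|/Lambda_trivial//] := alpha_pos_or_zero.
have [Le|Le] := pselect (Lambda p e); last first.
  rewrite (_ : _ @^-1` _ = set0) ?measure0 //; apply/seteqP; split=> // z /= E.
  by apply: Le; rewrite -E; exact: path_limit_Lambda.
have mj k (v : T k) : measurable [set z | below (w k) v (path_limit z k)].
  have := measurable_path_limit measurableT (measurable_below w v).
  by rewrite setTI.
have me : measurable (path_limit @^-1` [set e]).
  rewrite (_ : _ @^-1` _ = [set z | forall k (v : T k),
      below (w k) v (path_limit z k) <-> below (w k) v (e k)]).
    apply: measP_forall => // k; apply: measP_forall => // v.
    by apply: measP_iff => //; exact: measP_const.
  apply/seteqP; split=> z /= E; first by rewrite E.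
  by apply: Lambda_unique => //; exact: path_limit_Lambda.
have := no_end_atom (fun v => below (w j) v (e j)) x aj.
rewrite -(Q_as me meas_regular (regular1 x)); apply: prob0_mono.
- by apply: measurableI => //; exact: meas_regular.
- exact: meas_end_data.
- by move=> z [rz /= E] v; rewrite -E path_limit_below regularizeE.
Qed.
End BoundaryLaw.

Lemma mfun_of d d' (U : measurableType d) (V : measurableType d') (f : U -> V) :
  measurable_fun setT f -> exists g : {mfun U >-> V}, forall u, g u = f u.
Proof.
move=> mf; pose h := isMeasurableFun.Build _ _ _ _ f mf.
pose g : {mfun U >-> V} := HB.pack f h.
by exists g.
Qed.

Theorem mainTheorem14 (R : realType) (d : nat) (hd : (2 <= d)%N)
  (q : 'I_d -> nat) (hq : forall j, (2 <= q j)%N)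
  (T : forall j, homTree (q j)) (w : forall j, tree_end (T j))
  (p : DL w -> DL w -> R)
  (hstoch : stochastic p)
  (hirr : irreducible p)
  (hinv : Gamma_transitive p)
  (hmom : finite_first_moment p)
  (dO : measure_display) (Om : measurableType dO)
  (Pr : DL w -> probability Om R) (Z : nat -> Om -> DL w)
  (hZ : random_walk p Pr Z) :
  (Lambda p `<=` DL_boundary w /\ measurable (Lambda p : set (borel_hat T))) /\
  exists Zoo : {mfun Om >-> borel_hat T},
    let nu x := distribution (Pr x) Zoo in
    [/\ forall om, Lambda p (Zoo om : prod_hat T),
        forall x, {ae Pr x, forall om,
          (fun n => dl_embed (Z n om)) @ \oo --> (Zoo om : prod_hat T)},
        forall x, nu x (Lambda p) = 1%E /\ Lambda p `<=` msupport (nu x),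
        (Lambda p <> [set omega_pt w] ->
           forall x (z : prod_hat T), nu x [set z] = 0%E) /\
        (Lambda p = [set omega_pt w] <-> forall j, alpha p j = 0) &
        (forall x (B : set (borel_hat T)), measurable B ->
           nu x B = \esum_(y in [set: DL w]) ((p x y)%:E * nu y B)%E) /\
        (forall x y, nu x `<< nu y)].
Proof.
have p0 := hstoch.1; have p1 := hstoch.2; have Xc := DL_countable w.
have cylQ := Q_cyl hZ; have irrQ := Q_irr hstoch hirr hZ.
have a0 := sum_alpha hd hq hstoch hinv hmom hZ.
have toroot j x : alpha p j <= 0 -> path_law hZ x (to_root (w j) (fun x : DL w => x j)) = 1%E.
  by move=> aj; exact: (walk_limit hd hq hstoch hirr hinv hmom hZ j).1.
have trap j x : 0 < alpha p j -> path_law hZ x (trapped (w j) (fun x : DL w => x j)) = 1%E.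
  by move=> aj; exact: (walk_limit hd hq hstoch hirr hinv hmom hZ j).2.
have settle j x := walk_settles hd hq hstoch hirr hinv hmom hZ j x.
pose L := path_limit toroot trap settle.
have mL : measurable_fun setT L := measurable_path_limit toroot trap settle.
have mLB B : measurable B -> measurable (L @^-1` B).
  by move=> mB; rewrite -[_ @^-1` _]setTI; exact: mL.
have [|Zoo ZooE] := @mfun_of _ _ Om (borel_hat T) (L \o Zpath Z).
  by apply: measurableT_comp => //; exact: (measurable_Zpath hZ).
have nuE x B : distribution (Pr x) Zoo B = path_law hZ x (L @^-1` B).
  by rewrite /path_law /distribution /pushforward /=; congr (Pr x _);
    apply/seteqP; split=> om /=; rewrite ZooE.
split.
  split; last exact: measurable_Lambda.
  exact: (Lambda_boundary hd hq p0 p1 hinv cylQ irrQ a0 toroot trap settle).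
exists Zoo; split.
- by move=> om; rewrite ZooE; exact: path_limit_Lambda.
- move=> x; exists (Zpath Z @^-1` (~` regular p)); split.
  + rewrite -[_ @^-1` _]setTI; apply: (measurable_Zpath hZ) => //.
    by apply: measurableC; exact: meas_regular.
  + apply/(prob1C (path_law hZ x) (meas_regular p)).
    exact: (regular1 toroot trap settle).
  + move=> om /= ncv rz; apply: ncv; rewrite ZooE.
    exact: (@path_limit_cvg _ _ _ _ _ _ _ toroot trap settle).
- move=> x; split.
    rewrite nuE (_ : _ @^-1` _ = setT) ?probability_setT //.
    by apply/seteqP; split=> // z _; exact: path_limit_Lambda.
  move=> e Le U Uop Ue.
  have : (0 < path_law hZ x (L @^-1` U))%E; last by rewrite -nuE.
  exact: (limit_support hd hq p0 p1 hinv cylQ irrQ a0 toroot trap settle x Le Uop Ue).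
- split; last exact: (Lambda_trivial a0 toroot trap settle).
  move=> nt x e; rewrite nuE.
  exact: (limit_no_atom hd hq p0 p1 hinv cylQ irrQ a0 toroot trap settle).
- split=> [x B mB|x y N yN B mB BN].
    (* The event that the limit lies in [B] is shift invariant: its probability is harmonic in the
       starting point, and irreducibility makes its being null independent of that point. *)
    have h := invariant_markov Xc p0 p1 cylQ x (mLB B mB) (path_limit_invariant toroot trap settle B).
    by rewrite nuE h; apply: eq_esum => y _; rewrite nuE.
  rewrite nuE; apply: (null_all Xc p0 p1 cylQ irrQ (x := y)); first exact: mLB.
    exact: path_limit_invariant.
  by rewrite -nuE; exact: yN.
Qed.
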